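(* Let $m$ be an admissible weight, let $(Y,\|\cdot|Y\|)$ be a Banach space with properties (Y1) and (Y2) with respect to $m$, and let $\mathcal F=\{\psi_x\}_{x\in X}$ be a continuous frame for $\mathcal H$ (as in the context, with $R\in\mathcal A_m$). Suppose that $\mathcal F$ possesses property $D[\delta,m]$ with a corresponding moderate admissible covering $\mathcal U=\mathcal U^\delta=(U_i)_{i\in I}$ of $X$, for some $\delta>0$ such that $$\delta\Big(\|R|\mathcal A_m\|+\max\{C_{m,\mathcal U}\|R|\mathcal A_m\|,\ \|R|\mathcal A_m\|+\delta\}\Big)\le 1,$$ where $C_{m,\mathcal U}$ is the constant with $\sup_{x,y\in U_i}m(x,y)\le C_{m,\mathcal U}$ for all $i\in I$. Choose points $(x_i)_{i\in I}\subset X$ with $x_i\in U_i$. Then $\mathcal F_d:=\{\psi_{x_i}\}_{i\in I}\subset\mathcal K^1_v$ is both an atomic decomposition of $\widetilde{\mathsf{Co}}\,Y$ with corresponding sequence space $Y^\natural=Y^\natural(\mathcal U)$ and a Banach frame for $\mathsf{Co}\,Y$ with corresponding sequence space $Y^\flat=Y^\flat(\mathcal U)$. Moreover, there exists a ''dual frame'' $\widehat{\mathcal F_d}=\{e_i\}_{i\in I}\subset\mathcal H^1_v$ such that: (a) one has the norm equivalences $$\|f|\mathsf{Co}\,Y\|\cong\|(\langle f,\psi_{x_i}\rangle)_{i\in I}|Y^\flat\|\quad (f\in \mathsf{Co}\,Y)\qquad\text{and}\qquad \|f|\widetilde{\mathsf{Co}}\,Y\|\cong\|(\langle f,e_i\rangle)_{i\in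 I}|Y^\natural\|\quad (f\in\widetilde{\mathsf{Co}}\,Y);$$ (b) if $f\in\widetilde{\mathsf{Co}}\,Y$ then $f=\sum_{i\in I}\langle f,e_i\rangle\psi_{x_i}$, with unconditional norm convergence in $\widetilde{\mathsf{Co}}\,Y$ if the finite sequences are dense in $Y^\natural$, and with unconditional convergence in the weak-$*$ topology induced from $(\mathcal H^1_v)^\urcorner$ otherwise; (c) if the finite sequences are dense in $Y^\flat$, then for all $f\in\mathsf{Co}\,Y$ one has $f=\sum_{i\in I}\langle f,\psi_{x_i}\rangle e_i$ with unconditional convergence in the norm of $\mathsf{Co}\,Y$.
   Context: **Frame.** $\mathcal H$ is a separable Hilbert space (inner product linear in the first slot); $X$ is a locally compact, $\sigma$-compact Hausdorff space with positive Radon measure $\mu$, $\operatorname{supp}\mu=X$. A family $\mathcal F=\{\psi_x\}_{x\in X}\subset\mathcal H$ is a continuous frame if there are $0<C_1,C_2<\infty$ with $C_1\|f\|^2\le\int_X|\langle f,\psi_x\rangle|^2d\mu(x)\le C_2\|f\|^2$ for all $f\in\mathcal H$. Standing: $x\mapsto\psi_x$ is weakly continuous and $\sup_x\|\psi_x\|<\infty$. The frame operator is $Sf=\int_X\langle f,\psi_x\rangle\psi_x\,d\mu(x)$ (weakly), bounded, positive, boundedly invertible. Put $Vf(x)=\langle f,\psi_x\rangle$, $Wf(x)=\langle f,S^{-1}\psi_x\rangle$, $R(x,y)=\langle\psi_y,S^{-1}\psi_x\rangle$. **Kernels.** A kernel $K$ on $X\times X$ acts by $K(F)(x)=\int_XF(y)K(x,y)d\mu(y)$.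 $\mathcal A_1$ is the space of measurable kernels with $\|K|\mathcal A_1\|=\max\{\operatorname{ess\,sup}_x\int|K(x,y)|d\mu(y),\operatorname{ess\,sup}_y\int|K(x,y)|d\mu(x)\}<\infty$. A weight $m:X\times X\to\mathbb R$ is admissible if it is continuous, $1\le m(x,y)\le m(x,z)m(z,y)$, $m(x,y)=m(y,x)$ for all $x,y,z$, and $m(x,x)\le C<\infty$ for all $x$. $\mathcal A_m=\{K: Km\in\mathcal A_1\}$, $\|K|\mathcal A_m\|=\|Km|\mathcal A_1\|$. **Space $Y$.** (Y1) $Y$ is a non-trivial Banach space of functions on $X$, continuously embedded in $L^1_{loc}(X,\mu)$, and solid: $F\in L^1_{loc}$, $G\in Y$, $|F|\le|G|$ a.e. imply $F\in Y$, $\|F|Y\|\le\|G|Y\|$. (Y2) for the admissible weight $m$: $\mathcal A_m(Y)\subset Y$ and $\|K(F)|Y\|\le\|K|\mathcal A_m\|\,\|F|Y\|$ for $K\in\mathcal A_m$, $F\in Y$. Standing: $R\in\mathcal A_m$. **Coorbit spaces.** Fix $z\in X$, $v(x)=m(x,z)$; $L^1_v=\{F:Fv\in L^1\}$. $\mathcal H^1_v=\{f\in\mathcal H: Vf\in L^1_v\}$ with norm $\|Vf|L^1_v\|$, $\mathcal K^1_v=\{f\in\mathcal H:Wf\in L^1_v\}$ with norm $\|Wf|L^1_v\|$. $B^\urcorner$ is the anti-dual (continuous conjugate-linear functionals), $\langle f,g\rangle:=f(g)$. One has $\psi_x\in\mathcal K^1_v$, $S^{-1}\psi_x\in\mathcal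 H^1_v$, and $V$, $W$ extend to $(\mathcal K^1_v)^\urcorner$, $(\mathcal H^1_v)^\urcorner$ by $Vf(x)=f(\psi_x)$, $Wf(x)=f(S^{-1}\psi_x)$. $\mathsf{Co}\,Y=\{f\in(\mathcal K^1_v)^\urcorner:Vf\in Y\}$, $\|f|\mathsf{Co}\,Y\|=\|Vf|Y\|$; $\widetilde{\mathsf{Co}}\,Y=\{f\in(\mathcal H^1_v)^\urcorner:Wf\in Y\}$, $\|f|\widetilde{\mathsf{Co}}\,Y\|=\|Wf|Y\|$. Here $\mathcal H$ is regarded as embedded in both anti-duals. **Coverings.** A family $\mathcal U=(U_i)_{i\in I}$ of (measurable) subsets is an admissible covering of $X$ if each $U_i$ is relatively compact with non-void interior, $X=\bigcup_iU_i$, and $\sup_{j\in I}\#\{i\in I:U_i\cap U_j\ne\emptyset\}\le N<\infty$. It is moderate if also $\mu(U_i)\ge D>0$ for all $i$ and $\mu(U_i)\le\widetilde C\mu(U_j)$ whenever $U_i\cap U_j\neq\emptyset$. ($I$ is countable.) **Property $D[\delta,m]$.** $\mathcal F$ possesses property $D[\delta,m]$ if there is a moderate admissible covering $\mathcal U=\mathcal U^\delta$ with $\sup_{x,y\in U_i}m(x,y)\le C_{m,\mathcal U}$ for all $i$, and such that $\operatorname{osc}_{\mathcal U}(x,y):=\sup_{z\in Q_y}|R(x,y)-R(x,z)|$, $Q_y:=\bigcup_{i:\,y\in U_i}U_i$, satisfies $\|\operatorname{osc}_{\mathcal U}|\mathcal A_m\|<\delta$. **Sequence spaces.** $Y^\flat(\mathcal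 U)=\{(\lambda_i)_{i\in I}:\sum_i|\lambda_i|\chi_{U_i}\in Y\}$ with norm $\|\sum_i|\lambda_i|\chi_{U_i}|Y\|$; $Y^\natural(\mathcal U)=\{(\lambda_i)_{i\in I}:\sum_i|\lambda_i|\mu(U_i)^{-1}\chi_{U_i}\in Y\}$ with norm $\|\sum_i|\lambda_i|\mu(U_i)^{-1}\chi_{U_i}|Y\|$. **Atomic decompositions, Banach frames.** A BK-space is a Banach space of sequences in which convergence implies componentwise convergence. $\{g_i\}_{i\in I}\subset B$ is an atomic decomposition for the Banach space $B$ with sequence space $B^\natural$ (a BK-space on $I$) if there are bounded linear functionals $\lambda_i$ on $B$ such that: $(\lambda_i(f))_i\in B^\natural$ and $\|(\lambda_i(f))_i|B^\natural\|\le C_1\|f|B\|$ for all $f\in B$; if $(\lambda_i)_i\in B^\natural$ then $f=\sum_i\lambda_ig_i\in B$ (unconditional convergence in some suitable topology) and $\|f|B\|\le C_2\|(\lambda_i)_i|B^\natural\|$; and $f=\sum_i\lambda_i(f)g_i$ for all $f\in B$. A family $\{h_i\}_{i\in I}$ of bounded functionals on $B$ (here $h_i(f)=\langle f,h_i\rangle$) is a Banach frame for $B$ with sequence space $B^\flat$ (a BK-space) if there is a bounded linear operator $\Omega:B^\flat\to B$ with $\Omega((h_i(f))_i)=f$ for all $f\in B$, and $(h_i(f))_i\in B^\flat$ with $C_1\|f|B\|\le\|(h_i(f))_i|B^\flat\|\le C_2\|f|B\|$ for all $f\in B$. *)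

(* Defs.v *)
From HB Require Import structures.
From mathcomp Require Import all_boot all_order all_algebra finmap.
From mathcomp Require Import sesquilinear complex.
From mathcomp Require Import all_classical all_reals all_analysis.
From mathcomp.analysis Require Import ess_sup_inf.
From mathcomp.analysis Require Export summability.

Set Implicit Arguments.
Unset Strict Implicit.
Unset Printing Implicit Defensive.

Import Order.TTheory GRing.Theory Num.Theory Num.Def.
Import numFieldNormedType.Exports.

Local Open Scope classical_set_scope.
Local Open Scope ring_scope.
Local Open Scope complex_scope.

(* [`|v|] takes its values in the scalar field R[i]; [rnorm v] is the same norm
   read in R. It is used for vectors and for complex numbers. *)
Definition rnorm (R : realType) (V : normedZmodType R[i]) (v : V) : R :=
  complex.Re `|v|.

Notation borel X := (g_sigma_algebraType (@open X)).

Section ComplexIntegral.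
Context (R : realType) d (T : measurableType d).
Variable mu : {measure set T -> \bar R}.

Definition cmeasurable (F : T -> R[i]) : Prop :=
  measurable_fun [set: T] (fun x => complex.Re (F x)) /\
  measurable_fun [set: T] (fun x => complex.Im (F x)).

Definition cintegrable (F : T -> R[i]) : Prop :=
  mu.-integrable [set: T] (fun x => (complex.Re (F x))%:E) /\
  mu.-integrable [set: T] (fun x => (complex.Im (F x))%:E).

Definition cintegral (F : T -> R[i]) : R[i] :=
  (\int[mu]_x complex.Re (F x)) +i* (\int[mu]_x complex.Im (F x)).

End ComplexIntegral.

(* Normed spaces given by a carrier B and a norm n inside an ambient complex
   vector space E; the values of n outside B are irrelevant. *)
Section NormedSubspaces.
Context (R : realType) (E : lmodType R[i]).

Record complete_seminormed (B : set E) (n : E -> R) : Prop := {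
  csn_zero : B 0;
  csn_linear : forall (a : R[i]) f g, B f -> B g -> B (a *: f + g);
  csn_ge0 : forall f, B f -> 0 <= n f;
  csn_scale : forall (a : R[i]) f, B f -> n (a *: f) = rnorm a * n f;
  csn_triangle : forall f g, B f -> B g -> n (f + g) <= n f + n g;
  csn_complete : forall u : nat -> E, (forall k, B (u k)) ->
    (forall eps, 0 < eps -> exists N, forall j k,
      (N <= j)%N -> (N <= k)%N -> n (u j - u k) < eps) ->
    exists2 f, B f & (fun k => n (u k - f)) @ \oo --> (0 : R) }.

Definition banach_space (B : set E) (n : E -> R) : Prop :=
  complete_seminormed B n /\ forall f, B f -> n f = 0 -> f = 0.

Definition bounded_functional (B : set E) (n : E -> R) (l : E -> R[i]) : Prop :=
  (forall (a : R[i]) f g, B f -> B g -> l (a *: f + g) = a * l f + l g) /\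
  exists c : R, forall f, B f -> rnorm (l f) <= c * n f.

(* Unconditional norm convergence is convergence of the net of the partial sums
   over the finite subsets J of I. *)
Definition norm_cvg (I : choiceType) (B : set E) (n : E -> R)
    (s : {fset I} -> E) (f : E) : Prop :=
  (forall J, B (s J)) /\ (fun J => n (s J - f)) @ totally --> (0 : R).

End NormedSubspaces.

Section SequenceSpaces.
Context (R : realType) (I : Type).

Definition BK_space (B : set (I -> R[i])) (n : (I -> R[i]) -> R) : Prop :=
  banach_space B n /\
  forall (s : nat -> I -> R[i]) (l : I -> R[i]),
    (forall k, B (s k)) -> B l -> (fun k => n (s k - l)) @ \oo --> (0 : R) ->
    forall i, (fun k => rnorm (s k i - l i)) @ \oo --> (0 : R).

Definition finite_sequences_dense (B : set (I -> R[i]))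
    (n : (I -> R[i]) -> R) : Prop :=
  forall l eps, B l -> 0 < eps -> exists l',
    [/\ finite_set [set i | l' i != 0], B l' & n (l - l') < eps].

End SequenceSpaces.

Section DiscreteFrames.
Context (R : realType) (E : lmodType R[i]) (I : choiceType).
Variables (B : set E) (n : E -> R).
Variables (Bs : set (I -> R[i])) (ns : (I -> R[i]) -> R).

(* [cvgE s f] is the mode of convergence of the net s of finite partial sums
   to f (the "suitable topology"). *)
Definition atomic_decomposition (cvgE : ({fset I} -> E) -> E -> Prop)
    (g : I -> E) : Prop :=
  [/\ banach_space B n, BK_space Bs ns, (forall i, B (g i)) &
    exists lambda : I -> E -> R[i],
    [/\ forall i, bounded_functional B n (lambda i),
        exists2 C1 : R, 0 < C1 & forall f, B f ->
          Bs (fun i => lambda i f) /\ ns (fun i => lambda i f) <= C1 * n f,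
        exists2 C2 : R, 0 < C2 & forall l, Bs l -> exists f,
          [/\ B f, cvgE (partial_sum (fun i => l i *: g i)) f &
              n f <= C2 * ns l] &
        forall f, B f -> cvgE (partial_sum (fun i => lambda i f *: g i)) f]].

Definition norm_equivalence (h : I -> E -> R[i]) : Prop :=
  exists C1 C2 : R, [/\ 0 < C1, 0 < C2 & forall f, B f ->
    [/\ Bs (fun i => h i f), C1 * n f <= ns (fun i => h i f) &
        ns (fun i => h i f) <= C2 * n f]].

Definition banach_frame (h : I -> E -> R[i]) : Prop :=
  [/\ banach_space B n, BK_space Bs ns,
      (forall i, bounded_functional B n (h i)),
      norm_equivalence h &
      exists Omega : (I -> R[i]) -> E,
      [/\ forall l, Bs l -> B (Omega l),
          forall (a : R[i]) l l', Bs l -> Bs l' ->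
            Omega (a *: l + l') = a *: Omega l + Omega l',
          exists c : R, forall l, Bs l -> n (Omega l) <= c * ns l &
          forall f, B f -> Omega (fun i => h i f) = f]].

End DiscreteFrames.

Definition sigma_compact (X : topologicalType) : Prop :=
  exists K : nat -> set X, (forall k, compact (K k)) /\ \bigcup_k K k = [set: X].

Section MeasureSpace.
Context (R : realType) (X : ptopologicalType).
Variable mu : {measure set (borel X) -> \bar R}.

Definition radon_measure : Prop :=
  [/\ forall K : set X, compact K -> (mu K < +oo)%E,
      forall A : set (borel X), measurable A ->
        mu A = ereal_inf [set mu O | O in [set O : set X | open O /\ A `<=` O]] &
      forall O : set X, open O ->
        mu O = ereal_sup [set mu K | K in [set K : set X | compact K /\ K `<=` O]]].

Definition full_support : Prop :=
  forall O : set X, open O -> O !=set0 -> (0 < mu O)%E.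

Definition admissible_weight (m : X -> X -> R) : Prop :=
  [/\ continuous (fun p : X * X => m p.1 p.2),
      forall x y, 1 <= m x y,
      forall x y z, m x y <= m x z * m z y,
      forall x y, m x y = m y x &
      exists C : R, forall x, m x x <= C].

(* Measurability of a kernel refers to the product of the Borel sigma-algebras. *)
Definition A1_norm (K : X -> X -> R[i]) : \bar R :=
  maxe (ess_sup mu (fun x => \int[mu]_y (rnorm (K x y))%:E)%E)
       (ess_sup mu (fun y => \int[mu]_x (rnorm (K x y))%:E)%E).

Definition A1 : set (X -> X -> R[i]) :=
  [set K | cmeasurable (fun p : borel X * borel X => K p.1 p.2) /\
           (A1_norm K < +oo)%E].

Definition weighted (m : X -> X -> R) (K : X -> X -> R[i]) : X -> X -> R[i] :=
  fun x y => K x y * (m x y)%:C.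

Definition Am (m : X -> X -> R) : set (X -> X -> R[i]) :=
  [set K | A1 (weighted m K)].

Definition Am_norm (m : X -> X -> R) (K : X -> X -> R[i]) : \bar R :=
  A1_norm (weighted m K).

Definition kernel_op (K : X -> X -> R[i]) (F : X -> R[i]) : X -> R[i] :=
  fun x => cintegral mu (fun y => F y * K x y).

Definition L1loc : set (X -> R[i]) :=
  [set F | cmeasurable (F : borel X -> R[i]) /\
    forall K : set X, compact K -> (\int[mu]_(x in K) (rnorm (F x))%:E < +oo)%E].

Definition L1_norm (v : X -> R) (F : X -> R[i]) : \bar R :=
  (\int[mu]_x (rnorm (F x) * v x)%:E)%E.

Definition L1 (v : X -> R) : set (X -> R[i]) :=
  [set F | cmeasurable (F : borel X -> R[i]) /\ (L1_norm v F < +oo)%E].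

(* A Banach function space is a set Y of Borel functions; two functions that
   agree almost everywhere represent the same element, so the norm is definite
   only almost everywhere. Invariance of Y and of its norm under almost
   everywhere equality follows from solidity. *)
Record property_Y1 (Y : set (X -> R[i])) (nY : (X -> R[i]) -> R) : Prop := {
  Y1_complete : complete_seminormed Y nY;
  Y1_definite : forall F, Y F -> nY F = 0 -> {ae mu, forall x, F x = 0};
  Y1_nontrivial : exists2 F, Y F & ~ {ae mu, forall x, F x = 0};
  Y1_L1loc : Y `<=` L1loc;
  Y1_embedding : forall K : set X, compact K -> exists c : R, forall F, Y F ->
    (\int[mu]_(x in K) (rnorm (F x))%:E <= (c * nY F)%:E)%E;
  Y1_solid : forall F G, L1loc F -> Y G ->
    {ae mu, forall x, rnorm (F x) <= rnorm (G x)} -> Y F /\ nY F <= nY G }.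

(* The first clause says that K(F) is defined almost everywhere, which is part
   of the meaning of "K(F) is in Y". *)
Definition property_Y2 (m : X -> X -> R) (Y : set (X -> R[i]))
    (nY : (X -> R[i]) -> R) : Prop :=
  forall K F, Am m K -> Y F ->
    [/\ {ae mu, forall x, cintegrable mu (fun y => F y * K x y)},
        Y (kernel_op K F) &
        ((nY (kernel_op K F))%:E <= Am_norm m K * (nY F)%:E)%E].

Section Coverings.
Variable I : choiceType.
Implicit Type U : I -> set X.

Definition admissible_covering U : Prop :=
  [/\ forall i, measurable (U i : set (borel X)),
      forall i, precompact (U i),
      forall i, (interior (U i)) !=set0,
      \bigcup_i U i = [set: X] &
      exists N : nat, forall j, ([set i | U i `&` U j !=set0] #<= `I_N)%card].

Definition moderate_admissible_covering U : Prop :=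
  [/\ admissible_covering U,
      exists2 D : R, 0 < D & forall i, (D%:E <= mu (U i))%E &
      exists C : R, forall i j, U i `&` U j !=set0 -> (mu (U i) <= C%:E * mu (U j))%E].

Definition Qset U (y : X) : set X := \bigcup_(i in [set i | U i y]) U i.

Definition osc (K : X -> X -> R[i]) U (x y : X) : R[i] :=
  (sup [set rnorm (K x y - K x z) | z in Qset U y])%:C.

(* Property D[delta, m] for a family with kernel K, witnessed by the covering U
   and the constant CmU. *)
Definition property_D (K : X -> X -> R[i]) (m : X -> X -> R) (delta : R) U
    (CmU : R) : Prop :=
  [/\ moderate_admissible_covering U,
      forall i x y, U i x -> U i y -> m x y <= CmU,
      Am m (osc K U) &
      (Am_norm m (osc K U) < delta%:E)%E].

(* [\sum_(i \in _)] ranges over the indices with a nonzero term; for an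
   admissible covering there are only finitely many of them at every point. *)
Definition flat_fun U (l : I -> R[i]) : X -> R[i] := fun x =>
  (\sum_(i \in [set: I]) rnorm (l i) * \1_(U i) x)%:C.

Definition natural_fun U (l : I -> R[i]) : X -> R[i] := fun x =>
  (\sum_(i \in [set: I]) rnorm (l i) * (fine (mu (U i)))^-1 * \1_(U i) x)%:C.

Definition Yflat U (Y : set (X -> R[i])) : set (I -> R[i]) :=
  [set l | Y (flat_fun U l)].
Definition Yflat_norm U (nY : (X -> R[i]) -> R) (l : I -> R[i]) : R :=
  nY (flat_fun U l).

Definition Ynatural U (Y : set (X -> R[i])) : set (I -> R[i]) :=
  [set l | Y (natural_fun U l)].
Definition Ynatural_norm U (nY : (X -> R[i]) -> R) (l : I -> R[i]) : R :=
  nY (natural_fun U l).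

End Coverings.
End MeasureSpace.

Section Hilbert.
Context (R : realType) (H : completeNormedModType R[i]).

Definition separable_space : Prop := exists A : set H, countable A /\ dense A.

(* The anti-dual of the normed space (D, n), D being a subspace of H. An
   anti-linear functional on D is encoded by its extension by 0 to H, so that
   equality of functionals is equality of functions. *)
Definition antidual (D : set H) (n : H -> R) : set (H -> R[i]) :=
  [set f | [/\ forall g, ~ D g -> f g = 0,
    forall (a : R[i]) g h, D g -> D h -> f (a *: g + h) = conjC a * f g + f h &
    exists c : R, forall g, D g -> rnorm (f g) <= c * n g]].

(* Unconditional convergence in the weak-* topology of the anti-dual of D. *)
Definition weakstar_cvg (I : choiceType) (D : set H)
    (s : {fset I} -> H -> R[i]) (f : H -> R[i]) : Prop :=
  forall g, D g -> (fun J => rnorm (s J g - f g)) @ totally --> (0 : R).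

Variable ip : {dot H for (@conjC R[i])}.

Definition hilbert_norm : Prop := forall f : H, ip f f = `|f| ^+ 2.

(* The vector h of H as an element of the anti-dual of D. *)
Definition embed (D : set H) (h : H) : H -> R[i] := patch (fun=> 0) D (ip h).

Section Frame.
Context (X : ptopologicalType).
Variable mu : {measure set (borel X) -> \bar R}.
Variable psi : X -> H.

Definition continuous_frame : Prop :=
  [/\ exists C1 C2 : R, [/\ 0 < C1, 0 < C2 & forall f,
        ((C1 * rnorm f ^+ 2)%:E <= \int[mu]_x (rnorm (ip f (psi x)) ^+ 2)%:E)%E /\
        (\int[mu]_x (rnorm (ip f (psi x)) ^+ 2)%:E <= (C2 * rnorm f ^+ 2)%:E)%E],
      forall f, continuous ((fun x => ip f (psi x)) : X -> R[i]^o) &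
      exists M : R, forall x, rnorm (psi x) <= M].

(* For a continuous frame the vector and the preimage below exist and are
   unique; the default value 0 is never used. *)
Definition frame_op (f : H) : H :=
  xget 0 [set h | forall g,
    ip h g = cintegral mu (fun x => ip f (psi x) * ip (psi x) g)].

Definition frame_op_inv (f : H) : H := xget 0 [set h | frame_op h = f].

Definition dual_frame (x : X) : H := frame_op_inv (psi x).

Definition frame_kernel (x y : X) : R[i] := ip (psi y) (dual_frame x).

(* V and W on H are the maps f |-> (ip f) \o psi and f |-> (ip f) \o dual_frame;
   their extensions to the anti-duals are f |-> f \o psi, f |-> f \o dual_frame. *)
Definition H1 (v : X -> R) : set H := [set f | L1 mu v (ip f \o psi)].
Definition H1_norm (v : X -> R) (f : H) : R := fine (L1_norm mu v (ip f \o psi)).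

Definition K1 (v : X -> R) : set H := [set f | L1 mu v (ip f \o dual_frame)].
Definition K1_norm (v : X -> R) (f : H) : R :=
  fine (L1_norm mu v (ip f \o dual_frame)).

Definition Co (v : X -> R) (Y : set (X -> R[i])) : set (H -> R[i]) :=
  [set f | antidual (K1 v) (K1_norm v) f /\ Y (f \o psi)].
Definition Co_norm (nY : (X -> R[i]) -> R) (f : H -> R[i]) : R := nY (f \o psi).

Definition Co_tilde (v : X -> R) (Y : set (X -> R[i])) : set (H -> R[i]) :=
  [set f | antidual (H1 v) (H1_norm v) f /\ Y (f \o dual_frame)].
Definition Co_tilde_norm (nY : (X -> R[i]) -> R) (f : H -> R[i]) : R :=
  nY (f \o dual_frame).

End Frame.
End Hilbert.

(* Main.v *)
(* Write [K] for the kernel [R] of the paper, which is Hermitian. The maps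
   [f |-> V f] and [f |-> W f] identify [Co Y] and the coorbit space [Co~ Y] with
   one and the same space [Z Y] of the [F] in [Y] such that
   [F(x) = \int F(y) K(x, y) dy] at every point [x].

   Let [(c_i)] be a measurable partition of [X] subordinate to the covering. On
   [Z Y] the operator [U F = \sum_i mu(c_i) F(x_i) K(., x_i)] satisfies
   [|F - U F| <= dl * (2 |K| + dl) * |F|] with [dl] the norm of the oscillation
   kernel, hence it is invertible by a Neumann series. So [F] can be recovered
   from its samples [F(x_i)] (Banach frame), and [F = U (U^-1 F)] is an expansion
   in the atoms [K(., x_i)] (atomic decomposition). The vector [e_i] is the one
   with transform [U^-1 (mu(c_i) K(., x_i))]; its pairing with [f] is the i-th
   coefficient because [U] is self-adjoint for the pairing with [Z (L^1_v)].

   Duality enters only through [L^1_v], where finite sequences are dense: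
   applying an anti-linear functional [f] to [g = U (U^-1 g)] term by term shows
   that [f \o psi] is itself a synthesized function, hence lies in [Z Y] as soon
   as it lies in [Y]. *)

Require Import Defs.
From HB Require Import structures.
From mathcomp Require Import all_boot all_order all_algebra finmap.
From mathcomp Require Import sesquilinear complex.
From mathcomp Require Import all_classical all_reals all_analysis.
From mathcomp.analysis Require Import ess_sup_inf measurable_realfun.
From mathcomp Require Import ring lra.

Set Implicit Arguments.
Unset Strict Implicit.
Unset Printing Implicit Defensive.

Import Order.TTheory GRing.Theory Num.Theory Num.Def.
Import numFieldNormedType.Exports.

Local Open Scope classical_set_scope.
Local Open Scope ring_scope.

(** * Complex-valued functions *)

(** The smallness condition concerns kernels up to null sets, whereas samples are values at points,
    which may themselves form a null set. Hence oscillation estimates for [F] hold for almost every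
    [y] but for all [y'] in the same member of the covering. The error [F - U F] splits into
    [K(x,y) (F(y) - F(x_i))], of norm at most [dl nR |F|], and [(K(x,y) - K(x,x_i)) F(x_i)], of norm
    at most [dl (nR + dl) |F|]; the sum of the two factors is [theta], and the condition on [delta]
    makes it less than 1. The Neumann series gives one inverse of [U] for each space [Z Y]. They are
    tied together by injectivity of [U] on a common ambient space [Zv] of functions growing at most
    like [v]; there no Neumann series is at hand, and injectivity follows by duality from
    surjectivity on [Z L1v]. So the duals [e_i], built in [Z L1v], have transforms in [Z Y] as well.
    [Y] and [L^1_v] are two instances of one interface [core_space], and the frame and its canonical
    dual form a symmetric pair, so both coorbit spaces are one construction with the roles
    exchanged. *)

Section RNorm.
Context (R : realType).
Implicit Types a z : R[i].
Local Open Scope complex_scope.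

Lemma rnormE (V : normedZmodType R[i]) (v : V) : `|v| = (rnorm v)%:C.
Proof. by rewrite /rnorm; have := normr_ge0 v; rewrite lecE /= => /andP[/eqP h _]; case: `|v| h => ? ? /= ->. Qed.

Lemma rnorm_ge0 (V : normedZmodType R[i]) (v : V) : 0 <= rnorm v.
Proof. by rewrite -lecR -rnormE normr_ge0. Qed.

Lemma rnorm0 (V : normedZmodType R[i]) : rnorm (0 : V) = 0.
Proof. by rewrite /rnorm normr0. Qed.

Lemma rnorm0_eq0 (V : normedZmodType R[i]) (v : V) : rnorm v = 0 -> v = 0.
Proof. by move=> h; apply/eqP; rewrite -normr_eq0 rnormE h. Qed.

Lemma rnormN (V : normedZmodType R[i]) (v : V) : rnorm (- v) = rnorm v.
Proof. by rewrite /rnorm normrN. Qed.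

Lemma rnormD (V : normedZmodType R[i]) (u v : V) : rnorm (u + v) <= rnorm u + rnorm v.
Proof. by rewrite -lecR raddfD /= -!rnormE ler_normD. Qed.

Lemma rnormB (V : normedZmodType R[i]) (u v : V) : rnorm (u - v) <= rnorm u + rnorm v.
Proof. by rewrite -(rnormN v) rnormD. Qed.

Lemma rnorm_distC (V : normedZmodType R[i]) (u v : V) : rnorm (u - v) = rnorm (v - u).
Proof. by rewrite -rnormN opprB. Qed.

Lemma rnorm_distD (V : normedZmodType R[i]) (w u v : V) :
  rnorm (u - v) <= rnorm (u - w) + rnorm (w - v).
Proof. by rewrite -[X in rnorm X](subrKA w) rnormD. Qed.

Lemma rnorm_le_dist (V : normedZmodType R[i]) (u v : V) :
  rnorm u <= rnorm v + rnorm (u - v).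
Proof. by rewrite -[X in rnorm X <= _](subrK v) addrC rnormD. Qed.

Lemma rnorm_distdist (V : normedZmodType R[i]) (u v : V) :
  `|rnorm u - rnorm v| <= rnorm (u - v).
Proof.
have h1 := rnorm_le_dist u v; have h2 := rnorm_le_dist v u.
by rewrite ler_norml; apply/andP; split; rewrite 1?(rnorm_distC v) in h2 *; lra.
Qed.

Lemma rnormM a z : rnorm (a * z) = rnorm a * rnorm z.
Proof. by apply: complexI; rewrite rmorphM /= -!rnormE normrM. Qed.

Lemma rnormC (r : R) : rnorm (r%:C) = `|r|.
Proof. by rewrite /rnorm normc_def /= expr0n addr0 sqrtr_sqr. Qed.

Lemma rnorm1 : rnorm (1 : R[i]) = 1.
Proof. by rewrite (rnormC 1) normr1. Qed.

Lemma rnorm_conj z : rnorm (z^*%R) = rnorm z.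
Proof. by rewrite /rnorm norm_conjC. Qed.

Lemma rnorm_sqr z : rnorm z ^+ 2 = complex.Re z ^+ 2 + complex.Im z ^+ 2.
Proof. by apply: complexI; rewrite rmorphXn /= -rnormE -add_Re2_Im2. Qed.

Lemma norm_Re_le z : `|complex.Re z| <= rnorm z.
Proof.
rewrite -(@ler_pXn2r _ 2) ?nnegrE ?rnorm_ge0 //.
by rewrite rnorm_sqr real_normK ?num_real // lerDl sqr_ge0.
Qed.

Lemma norm_Im_le z : `|complex.Im z| <= rnorm z.
Proof.
rewrite -(@ler_pXn2r _ 2) ?nnegrE ?rnorm_ge0 //.
by rewrite rnorm_sqr real_normK ?num_real // lerDr sqr_ge0.
Qed.

Lemma Re_le_rnorm z : complex.Re z <= rnorm z.
Proof. exact: le_trans (ler_norm _) (norm_Re_le z). Qed.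

Lemma rnorm_le_ReIm z : rnorm z <= `|complex.Re z| + `|complex.Im z|.
Proof.
rewrite -(@ler_pXn2r _ 2) ?nnegrE ?rnorm_ge0 ?addr_ge0 //.
rewrite rnorm_sqr -(real_normK (num_real (complex.Re z))).
rewrite -(real_normK (num_real (complex.Im z))).
have h1 := normr_ge0 (complex.Re z); have h2 := normr_ge0 (complex.Im z); nra.
Qed.

Lemma rnorm_conjM z : z * z^*%R = (rnorm z ^+ 2)%:C.
Proof. by rewrite -normCK rnormE rmorphXn. Qed.

Lemma rnorm_sum (V : normedZmodType R[i]) (J : Type) (r : seq J) (P : pred J) (F : J -> V) :
  rnorm (\sum_(j <- r | P j) F j) <= \sum_(j <- r | P j) rnorm (F j).
Proof.
elim/big_ind2: _ => [|x y u w hx hu|//]; first by rewrite rnorm0.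
exact: le_trans (rnormD _ _) (lerD _ _).
Qed.
End RNorm.

(** Complex limits are phrased throughout as real limits of [rnorm] of a difference, so uniqueness
    has to be derived in that form. *)
Lemma rnorm_cvg_unique (R : realType) (J : Type) (FF : set_system J) {PF : ProperFilter FF}
  (u : J -> R[i]) (l l' : R[i]) :
  rnorm (u j - l) @[j --> FF] --> (0 : R) ->
  rnorm (u j - l') @[j --> FF] --> (0 : R) -> l = l'.
Proof.
move=> h h'; apply/eqP; rewrite -subr_eq0; apply/eqP/rnorm0_eq0/eqP.
rewrite eq_le rnorm_ge0 andbT.
apply: (@cvgr_to_ge J FF PF R (fun j => rnorm (u j - l) + rnorm (u j - l'))).
  by rewrite -[X in _ --> X](addr0 0); exact: cvgD.
by apply: nearW => j; rewrite (le_trans (rnorm_distD (u j) _ _)) // lerD2r rnorm_distC.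
Qed.

Lemma rnorm_cauchy_cvg (R : realType) (u : nat -> R[i]) :
  (forall e, 0 < e -> exists N, forall j k, (N <= j)%N -> (N <= k)%N ->
     rnorm (u j - u k) < e) ->
  exists l : R[i], rnorm (u k - l) @[k --> \oo] --> (0 : R).
Proof.
move=> uC.
have cvgp (f : R[i] -> R) : (forall a b, `|f a - f b| <= rnorm (a - b)) ->
    exists l : R, f (u k) @[k --> \oo] --> l.
  move=> fl; suff : cvg (f (u k) @[k --> \oo]) by move=> h; exists (lim (f (u k) @[k --> \oo])).
  apply/cauchy_cvgP; apply: cauchy_exP => e e0; have [N hN] := uC e e0.
  exists (f (u N)); exists N => // k /= Nk; rewrite /ball /=.
  exact: le_lt_trans (fl _ _) (hN _ _ (leqnn N) Nk).
have [a ha] : exists a : R, complex.Re (u k) @[k --> \oo] --> a.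
  by apply: cvgp => a b; rewrite -raddfB norm_Re_le.
have [b hb] : exists b : R, complex.Im (u k) @[k --> \oo] --> b.
  by apply: cvgp => c b; rewrite -raddfB norm_Im_le.
exists (Complex a b).
apply: (@squeeze_cvgr _ _ _ _ (cst 0)
  (fun k => `|complex.Re (u k) - a| + `|complex.Im (u k) - b|)).
- by apply: nearW => k; rewrite rnorm_ge0 (le_trans (rnorm_le_ReIm _)) // !raddfB.
- exact: cvg_cst.
- rewrite -[X in _ --> X](addr0 0) -[X in X + _](normr0 R) -[X in _ + X](normr0 R).
  rewrite -[X in `|X| + _](subrr a) -[X in _ + `|X|](subrr b).
  by apply: cvgD; apply: cvg_norm; apply: cvgB => //; exact: cvg_cst.
Qed.

Section CMeasurable.
Context (R : realType) d (T : measurableType d).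
Implicit Types F G : T -> R[i].
Local Open Scope complex_scope.

Lemma cmeas_real (f : T -> R) :
  measurable_fun [set: T] f -> cmeasurable (fun x => (f x)%:C).
Proof. by move=> mf; split => //=; apply: measurable_cst. Qed.

Lemma cmeas_cst (a : R[i]) : cmeasurable (fun _ : T => a).
Proof. by split; apply: measurable_cst. Qed.

Lemma cmeasD F G : cmeasurable F -> cmeasurable G -> cmeasurable (fun x => F x + G x).
Proof.
move=> [f1 f2] [g1 g2]; split.
  by under eq_fun do rewrite raddfD /=; apply: measurable_funD.
by under eq_fun do rewrite raddfD /=; apply: measurable_funD.
Qed.

Lemma ReM (a b : R[i]) : complex.Re (a * b) =
  complex.Re a * complex.Re b - complex.Im a * complex.Im b.
Proof. by case: a b => [? ?] [? ?]. Qed.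

Lemma ImM (a b : R[i]) : complex.Im (a * b) =
  complex.Re a * complex.Im b + complex.Im a * complex.Re b.
Proof. by case: a b => [? ?] [? ?]. Qed.

Lemma Re_conj (a : R[i]) : complex.Re (conjC a) = complex.Re a.
Proof. by case: a. Qed.

Lemma Im_conj (a : R[i]) : complex.Im (conjC a) = - complex.Im a.
Proof. by case: a. Qed.

Lemma cmeasM F G : cmeasurable F -> cmeasurable G -> cmeasurable (fun x => F x * G x).
Proof.
move=> [f1 f2] [g1 g2]; split.
  by under eq_fun do rewrite ReM; apply: measurable_funB; apply: measurable_funM.
by under eq_fun do rewrite ImM; apply: measurable_funD; apply: measurable_funM.
Qed.

Lemma cmeasZ a F : cmeasurable F -> cmeasurable (fun x => a * F x).
Proof. exact/cmeasM/cmeas_cst. Qed.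

Lemma cmeasN F : cmeasurable F -> cmeasurable (fun x => - F x).
Proof. by move=> mF; under eq_fun do rewrite -mulN1r; apply: cmeasZ. Qed.

Lemma cmeasB F G : cmeasurable F -> cmeasurable G -> cmeasurable (fun x => F x - G x).
Proof. by move=> mF mG; apply: cmeasD => //; apply: cmeasN. Qed.

Lemma cmeas_conj F : cmeasurable F -> cmeasurable (fun x => conjC (F x)).
Proof.
move=> [f1 f2]; split; first by under eq_fun do rewrite Re_conj.
by under eq_fun do rewrite Im_conj; apply: measurableT_comp.
Qed.

Lemma cmeas_sum (J : Type) (s : seq J) (F : J -> T -> R[i]) :
  (forall j, cmeasurable (F j)) -> cmeasurable (fun x => \sum_(j <- s) F j x).
Proof.
move=> mF; elim: s => [|j s ih].
  by under eq_fun do rewrite big_nil; apply: cmeas_cst.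
by under eq_fun do rewrite big_cons; apply: cmeasD.
Qed.

Lemma cmeas_rnorm F : cmeasurable F -> measurable_fun [set: T] (fun x => rnorm (F x)).
Proof.
move=> [f1 f2].
have -> : (fun x => rnorm (F x)) =
    Num.sqrt \o (fun x => complex.Re (F x) ^+ 2 + complex.Im (F x) ^+ 2).
  by apply/funext => x /=; rewrite -rnorm_sqr sqrtr_sqr ger0_norm ?rnorm_ge0.
apply: measurableT_comp; first by apply: continuous_measurable_fun; exact: sqrt_continuous.
by apply: measurable_funD; apply: measurable_funX.
Qed.

Lemma cvg_Re (I : Type) (FF : set_system I) {_ : Filter FF} (u : I -> R[i]) l :
  rnorm (u i - l) @[i --> FF] --> (0 : R) ->
  complex.Re (u i) @[i --> FF] --> complex.Re l.
Proof.
move=> h; apply/cvgrPdist_lt => e e0; move/cvgrPdist_lt: h => /(_ e e0).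
apply: filterS => i; rewrite sub0r normrN ger0_norm ?rnorm_ge0 //.
by apply: le_lt_trans; rewrite rnorm_distC -raddfB norm_Re_le.
Qed.

Lemma cvg_Im (I : Type) (FF : set_system I) {_ : Filter FF} (u : I -> R[i]) l :
  rnorm (u i - l) @[i --> FF] --> (0 : R) ->
  complex.Im (u i) @[i --> FF] --> complex.Im l.
Proof.
move=> h; apply/cvgrPdist_lt => e e0; move/cvgrPdist_lt: h => /(_ e e0).
apply: filterS => i; rewrite sub0r normrN ger0_norm ?rnorm_ge0 //.
by apply: le_lt_trans; rewrite rnorm_distC -raddfB norm_Im_le.
Qed.

Lemma cmeas_lim (u : nat -> T -> R[i]) F : (forall n, cmeasurable (u n)) ->
  (forall x, rnorm (u n x - F x) @[n --> \oo] --> (0 : R)) -> cmeasurable F.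
Proof.
move=> mu uF; split.
  apply: (@measurable_fun_cvg _ _ _ _ (fun n x => complex.Re (u n x))) => [n|x _].
    exact: (mu n).1.
  exact: cvg_Re.
apply: (@measurable_fun_cvg _ _ _ _ (fun n x => complex.Im (u n x))) => [n|x _].
  exact: (mu n).2.
exact: cvg_Im.
Qed.
End CMeasurable.

(** * Integration of complex-valued functions *)

Section CIntegral.
Context (R : realType) d (T : measurableType d).
Variable mu : {measure set T -> \bar R}.
Implicit Types (F G : T -> R[i]) (f g : T -> R).
Local Open Scope complex_scope.

Lemma integrable_nnP f : measurable_fun [set: T] f -> (forall x, 0 <= f x) ->
  (\int[mu]_x (f x)%:E < +oo)%E -> mu.-integrable [set: T] (EFin \o f).
Proof.
move=> mf f0 h; apply/integrableP; split; first exact/measurable_EFinP.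
by under eq_integral => x _ do rewrite /= ger0_norm //.
Qed.

Lemma nnint_le f g : measurable_fun [set: T] f -> measurable_fun [set: T] g ->
  (forall x, 0 <= f x) -> {ae mu, forall x, f x <= g x} ->
  (\int[mu]_x (f x)%:E <= \int[mu]_x (g x)%:E)%E.
Proof.
move=> mf mg f0 fg.
(* On a null set [g] may lie below [f] and even be negative; passing to the maximum makes the
   comparison hold everywhere. *)
have -> : (\int[mu]_x (g x)%:E)%E = (\int[mu]_x (Num.max (f x) (g x))%:E)%E.
  apply: ae_eq_integral => //; try exact/measurable_EFinP.
    by apply/measurable_EFinP/measurable_maxr.
  by apply: filterS fg => x fgx _; rewrite max_r.
apply: ge0_le_integral => //; try exact/measurable_EFinP.
- by move=> x _; rewrite lee_fin.
- by apply/measurable_EFinP/measurable_maxr.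
- by move=> x _; rewrite lee_fin le_max lexx.
Qed.

Lemma nnintZ (c : R) f : measurable_fun [set: T] f -> (forall x, 0 <= f x) -> 0 <= c ->
  (\int[mu]_x (c * f x)%:E = c%:E * \int[mu]_x (f x)%:E)%E.
Proof.
move=> mf f0 c0; under eq_integral => x _ do rewrite EFinM.
by rewrite ge0_integralZl_EFin //; [move=> x _; rewrite lee_fin|exact/measurable_EFinP].
Qed.

Lemma nnintD f g : measurable_fun [set: T] f -> (forall x, 0 <= f x) ->
  measurable_fun [set: T] g -> (forall x, 0 <= g x) ->
  (\int[mu]_x (f x + g x)%:E = \int[mu]_x (f x)%:E + \int[mu]_x (g x)%:E)%E.
Proof.
move=> mf f0 mg g0; under eq_integral => x _ do rewrite EFinD.
by rewrite ge0_integralD //; try (by move=> x _; rewrite lee_fin);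
  exact/measurable_EFinP.
Qed.

Lemma cintegrableP F : cintegrable mu F <->
  cmeasurable F /\ (\int[mu]_x (rnorm (F x))%:E < +oo)%E.
Proof.
split=> [[/integrableP[m1 i1] /integrableP[m2 i2]]|[mF iF]].
  have mF : cmeasurable F by split; exact/measurable_EFinP.
  split => //.
  apply: (@le_lt_trans _ _ (\int[mu]_x (`|complex.Re (F x)| + `|complex.Im (F x)|)%:E)%E).
    apply: nnint_le.
    - exact: cmeas_rnorm.
    - by apply: measurable_funD; apply: measurableT_comp => //; case: mF.
    - by move=> x; exact: rnorm_ge0.
    - by apply: aeW => x; exact: rnorm_le_ReIm.
  case: mF => mR mI.
  have mr : measurable_fun [set: T] (fun x => `|complex.Re (F x)|) by exact: measurableT_comp mR.
  have mi : measurable_fun [set: T] (fun x => `|complex.Im (F x)|) by exact: measurableT_comp mI.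
  by rewrite (nnintD mr _ mi) // lte_add_pinfty.
have iF' : mu.-integrable [set: T] (EFin \o (fun x => rnorm (F x))).
  by apply: integrable_nnP => //; [exact: cmeas_rnorm|move=> x; exact: rnorm_ge0].
split; apply: (le_integrable measurableT _ _ iF').
- by apply/measurable_EFinP; case: mF.
- by move=> x _; rewrite /= lee_fin [leRHS]ger0_norm ?rnorm_ge0 ?norm_Re_le.
- by apply/measurable_EFinP; case: mF.
- by move=> x _; rewrite /= lee_fin [leRHS]ger0_norm ?rnorm_ge0 ?norm_Im_le.
Qed.

Lemma cint_meas F : cintegrable mu F -> cmeasurable F.
Proof. by case/cintegrableP. Qed.

Lemma cint_le F g : cmeasurable F -> measurable_fun [set: T] g ->
  {ae mu, forall x, rnorm (F x) <= g x} ->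
  (\int[mu]_x (g x)%:E < +oo)%E -> cintegrable mu F.
Proof.
move=> mF mg Fg ig; apply/cintegrableP; split => //.
apply: le_lt_trans ig; apply: nnint_le => //; first exact: cmeas_rnorm.
by move=> x; exact: rnorm_ge0.
Qed.

Lemma cintZ a F : cintegrable mu F -> cintegrable mu (fun x => a * F x).
Proof.
move=> /cintegrableP[mF iF]; apply/cintegrableP; split; first exact: cmeasZ.
under eq_integral => x _ do rewrite rnormM.
rewrite nnintZ ?rnorm_ge0 //; first by rewrite lte_mul_pinfty ?lee_fin ?rnorm_ge0.
  exact: cmeas_rnorm.
by move=> x; exact: rnorm_ge0.
Qed.

Lemma cintD F G : cintegrable mu F -> cintegrable mu G ->
  cintegrable mu (fun x => F x + G x).
Proof.
move=> [f1 f2] [g1 g2]; split.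
  by under eq_fun do rewrite raddfD EFinD; apply: integrableD.
by under eq_fun do rewrite raddfD EFinD; apply: integrableD.
Qed.

Lemma cintN F : cintegrable mu F -> cintegrable mu (fun x => - F x).
Proof. by move=> iF; under eq_fun do rewrite -mulN1r; apply: cintZ. Qed.

Lemma cintB F G : cintegrable mu F -> cintegrable mu G ->
  cintegrable mu (fun x => F x - G x).
Proof. by move=> iF iG; apply: cintD => //; apply: cintN. Qed.

Lemma cint0 : cintegrable mu (fun _ => 0).
Proof. by split => /=; exact: integrable0. Qed.

Lemma cint_conj F : cintegrable mu F -> cintegrable mu (fun x => conjC (F x)).
Proof.
move=> /cintegrableP[mF iF]; apply/cintegrableP; split; first exact: cmeas_conj.
by under eq_integral => x _ do rewrite rnorm_conj.
Qed.

Lemma cintegralD F G : cintegrable mu F -> cintegrable mu G ->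
  cintegral mu (fun x => F x + G x) = cintegral mu F + cintegral mu G.
Proof.
move=> [f1 f2] [g1 g2]; rewrite /cintegral.
under eq_Rintegral do rewrite raddfD.
under [X in _ +i* X]eq_Rintegral do rewrite raddfD.
by rewrite /= !RintegralD.
Qed.

Lemma cintegralZ a F : cintegrable mu F ->
  cintegral mu (fun x => a * F x) = a * cintegral mu F.
Proof.
case: a => [a b] [f1 f2]; rewrite /cintegral.
under eq_Rintegral do rewrite ReM.
under [X in _ +i* X]eq_Rintegral do rewrite ImM.
have i1 c : mu.-integrable [set: T] (EFin \o (fun x => c * complex.Re (F x))).
  exact: (integrableZl _ c f1).
have i2 c : mu.-integrable [set: T] (EFin \o (fun x => c * complex.Im (F x))).
  exact: (integrableZl _ c f2).
rewrite /= RintegralB ?RintegralD //; try exact: i1; try exact: i2.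
by rewrite !RintegralZl //.
Qed.

Lemma cintegralN F : cintegrable mu F ->
  cintegral mu (fun x => - F x) = - cintegral mu F.
Proof.
by move=> iF; rewrite -mulN1r -cintegralZ //; congr cintegral; apply/funext => x; rewrite mulN1r.
Qed.

Lemma cintegralB F G : cintegrable mu F -> cintegrable mu G ->
  cintegral mu (fun x => F x - G x) = cintegral mu F - cintegral mu G.
Proof. by move=> iF iG; rewrite cintegralD ?cintegralN //; exact: cintN. Qed.

Lemma cintegral0 : cintegral mu (fun _ => 0) = 0.
Proof. by rewrite /cintegral /= /Rintegral integral0. Qed.

Lemma cintegral_conj F : cintegrable mu F ->
  cintegral mu (fun x => conjC (F x)) = conjC (cintegral mu F).
Proof.
move=> [f1 f2]; rewrite /cintegral.
under eq_Rintegral do rewrite Re_conj.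
under [X in _ +i* X]eq_Rintegral do rewrite Im_conj -mulN1r.
by rewrite RintegralZl // mulN1r.
Qed.

Lemma cint_sum (J : Type) (s : seq J) (F : J -> T -> R[i]) :
  (forall j, cintegrable mu (F j)) -> cintegrable mu (fun x => \sum_(j <- s) F j x).
Proof.
move=> iF; elim: s => [|j s ih]; first by under eq_fun do rewrite big_nil; exact: cint0.
by under eq_fun do rewrite big_cons; apply: cintD.
Qed.

Lemma cintegral_sum (J : Type) (s : seq J) (F : J -> T -> R[i]) :
  (forall j, cintegrable mu (F j)) ->
  cintegral mu (fun x => \sum_(j <- s) F j x) = \sum_(j <- s) cintegral mu (F j).
Proof.
move=> iF; elim: s => [|j s ih].
  by under eq_fun do rewrite big_nil; rewrite big_nil cintegral0.
under eq_fun do rewrite big_cons; rewrite big_cons cintegralD ?ih //.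
exact: cint_sum.
Qed.

Lemma cintegral_real f : cintegral mu (fun x => (f x)%:C) = (\int[mu]_x f x)%:C.
Proof. by rewrite /cintegral /= /Rintegral integral0. Qed.

Lemma rnorm_cintegral F : cintegrable mu F ->
  ((rnorm (cintegral mu F))%:E <= \int[mu]_x (rnorm (F x))%:E)%E.
Proof.
move=> iF; have [mF fF] := (cintegrableP F).1 iF.
set z := cintegral mu F.
have [z0|z0] := eqVneq z 0.
  rewrite z0 rnorm0; apply: integral_ge0 => x _; rewrite lee_fin; exact: rnorm_ge0.
have nz0 : rnorm z != 0 by apply: contra_neq z0; exact: rnorm0_eq0.
(* A unimodular factor rotating the integral onto the positive axis, where its modulus is the
   integral of a real part. *)
pose u := conjC z / (rnorm z)%:C.
have uz : u * z = (rnorm z)%:C.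
  rewrite /u mulrAC (mulrC (conjC z)) rnorm_conjM expr2 rmorphM /= mulfK //.
  by rewrite fmorph_eq0.
have nu : rnorm u = 1.
  by rewrite /u rnormM rnorm_conj -fmorphV rnormC ger0_norm ?invr_ge0 ?rnorm_ge0 // divff.
have iuF := cintZ u iF.
have -> : (rnorm z)%:E = (\int[mu]_x (complex.Re (u * F x))%:E)%E.
  have := cintegralZ u iF; rewrite -/z uz => /(congr1 (@complex.Re R)) /= <-.
  rewrite /Rintegral fineK //; exact: (integrable_fin_num _ iuF.1).
have iN : mu.-integrable [set: T] (EFin \o (fun x => rnorm (F x))).
  by apply: integrable_nnP => //; [exact: cmeas_rnorm|move=> x; exact: rnorm_ge0].
apply: le_integral => //; first exact: iuF.1.
move=> x _; rewrite lee_fin.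
by rewrite (le_trans (Re_le_rnorm _)) // rnormM nu mul1r.
Qed.

Lemma rnorm_cintegral_le F c : cintegrable mu F ->
  (\int[mu]_x (rnorm (F x))%:E <= c%:E)%E -> rnorm (cintegral mu F) <= c.
Proof. by move=> iF h; rewrite -lee_fin (le_trans (rnorm_cintegral iF)). Qed.

Lemma cint_dominated (u : nat -> T -> R[i]) F g :
  (forall n, cmeasurable (u n)) -> measurable_fun [set: T] g ->
  (forall x, rnorm (u n x - F x) @[n --> \oo] --> (0 : R)) ->
  (forall n x, rnorm (u n x) <= g x) -> (\int[mu]_x (g x)%:E < +oo)%E ->
  [/\ cintegrable mu F, forall x, rnorm (F x) <= g x &
      rnorm (cintegral mu (u n) - cintegral mu F) @[n --> \oo] --> (0 : R)].
Proof.
move=> mu_ mg uF ug ig.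
have mF : cmeasurable F by exact: cmeas_lim uF.
have g0 x : 0 <= g x by exact: le_trans (rnorm_ge0 _) (ug 0%N x).
have Fg x : rnorm (F x) <= g x.
  apply/ler_addgt0Pr => e e0.
  have /cvgrPdist_lt/(_ e e0)[N _ /(_ N)/=] := uF x.
  rewrite leqnn sub0r normrN ger0_norm ?rnorm_ge0 // => /(_ isT) h.
  by rewrite (le_trans (rnorm_le_dist _ (u N x))) // lerD // rnorm_distC ltW.
have ui n : cintegrable mu (u n) by apply: cint_le ig => //; apply: aeW => x; exact: ug.
have iF : cintegrable mu F by apply: cint_le ig => //; apply: aeW => x; exact: Fg.
split => //.
(* Applied to the real functions [|u_n - F|], with limit 0 and majorant [2 g]; this controls the
   real and imaginary parts at once. *)
have [] := @dominated_convergence _ _ _ mu _ measurableT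
  (fun n x => (rnorm (u n x - F x))%:E) (cst 0%E) (fun x => (2 * g x)%:E).
- by move=> n; apply/measurable_EFinP/cmeas_rnorm/cmeasB.
- exact: measurable_cst.
- by apply: aeW => x _; apply: cvg_EFin; [exact: nearW|exact: uF].
- apply: (@integrable_nnP (fun x => 2 * g x)).
  + exact: measurable_funM.
  + by move=> x; rewrite mulr_ge0.
  + by rewrite nnintZ // lte_mul_pinfty.
- apply: aeW => x n _; rewrite lee_fin ger0_norm ?rnorm_ge0 //.
  by rewrite (le_trans (rnormB _ _)) // mulr_natl mulr2n lerD.
move=> _ _; rewrite integral0 => h.
apply: (@squeeze_cvgr _ _ _ _ (cst 0) (fun n => fine (\int[mu]_x (rnorm (u n x - F x))%:E)%E)).
- apply: nearW => n; rewrite rnorm_ge0 /=.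
  rewrite -cintegralB //; apply: rnorm_cintegral_le; first exact: cintB.
  by rewrite fineK // ge0_fin_numE; [case/cintegrableP: (cintB (ui n) iF)|
    apply: integral_ge0 => x _; rewrite lee_fin rnorm_ge0].
- exact: cvg_cst.
- exact: (fine_cvg h).
Qed.
End CIntegral.

(** * Sums over a locally finite covering *)

#[local] Existing Instance totally_filter.

Section LocallyFiniteSums.
Context (R : realType) d (T : measurableType d) (I : countType).
Variable mu : {measure set T -> \bar R}.
Variable U : I -> set T.
Hypothesis finU : forall y, finite_set [set i | U i y].
Local Open Scope complex_scope.

Definition lsum (V : zmodType) (h : I -> T -> V) (y : T) : V :=
  \sum_(i \in [set: I]) h i y.

(** With local finiteness of [U], this makes [lsum h y] a genuine finite sum at every point. *)
Definition supported (V : zmodType) (h : I -> T -> V) :=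
  forall i y, ~ U i y -> h i y = 0.

Definition off (V : zmodType) (J : {fset I}) (h : I -> T -> V) (i : I) (y : T) : V :=
  if i \in J then 0 else h i y.

Let S y : {fset I} := fset_set [set i | U i y].

Let inS i y : (i \in S y) = (i \in [set i | U i y]).
Proof. by rewrite in_fset_set. Qed.

Lemma lsumE (V : zmodType) (h : I -> T -> V) y (A : {fset I}) : supported h ->
  (forall i, U i y -> i \in A) -> lsum h y = \sum_(i <- A) h i y.
Proof.
move=> hs hA; rewrite /lsum (@fsbigE _ _ _ _ _ A) //.
- by apply: eq_bigl => i; rewrite in_setT.
- by move=> i _ iA; apply: hs => Ui; rewrite hA in iA.
Qed.

Lemma in_cover_fset i y : U i y -> i \in S y.
Proof. by move=> Ui; rewrite inS inE. Qed.

Lemma lsum_cover (V : zmodType) (h : I -> T -> V) y : supported h ->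
  lsum h y = \sum_(i <- fset_set [set i | U i y]) h i y.
Proof. by move=> hs; apply: lsumE => // i; exact: in_cover_fset. Qed.

Lemma supported_off (V : zmodType) J (h : I -> T -> V) : supported h -> supported (off J h).
Proof. by move=> hs i y nU; rewrite /off hs // if_same. Qed.

Lemma lsum_off (V : zmodType) J (h : I -> T -> V) y : supported h ->
  lsum (off J h) y = lsum h y - \sum_(i <- J) h i y.
Proof.
move=> hs; rewrite (@lsumE _ _ _ (S y `|` J)%fset) //; last 2 first.
- exact: supported_off.
- by move=> i /in_cover_fset iS; rewrite in_fsetU iS.
rewrite (@lsumE _ h _ (S y `|` J)%fset) //; last first.
  by move=> i /in_cover_fset iS; rewrite in_fsetU iS.
have -> : \sum_(i <- J) h i y =
    \sum_(i <- (S y `|` J)%fset) (if i \in J then h i y else 0).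
  transitivity (\sum_(i <- J) (if i \in J then h i y else 0)).
    by apply: eq_big_seq => i ->.
  by apply: big_fset_incl => [|i _ /negbTE->//]; exact: fsubsetUr.
rewrite -sumrB; apply: eq_bigr => i _; rewrite /off.
by case: ifP; rewrite ?subrr ?subr0.
Qed.

(** A cofinal sequence in the net of finite subsets of [I]: measurability of limits and dominated
    convergence are statements about sequences. *)
Definition upto n : {fset I} := [fset i in pmap pickle_inv (iota 0 n)]%fset.

Lemma in_upto n i : (i \in upto n) = (choice.pickle i < n)%N.
Proof.
rewrite !inE mem_pmap; apply/mapP/idP => [[k]|h].
  rewrite mem_iota /= add0n => kn ik.
  by have := @pickle_invK I k; rewrite -ik /= => ->.
by exists (choice.pickle i); [rewrite mem_iota|rewrite pickleK_inv].
Qed.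

Lemma upto_le n n' : (n <= n')%N -> (upto n `<=` upto n')%fset.
Proof. by move=> nn; apply/fsubsetP => i; rewrite !in_upto => /leq_trans->. Qed.

Lemma upto_exhaust (A : {fset I}) : exists n, (A `<=` upto n)%fset.
Proof.
exists (\max_(i <- A) (choice.pickle i).+1)%N; apply/fsubsetP => i iA.
by rewrite in_upto (@leq_bigmax_seq _ _ xpredT (fun i => (choice.pickle i).+1)).
Qed.

Lemma lsum_near (V : zmodType) (h : I -> T -> V) y : supported h ->
  \forall n \near \oo, \sum_(i <- upto n) h i y = lsum h y.
Proof.
move=> hs; have [N hN] := upto_exhaust (S y).
exists N => // n /= Nn; apply/esym/lsumE => // i /in_cover_fset iS.
by apply: (fsubsetP (upto_le Nn)); apply: (fsubsetP hN).
Qed.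

Lemma lsum_meas (h : I -> T -> R) : supported h ->
  (forall i, measurable_fun [set: T] (h i)) -> measurable_fun [set: T] (lsum h).
Proof.
move=> hs mh; apply: (@measurable_fun_cvg _ _ _ _ (fun n y => \sum_(i <- upto n) h i y)).
  by move=> n; exact: measurable_sum.
by move=> y _; apply: (@cvg_near_cst); exact: lsum_near.
Qed.

Lemma lsum_cmeas (h : I -> T -> R[i]) : supported h ->
  (forall i, cmeasurable (h i)) -> cmeasurable (lsum h).
Proof.
move=> hs mh; apply: (@cmeas_lim _ _ _ (fun n y => \sum_(i <- upto n) h i y)).
  by move=> n; exact: cmeas_sum.
move=> y; apply: (@cvg_near_cst); apply: filterS (lsum_near y hs) => n ->.
by rewrite subrr rnorm0.
Qed.

Lemma ler_lsum (h g : I -> T -> R) y : supported h -> supported g ->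
  (forall i, U i y -> h i y <= g i y) -> lsum h y <= lsum g y.
Proof.
move=> hs gs hg; rewrite !lsum_cover //; rewrite big_seq [leRHS]big_seq.
by apply: ler_sum => i; rewrite in_fset_set // inE => Ui; exact: hg.
Qed.

Lemma lsum_ge0 (h : I -> T -> R) y : supported h ->
  (forall i, 0 <= h i y) -> 0 <= lsum h y.
Proof. by move=> hs h0; rewrite lsum_cover //; exact: sumr_ge0. Qed.

Lemma lsum_ge1 (h : I -> T -> R) i y : supported h ->
  (forall i, 0 <= h i y) -> h i y <= lsum h y.
Proof.
move=> hs h0; have [Ui|nU] := pselect (U i y); last by rewrite hs ?lsum_ge0.
rewrite lsum_cover // (big_fsetD1 i) ?in_cover_fset //= lerDl sumr_ge0 //.
Qed.

Lemma rnorm_lsum (h : I -> T -> R[i]) y : supported h ->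
  rnorm (lsum h y) <= lsum (fun i y => rnorm (h i y)) y.
Proof.
move=> hs; rewrite !lsum_cover ?rnorm_sum //.
by move=> i z nU; rewrite hs ?rnorm0.
Qed.

Lemma lsumD (V : zmodType) (h g : I -> T -> V) y : supported h -> supported g ->
  lsum (fun i y => h i y + g i y) y = lsum h y + lsum g y.
Proof.
move=> hs gs; rewrite !lsum_cover ?big_split //.
by move=> i z nU; rewrite hs ?gs ?addr0.
Qed.

Lemma lsumZl (K : pzRingType) (h : I -> T -> K) a y : supported h ->
  lsum (fun i y => a * h i y) y = a * lsum h y.
Proof.
move=> hs; rewrite !lsum_cover ?mulr_sumr //.
by move=> i z nU; rewrite hs ?mulr0.
Qed.

Lemma off_meas J (h : I -> T -> R) : (forall i, measurable_fun [set: T] (h i)) ->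
  forall i, measurable_fun [set: T] (off J h i).
Proof. by move=> mh i; rewrite /off; case: (i \in J) => //; exact: measurable_cst. Qed.

(** Dominated convergence along [upto] gives one small tail; nonnegative tails decrease as [J]
    grows, so every larger [J] works too, which is unconditional convergence. *)
Lemma tail_small (h : I -> T -> R) : supported h ->
  (forall i, measurable_fun [set: T] (h i)) -> (forall i y, 0 <= h i y) ->
  (\int[mu]_y (lsum h y)%:E < +oo)%E -> forall e, 0 < e ->
  exists J0, forall J, (J0 `<=` J)%fset -> (\int[mu]_y (lsum (off J h) y)%:E < e%:E)%E.
Proof.
move=> hs mh h0 ih e e0.
have offs J : supported (off J h) by exact: supported_off.
have off0 J i y : 0 <= off J h i y by rewrite /off; case: ifP.
have moff J : measurable_fun [set: T] (lsum (off J h)).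
  by apply: lsum_meas => //; exact: off_meas.
have offh J y : lsum (off J h) y <= lsum h y.
  by apply: ler_lsum => // i _; rewrite /off; case: ifP.
have [] := @dominated_convergence _ _ _ mu _ measurableT
  (fun n y => (lsum (off (upto n) h) y)%:E) (cst 0%E) (fun x => (lsum h x)%:E).
- by move=> n; apply/measurable_EFinP; exact: moff.
- exact: measurable_cst.
- apply: aeW => y _; apply: cvg_EFin; first exact: nearW.
  apply: cvg_near_cst; apply: filterS (lsum_near y hs) => n nh /=.
  by rewrite lsum_off // nh subrr.
- apply: integrable_nnP => //; first exact: lsum_meas.
  by move=> y; exact: lsum_ge0.
- by apply: aeW => y n _; rewrite lee_fin ger0_norm ?lsum_ge0.
move=> _ _; rewrite integral0 => /fine_cvgP[F1 /cvgrPdist_lt/(_ e e0)F2].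
have [N _ HN] := filterI F1 F2.
have [/= fN eN] := HN N (leqnn N).
exists (upto N) => J NJ; apply: (@le_lt_trans _ _ (\int[mu]_y (lsum (off (upto N) h) y)%:E)%E).
  apply: nnint_le => //; first by move=> y; exact: lsum_ge0.
  apply: aeW => y; apply: ler_lsum => // i _; rewrite /off.
  by case: ifP => iJ; case: ifP => // iN; rewrite (fsubsetP NJ) in iJ.
rewrite -(fineK fN) lte_fin; move: eN; rewrite sub0r normrN ger0_norm //.
by apply: fine_ge0; apply: integral_ge0 => y _; rewrite lee_fin lsum_ge0.
Qed.

Lemma partial_sumE (V : zmodType) (a : I -> V) J :
  partial_sum a J = \sum_(i <- J) a i.
Proof. by rewrite /partial_sum big_seq_fsetE. Qed.

Lemma cvg_totally0 (a : {fset I} -> R) : (forall J, 0 <= a J) ->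
  (forall e, 0 < e -> exists J0, forall J, (J0 `<=` J)%fset -> a J < e) ->
  a @ totally --> (0 : R).
Proof.
move=> a0 h; apply/cvgrPdist_lt => e /h[J0 hJ]; exists J0 => // J /= JJ.
by rewrite sub0r normrN ger0_norm ?hJ.
Qed.

Lemma totally0P (a : {fset I} -> R) : a @ totally --> (0 : R) -> forall e, 0 < e ->
  exists J0, forall J, (J0 `<=` J)%fset -> a J < e.
Proof.
move=> /cvgrPdist_lt h e /h[J0 _ hJ]; exists J0 => J /hJ /=.
by rewrite sub0r normrN; apply: le_lt_trans (ler_norm _).
Qed.

(** The difference between the integral of the sum and a partial sum of the integrals is the
    integral of a tail, which [tail_small] controls after taking moduli. *)
Lemma cint_lsum (h : I -> T -> R[i]) : supported h ->
  (forall i, cmeasurable (h i)) ->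
  (\int[mu]_y (lsum (fun i y => rnorm (h i y)) y)%:E < +oo)%E ->
  [/\ cintegrable mu (lsum h), forall i, cintegrable mu (h i) &
    (fun J => rnorm (partial_sum (fun i => cintegral mu (h i)) J -
                     cintegral mu (lsum h))) @ totally --> (0 : R)].
Proof.
move=> hs mh ih.
have ns : supported (fun i y => rnorm (h i y)) by move=> i y nU; rewrite hs ?rnorm0.
have mn i : measurable_fun [set: T] (fun y => rnorm (h i y)) by exact: cmeas_rnorm.
have mnl : measurable_fun [set: T] (lsum (fun i y => rnorm (h i y))) by exact: lsum_meas.
have il : cintegrable mu (lsum h).
  by apply: cint_le ih => //; [exact: lsum_cmeas|apply: aeW => y; exact: rnorm_lsum].
have ii i : cintegrable mu (h i).
  apply: cint_le ih => //; apply: aeW => y.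
  by apply: (lsum_ge1 i ns) => j; exact: rnorm_ge0.
split => //; apply: cvg_totally0 => [J|e e0]; first exact: rnorm_ge0.
have [J0 hJ] := tail_small ns mn (fun i y => rnorm_ge0 _) ih e0.
exists J0 => J JJ; rewrite -lte_fin; apply: le_lt_trans (hJ J JJ).
rewrite partial_sumE -cintegral_sum // rnorm_distC -cintegralB //; last exact: cint_sum.
have iB : cintegrable mu (fun x => lsum h x - \sum_(i <- J) h i x).
  by apply: cintB => //; exact: cint_sum.
apply: le_trans (rnorm_cintegral iB) _; apply: nnint_le.
- by apply: cmeas_rnorm; exact: cint_meas iB.
- apply: lsum_meas; first exact: supported_off.
  exact: off_meas.
- by move=> y; exact: rnorm_ge0.
apply: aeW => y; rewrite -lsum_off //.
apply: le_trans (rnorm_lsum y (supported_off J hs)) _.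
apply: ler_lsum => [i z nU|i z nU|i _].
- by rewrite supported_off ?rnorm0.
- by rewrite supported_off.
- by rewrite /off; case: ifP; rewrite ?rnorm0.
Qed.

Lemma cvg_partial_unique (a : I -> R[i]) (l l' : R[i]) :
  (fun J => rnorm (partial_sum a J - l)) @ totally --> (0 : R) ->
  (fun J => rnorm (partial_sum a J - l')) @ totally --> (0 : R) -> l = l'.
Proof.
by move=> h h'; exact: (rnorm_cvg_unique h h').
Qed.

Lemma cvg_partial_seq (a : I -> R[i]) l :
  (fun J => rnorm (partial_sum a J - l)) @ totally --> (0 : R) ->
  rnorm (partial_sum a (upto n) - l) @[n --> \oo] --> (0 : R).
Proof.
move=> h; apply/cvgrPdist_lt => e e0; have [J0 hJ] := totally0P h e0.
have [N hN] := upto_exhaust J0; exists N => // n /= Nn.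
rewrite sub0r normrN ger0_norm ?rnorm_ge0 // hJ //.
exact: fsubset_trans hN (upto_le Nn).
Qed.
End LocallyFiniteSums.

(** * Operators close to the identity *)

Section Seminormed.
Context (R : realType) (E : lmodType R[i]) (B : set E) (n : E -> R).
Hypothesis nB : complete_seminormed B n.
Local Open Scope complex_scope.

Lemma csnZ a f : B f -> B (a *: f).
Proof. by move=> Bf; rewrite -[_ *: _]addr0; apply: (csn_linear nB) => //; exact: (csn_zero nB). Qed.

Lemma csnD f g : B f -> B g -> B (f + g).
Proof. by move=> Bf Bg; rewrite -[f]scale1r; exact: (csn_linear nB). Qed.

Lemma csnN f : B f -> B (- f).
Proof. by move=> Bf; rewrite -scaleN1r; exact: csnZ. Qed.

Lemma csnB f g : B f -> B g -> B (f - g).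
Proof. by move=> Bf Bg; apply: csnD => //; exact: csnN. Qed.

Lemma csn_normN f : B f -> n (- f) = n f.
Proof. by move=> Bf; rewrite -scaleN1r (csn_scale nB) // rnormN rnorm1 mul1r. Qed.

Lemma csn_distC f g : B f -> B g -> n (f - g) = n (g - f).
Proof. by move=> Bf Bg; rewrite -csn_normN ?opprB //; exact: csnB. Qed.

Lemma csn_norm0 : n 0 = 0.
Proof. by rewrite -(scale0r 0) (csn_scale nB) ?rnorm0 ?mul0r //; exact: csn_zero nB. Qed.

Lemma csn_dist_tri g f h : B f -> B g -> B h -> n (f - h) <= n (f - g) + n (g - h).
Proof.
by move=> Bf Bg Bh; rewrite -[f - h](subrKA g) (csn_triangle nB) //; exact: csnB.
Qed.

Lemma csn_le_dist f g : B f -> B g -> n f <= n g + n (f - g).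
Proof.
by move=> Bf Bg; rewrite -[X in n X <= _](subrK g) addrC (csn_triangle nB) //; exact: csnB.
Qed.

Variables (Op : E -> E) (th : R).
Hypothesis n_def : forall f, B f -> n f = 0 -> f = 0.
Hypothesis OpB : forall f, B f -> B (Op f).
Hypothesis OpL : forall a f g, B f -> B g -> Op (a *: f + g) = a *: Op f + Op g.
Hypothesis th0 : 0 <= th.
Hypothesis th1 : th < 1.
Hypothesis OpC : forall f, B f -> n (f - Op f) <= th * n f.

Lemma near_id_lower f : B f -> (1 - th) * n f <= n (Op f).
Proof.
move=> Bf; have := csn_le_dist Bf (OpB Bf); have := OpC Bf.
by rewrite mulrBl mul1r; lra.
Qed.

Lemma near_idB f g : B f -> B g -> Op (f - g) = Op f - Op g.
Proof.
move=> Bf Bg; rewrite -[f - g]addrC -scaleN1r OpL // scaleN1r addrC //.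
Qed.

(* The Neumann iteration [g_(k+1) = f + (g_k - Op g_k)]. *)
Lemma near_id_onto f : B f -> exists g, [/\ B g, Op g = f & n g <= (1 - th)^-1 * n f].
Proof.
move=> Bf; have t1 : 0 < 1 - th by rewrite subr_gt0.
pose T h := h - Op h; pose u := fix u k := if k is k'.+1 then f + T (u k') else 0.
have BT h : B h -> B (T h) by move=> Bh; apply: csnB => //; exact: OpB.
have Bu k : B (u k).
  by elim: k => [|k ih]; [exact: csn_zero nB|apply: csnD => //; exact: BT].
have nf0 := csn_ge0 nB Bf.
(* [C] is the fixed point of [t |-> n f + th * t], so the ball of radius [C] is stable under the
   iteration. *)
pose C := (1 - th)^-1 * n f.
have C0 : 0 <= C by rewrite mulr_ge0 // invr_ge0 ltW.
have CE : n f + th * C = C by rewrite /C; field; rewrite gt_eqF.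
have nu k : n (u k) <= C.
  elim: k => [|k ih]; first by rewrite csn_norm0.
  rewrite /= (le_trans (csn_triangle nB Bf (BT _ (Bu k)))) // -[leRHS]CE lerD2l.
  by rewrite (le_trans (OpC (Bu k))) // ler_wpM2l.
have TB h h' : B h -> B h' -> T h - T h' = T (h - h').
  by move=> Bh Bh'; rewrite /T near_idB // !opprD !opprK addrACA.
have du k p : n (u (k + p)%N - u k) <= th ^+ k * C.
  elim: k => [|k ih]; first by rewrite add0n subr0 expr0 mul1r.
  rewrite addSn /= opprD addrACA subrr add0r TB // exprS -mulrA.
  apply: le_trans (OpC (csnB (Bu _) (Bu _))) _.
  by rewrite ler_wpM2l.
have cth : th ^+ k * C @[k --> \oo] --> (0 : R).
  by rewrite -(mul0r C); apply: cvgMr_tmp; apply: cvg_expr; rewrite ger0_norm.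
have duj k j : (k <= j)%N -> n (u j - u k) <= th ^+ k * C by move=> /subnKC <-.
have [g Bg ug] : exists2 g, B g & n (u k - g) @[k --> \oo] --> (0 : R).
  apply: (csn_complete nB) => // e e0.
  have e2 : 0 < e / 2 by rewrite divr_gt0.
  have /cvgrPdist_lt/(_ _ e2)[N _ hN] := cth.
  have {}hN : th ^+ N * C < e / 2.
    by have := hN N (leqnn N); rewrite /= sub0r normrN; apply: le_lt_trans (ler_norm _).
  exists N => j k Nj Nk; apply: le_lt_trans (csn_dist_tri (Bu j) (Bu N) (Bu k)) _.
  rewrite (splitr e) ltrD //; first by apply: le_lt_trans hN; exact: duj.
  by rewrite csn_distC //; apply: le_lt_trans hN; exact: duj.
exists g; split => //.
- apply/eqP; rewrite -subr_eq0; apply/eqP/n_def; first by apply: csnB => //; exact: OpB.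
  apply/eqP; rewrite eq_le (csn_ge0 nB) ?andbT; last by apply: csnB => //; exact: OpB.
  (* The residual of the limit is compared with that of an iterate, which is just one Neumann step
     [u k.+1 - u k] up to sign; both terms tend to 0. *)
  have hk k : n (Op g - f) <= (1 + th) * n (u k - g) + th ^+ k * C.
    have -> : Op g - f = Op (g - u k) + (Op (u k) - f).
      by rewrite near_idB // addrA subrK.
    have -> : Op (u k) - f = - (u k.+1 - u k) by rewrite /= opprB [f + _]addrC opprD addrA subKr.
    have BD : B (u k.+1 - u k) by exact: csnB.
    have Bgu : B (g - u k) by exact: csnB.
    apply: le_trans (csn_triangle nB (OpB Bgu) (csnN BD)) _.
    rewrite csn_normN // lerD //; last by have := du k 1%N; rewrite addn1.
    rewrite [n (u k - g)]csn_distC //.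
    have := csn_le_dist (OpB Bgu) Bgu; rewrite (csn_distC (OpB Bgu) Bgu).
    by have := OpC Bgu; rewrite mulrDl mul1r; lra.
  apply: (@cvgr_to_ge nat \oo _ R (fun k => (1 + th) * n (u k - g) + th ^+ k * C) 0).
    rewrite -[X in _ --> X]addr0; apply: cvgD => //.
    by rewrite -[X in _ --> X](mulr0 (1 + th)); exact: cvgMl_tmp.
  exact: nearW.
- apply: (@cvgr_to_ge nat \oo _ R (fun k => C + n (u k - g)) C).
    by rewrite -[X in _ --> X]addr0; apply: cvgD => //; exact: cvg_cst.
  apply: nearW => k; rewrite csn_distC //.
  exact: le_trans (csn_le_dist Bg (Bu k)) (lerD (nu k) (lexx _)).
Qed.
End Seminormed.

(** * Solid function spaces *)

Section SolidSpaces.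
Context (R : realType) d (T : measurableType d).
Variable mu : {measure set T -> \bar R}.
Local Open Scope complex_scope.

(* Only an almost everywhere bound is required because the integral may be
   infinite on a null set. *)
Definition kernel_bound (k : T -> T -> R) (c : R) (Y : set (T -> R[i]))
    (nY : (T -> R[i]) -> R) : Prop :=
  forall F, Y F -> exists G : T -> R,
    [/\ forall x, 0 <= G x, Y (fun x => (G x)%:C),
        nY (fun x => (G x)%:C) <= c * nY F &
        {ae mu, forall x, (\int[mu]_y (k x y * rnorm (F y))%:E <= (G x)%:E)%E}].

(** Elements are functions rather than classes, so completeness takes the form [ss_fatou]: a Cauchy
    sequence that converges at every point converges in norm to its pointwise limit. *)
Record solid_space (Y : set (T -> R[i])) (nY : (T -> R[i]) -> R) : Prop := {
  ss_zero : Y 0;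
  ss_linear : forall (a : R[i]) F G, Y F -> Y G -> Y (a *: F + G);
  ss_ge0 : forall F, Y F -> 0 <= nY F;
  ss_scale : forall (a : R[i]) F, Y F -> nY (a *: F) = rnorm a * nY F;
  ss_triangle : forall F G, Y F -> Y G -> nY (F + G) <= nY F + nY G;
  ss_meas : forall F, Y F -> cmeasurable F;
  ss_solid : forall F G, cmeasurable F -> Y G ->
    {ae mu, forall x, rnorm (F x) <= rnorm (G x)} -> Y F /\ nY F <= nY G;
  ss_definite : forall F, Y F -> nY F = 0 -> {ae mu, forall x, F x = 0};
  ss_fatou : forall (u : nat -> T -> R[i]) F, (forall k, Y (u k)) ->
    (forall eps, 0 < eps -> exists N, forall j k,
      (N <= j)%N -> (N <= k)%N -> nY (u j - u k) < eps) ->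
    (forall x, rnorm (u k x - F x) @[k --> \oo] --> (0 : R)) ->
    Y F /\ nY (u k - F) @[k --> \oo] --> (0 : R) }.

Section Theory.
Variables (Y : set (T -> R[i])) (nY : (T -> R[i]) -> R).
Hypothesis YS : solid_space Y nY.

Lemma ssZ a F : Y F -> Y (a *: F).
Proof. by move=> YF; rewrite -[_ *: _]addr0; apply: (ss_linear YS) => //; exact: (ss_zero YS). Qed.

Lemma ssD F G : Y F -> Y G -> Y (F + G).
Proof. by move=> YF YG; rewrite -[F]scale1r; exact: (ss_linear YS). Qed.

Lemma ssB F G : Y F -> Y G -> Y (F - G).
Proof. by move=> YF YG; rewrite -[- G]scaleN1r; apply: ssD => //; exact: ssZ. Qed.

Lemma ss_dom F (g : T -> R) : cmeasurable F -> Y (fun x => (g x)%:C) ->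
  {ae mu, forall x, rnorm (F x) <= g x} -> Y F /\ nY F <= nY (fun x => (g x)%:C).
Proof.
move=> mF Yg Fg; apply: (ss_solid YS) => //; apply: filterS Fg => x h.
by rewrite rnormC (le_trans h) // ler_norm.
Qed.

Lemma ss_abs F : Y F ->
  Y (fun x => (rnorm (F x))%:C) /\ nY (fun x => (rnorm (F x))%:C) <= nY F.
Proof.
move=> YF; apply: (ss_solid YS) => //.
  by apply: cmeas_real; apply: cmeas_rnorm; exact: (ss_meas YS YF).
by apply: aeW => x; rewrite rnormC ger0_norm ?rnorm_ge0.
Qed.

Lemma ss_dom2 F (g1 g2 : T -> R) : cmeasurable F ->
  Y (fun x => (g1 x)%:C) -> Y (fun x => (g2 x)%:C) ->
  {ae mu, forall x, rnorm (F x) <= g1 x + g2 x} ->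
  Y F /\ nY F <= nY (fun x => (g1 x)%:C) + nY (fun x => (g2 x)%:C).
Proof.
move=> mF Y1 Y2 Fg.
have YD := ssD Y1 Y2.
have [] := @ss_dom F (fun x => g1 x + g2 x) mF.
- by rewrite (_ : (fun _ => _) = (fun x => (g1 x)%:C) + (fun x => (g2 x)%:C)) //;
    apply/funext => x; rewrite rmorphD.
- exact: Fg.
move=> YF nF; split => //; apply: le_trans nF _.
rewrite (_ : (fun _ => _) = (fun x => (g1 x)%:C) + (fun x => (g2 x)%:C)).
  exact: ss_triangle YS _ _ Y1 Y2.
by apply/funext => x; rewrite rmorphD.
Qed.

Lemma ss_realZ c F (g : T -> R) : 0 <= c -> cmeasurable F -> Y (fun x => (g x)%:C) ->
  {ae mu, forall x, rnorm (F x) <= c * g x} ->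
  Y F /\ nY F <= c * nY (fun x => (g x)%:C).
Proof.
move=> c0 mF Yg Fg.
have E : (fun x => (c * g x)%:C) = c%:C *: (fun x => (g x)%:C).
  by apply/funext => x; rewrite rmorphM.
have [] := @ss_dom F (fun x => c * g x) mF _ Fg; first by rewrite E; exact: ssZ.
move=> YF nF; split => //; apply: le_trans nF _.
by rewrite E (ss_scale YS) // rnormC ger0_norm.
Qed.

Lemma ss_kernel_meas k c F : kernel_bound k c Y nY -> Y F ->
  exists G : T -> R, [/\ forall x, 0 <= G x, measurable_fun [set: T] G,
     Y (fun x => (G x)%:C), nY (fun x => (G x)%:C) <= c * nY F &
     {ae mu, forall x, (\int[mu]_y (k x y * rnorm (F y))%:E <= (G x)%:E)%E}].
Proof.
move=> kb YF; have [G [G0 YG nG kG]] := kb F YF; exists G; split => //.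
exact: (ss_meas YS YG).1.
Qed.
End Theory.

End SolidSpaces.

Lemma limn_einf_le (R : realType) (u : nat -> \bar R) (c : \bar R) :
  (\forall n \near \oo, (u n <= c)%E) -> (limn_einf u <= c)%E.
Proof.
move=> [N _ hN]; rewrite limn_einf_lim; apply: lime_le; first exact: is_cvg_einfs.
apply: nearW => n; apply: le_trans (hN (maxn n N) (leq_maxr _ _)).
by apply: ereal_inf_lbound; exists (maxn n N) => //=; rewrite leq_maxl.
Qed.

(** * Weighted L^1 spaces *)

Section WeightedL1.
Context (R : realType) d (T : measurableType d).
Variable mu : {measure set T -> \bar R}.

(** Stated over any measurable space; on [borel X] these notions unfold to [L1_norm] and [L1]. *)
Definition wL1_norm (v : T -> R) (F : T -> R[i]) : \bar R :=
  (\int[mu]_x (rnorm (F x) * v x)%:E)%E.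

Definition wL1 (v : T -> R) : set (T -> R[i]) :=
  [set F | cmeasurable F /\ (wL1_norm v F < +oo)%E].

Definition wL1n v F : R := fine (wL1_norm v F).

Variable v : T -> R.
Hypothesis mv : measurable_fun [set: T] v.
Hypothesis v1 : forall x, 1 <= v x.
Local Open Scope complex_scope.

Let v0 x : 0 <= v x. Proof. exact: le_trans ler01 (v1 x). Qed.

Lemma wL1_meas F : cmeasurable F -> measurable_fun [set: T] (fun x => rnorm (F x) * v x).
Proof. by move=> mF; apply: measurable_funM => //; exact: cmeas_rnorm. Qed.

Lemma wL1_nn (F : T -> R[i]) x : 0 <= rnorm (F x) * v x.
Proof. by rewrite mulr_ge0 ?rnorm_ge0. Qed.

Lemma wL1nE F : wL1 v F -> (\int[mu]_x (rnorm (F x) * v x)%:E = (wL1n v F)%:E)%E.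
Proof.
move=> [_ iF]; rewrite /wL1n fineK // ge0_fin_numE //.
by apply: integral_ge0 => x _; rewrite lee_fin wL1_nn.
Qed.

Lemma wL1n_ge0 F : 0 <= wL1n v F.
Proof. by apply: fine_ge0; apply: integral_ge0 => x _; rewrite lee_fin wL1_nn. Qed.

Lemma wL1n_le F c : cmeasurable F -> (\int[mu]_x (rnorm (F x) * v x)%:E <= c%:E)%E ->
  wL1 v F /\ wL1n v F <= c.
Proof.
move=> mF h; have LF : wL1 v F by split => //; apply: le_lt_trans h _; exact: ltry.
by split => //; rewrite -lee_fin -wL1nE.
Qed.

Lemma wL1_dom F (g : T -> R) : cmeasurable F -> measurable_fun [set: T] g ->
  {ae mu, forall x, rnorm (F x) * v x <= g x} ->
  (\int[mu]_x (g x)%:E < +oo)%E -> wL1 v F.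
Proof.
move=> mF mg Fg ig; split => //; apply: le_lt_trans ig.
by apply: nnint_le => //; [exact: wL1_meas|exact: wL1_nn].
Qed.

Lemma wL1_solid : solid_space mu (wL1 v) (wL1n v).
Proof.
have LD F G : wL1 v F -> wL1 v G -> wL1 v (F + G) /\ wL1n v (F + G) <= wL1n v F + wL1n v G.
  move=> LF LG; apply: wL1n_le; first by apply: cmeasD; [case: LF|case: LG].
  apply: le_trans (_ : (\int[mu]_x (rnorm (F x) * v x + rnorm (G x) * v x)%:E <= _)%E).
    apply: nnint_le; [by apply/wL1_meas/cmeasD; [case: LF|case: LG]| |exact: wL1_nn|].
      by apply: measurable_funD; apply: wL1_meas; [case: LF|case: LG].
    by apply: aeW => x; rewrite -mulrDl ler_wpM2r // rnormD.
  rewrite nnintD ?wL1nE //; try exact: wL1_nn.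
  + by apply: wL1_meas; case: LF.
  + by apply: wL1_meas; case: LG.
have LZ a F : wL1 v F -> wL1 v (a *: F) /\ wL1n v (a *: F) = rnorm a * wL1n v F.
  move=> LF; have E : (\int[mu]_x (rnorm ((a *: F) x) * v x)%:E = (rnorm a * wL1n v F)%:E)%E.
    under eq_integral => x _ do rewrite [(a *: F) x]/(a * F x) rnormM -mulrA.
    rewrite nnintZ ?rnorm_ge0 ?wL1nE //; last exact: wL1_nn.
    by apply: wL1_meas; case: LF.
  have L : wL1 v (a *: F).
    by split; [apply: cmeasZ; case: LF|rewrite /wL1_norm E ltry].
  by split => //; apply: EFin_inj; rewrite -wL1nE.
have LS F G : cmeasurable F -> wL1 v G ->
    {ae mu, forall x, rnorm (F x) <= rnorm (G x)} -> wL1 v F /\ wL1n v F <= wL1n v G.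
  move=> mF LG FG; apply: wL1n_le => //; rewrite -wL1nE //.
  apply: nnint_le; [exact: wL1_meas|by apply: wL1_meas; case: LG|exact: wL1_nn|].
  by apply: filterS FG => x h; rewrite ler_wpM2r.
split => //.
- split; first exact: cmeas_cst.
  rewrite /wL1_norm; under eq_integral => x _ do rewrite rnorm0 mul0r.
  by rewrite integral0.
- by move=> a F G LF LG; apply: (LD _ _ (LZ a F LF).1 LG).1.
- by move=> F _; exact: wL1n_ge0.
- by move=> a F /(LZ a)[].
- by move=> F G LF LG; case: (LD _ _ LF LG).
- by move=> F [].
- move=> F LF n0.
  have h0 : (\int[mu]_x `|(rnorm (F x) * v x)%:E| = 0)%E.
    under eq_integral => x _ do rewrite abse_EFin ger0_norm ?wL1_nn //.
    by rewrite wL1nE // n0.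
  have mF : measurable_fun [set: T] (fun x => (rnorm (F x) * v x)%:E).
    by apply/measurable_EFinP; apply: wL1_meas; case: LF.
  have := (ae_eq_integral_abs mu measurableT mF).1 h0; apply: filterS => x /(_ I) /= [] /eqP.
  by rewrite mulf_eq0 [v x == 0]gt_eqF ?(lt_le_trans ltr01) // orbF => /eqP/rnorm0_eq0.
- move=> u F Lu uC uF.
  have mF : cmeasurable F by apply: cmeas_lim uF => k; case: (Lu k).
  (* Fatou's lemma in [j]: the norm of [u k - F] is at most the lower limit of the norms of
     [u k - u j], all small by the Cauchy property. *)
  have close e : 0 < e -> exists N, forall k, (N <= k)%N ->
      wL1 v (u k - F) /\ wL1n v (u k - F) <= e.
    move=> e0; have [N hN] := uC e e0; exists N => k Nk.
    have mD j : cmeasurable (u j - u k) by apply: cmeasB; [case: (Lu j)|case: (Lu k)].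
    apply: wL1n_le; first by apply: cmeasB => //; case: (Lu k).
    have -> : (fun x => (rnorm ((u k - F) x) * v x)%:E) =
        (fun x => limn_einf (fun j => (rnorm ((u j - u k) x) * v x)%:E)).
      apply/funext => x; apply/esym.
      have H : (rnorm ((u j - u k) x) * v x)%:E @[j --> \oo] --> (rnorm ((u k - F) x) * v x)%:E.
        apply: cvg_EFin; first exact: nearW.
        apply: cvgMr_tmp; apply/cvgrPdist_lt => r r0.
        have /cvgrPdist_lt/(_ r r0) := uF x; apply: filterS => j.
        rewrite sub0r normrN ger0_norm ?rnorm_ge0 //; apply: le_lt_trans.
        apply: le_trans (_ : rnorm ((u k - F) x + (u j - u k) x) <= _).
          by rewrite -(rnormN ((u j - u k) x)); apply: le_trans (rnorm_distdist _ _) _;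
             rewrite opprK.
        by rewrite addrC [(u j - u k) x]/(u j x - u k x) [(u k - F) x]/(u k x - F x) subrKA.
      by rewrite (cvg_limn_einf_sup H).1.
    apply: le_trans (fatou mu measurableT _ _) _.
    + by move=> j; apply/measurable_EFinP; exact: wL1_meas.
    + by move=> j x _; rewrite lee_fin wL1_nn.
    apply: limn_einf_le; exists N => // j /= Nj.
    have Lj : wL1 v (u j - u k).
      apply: (LD (u j) (- u k) (Lu j) _).1.
      by rewrite -scaleN1r; exact: (LZ (-1) _ (Lu k)).1.
    by rewrite wL1nE // lee_fin ltW // hN.
  split.
    have [N /(_ N (leqnn N))[LN _]] := close 1 ltr01.
    have -> : F = u N + (-1) *: (u N - F) by rewrite scaleN1r opprB addrC subrK.
    exact: (LD _ _ (Lu N) (LZ (-1) _ LN).1).1.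
  apply/cvgrPdist_lt => e e0; have e2 : 0 < e / 2 by rewrite divr_gt0.
  have [N hN] := close _ e2; exists N => // k /= Nk.
  rewrite sub0r normrN ger0_norm ?wL1n_ge0 // (le_lt_trans (hN k Nk).2) //.
  by rewrite ltr_pdivrMr // ltr_pMr // ltr1n.
Qed.
End WeightedL1.

(** * Riesz representation and dual pairs *)

Lemma rnorm_complete (R : realType) (H : completeNormedModType R[i]) (u : nat -> H) :
  (forall e : R, 0 < e -> exists N, forall j k, (N <= j)%N -> (N <= k)%N ->
     rnorm (u j - u k) < e) ->
  exists f : H, rnorm (u k - f) @[k --> \oo] --> (0 : R).
Proof.
move=> uC.
have : cvg (u k @[k --> \oo]).
  apply/cauchy_cvgP; apply: cauchy_exP => e e0.
  have e0' : 0 < complex.Re e by move: e0; rewrite ltcE /= => /andP[].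
  have eE : e = (complex.Re e)%:C%C.
    by move: e0; rewrite ltcE /= => /andP[/eqP e1 _]; case: e e1 e0' => a b /= ->.
  have [N hN] := uC _ e0'; exists (u N); exists N => // k /= Nk.
  rewrite -ball_normE /ball_ /= eE rnormE ltcR; exact: hN (leqnn N) Nk.
move=> h; exists (lim (u k @[k --> \oo])); apply/cvgrPdist_lt => e e0.
have /cvgrPdist_lt/(_ (e%:C)%C) := h; rewrite ltcR => /(_ e0).
apply: filterS => k; rewrite rnormE ltcR sub0r normrN ger0_norm ?rnorm_ge0 //.
by rewrite rnorm_distC.
Qed.

Section Riesz.
Context (R : realType) (H : completeNormedModType R[i]).
Variables (B : H -> H -> R[i]) (c C : R).
Local Open Scope complex_scope.
Hypothesis c0 : 0 < c.
Hypothesis C_ge0 : 0 <= C.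
Hypothesis B_linear : forall a f g h, B (a *: f + g) h = a * B f h + B g h.
Hypothesis B_herm : forall f g, B g f = conjC (B f g).
Let b f := complex.Re (B f f).
Hypothesis b_lower : forall f, c * rnorm f ^+ 2 <= b f.
Hypothesis b_upper : forall f, b f <= C * rnorm f ^+ 2.

Let b_ge0 f : 0 <= b f.
Proof. by apply: le_trans (b_lower f); rewrite mulr_ge0 ?sqr_ge0 ?ltW. Qed.

Let B_real f : B f f = (b f)%:C.
Proof.
rewrite /b; have := B_herm f f; case: (B f f) => x y [] /eqP.
by rewrite -addr_eq0 -mulr2n mulrn_eq0 /= => /eqP ->.
Qed.

Let B0 h : B 0 h = 0.
Proof.
have := B_linear 1 0 0 h; rewrite scaler0 addr0 mul1r => /eqP.
by rewrite -subr_eq subrr eq_sym => /eqP.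
Qed.

Let BZ a f h : B (a *: f) h = a * B f h.
Proof. by rewrite -[a *: f]addr0 B_linear B0 addr0. Qed.

Let BD f g h : B (f + g) h = B f h + B g h.
Proof. by rewrite -{1}[f]scale1r B_linear mul1r. Qed.

Let B_conj a f g h : B h (a *: f + g) = conjC a * B h f + B h g.
Proof. by rewrite B_herm B_linear rmorphD rmorphM /= -!B_herm. Qed.

Let BcZ a f h : B h (a *: f) = conjC a * B h f.
Proof. by rewrite B_herm BZ rmorphM /= -B_herm. Qed.

Let BcD f g h : B h (f + g) = B h f + B h g.
Proof. by rewrite B_herm BD rmorphD /= -!B_herm. Qed.

Let b_expand f g (t : R) : b (f + t%:C *: g) = b f + 2 * t * complex.Re (B f g) + t ^+ 2 * b g.
Proof.
have E : B (f + t%:C *: g) (f + t%:C *: g) =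
    B f f + t%:C * (B f g + conjC (B f g)) + (t ^+ 2)%:C * B g g.
  rewrite BD BZ !BcD !BcZ [B g f]B_herm.
  have -> : conjC (t%:C) = t%:C :> R[i] by exact: conjc_real.
  rewrite rmorphXn /=; ring.
rewrite /b E; case: (B f g) => x y; case: (B f f) => x1 y1; case: (B g g) => x2 y2.
rewrite /= ; ring.
Qed.

(** The form [B] is left general because it stands both for the inner product, with [c = C = 1], and
    for the form of the frame operator, with the frame bounds. *)
Lemma form_CS f g : rnorm (B f g) <= C * rnorm f * rnorm g.
Proof.
have CS : rnorm (B f g) ^+ 2 <= b f * b g.
  have [bg0|bg0] := eqVneq (b g) 0.
    have g0 : g = 0.
      apply: rnorm0_eq0; apply/eqP; rewrite -sqrf_eq0.
      have := b_lower g; rewrite bg0 pmulr_rle0 // => h.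
      by rewrite eq_le h sqr_ge0.
    by rewrite g0 B_herm B0 rmorph0 rnorm0 expr0n /= -g0 bg0 mulr0.
  have bgp : 0 < b g by rewrite lt_neqAle eq_sym bg0 b_ge0.
  (* Up to the factor [b g], this vector is the component of [f] that is [B]-orthogonal to [g]. *)
  have := b_ge0 ((b g)%:C *: f + (- B f g) *: g).
  have -> : b ((b g)%:C *: f + (- B f g) *: g) = b g * (b f * b g - rnorm (B f g) ^+ 2).
    rewrite {1}/b BD !BZ !BcD !BcZ.
    rewrite [B g f]B_herm !B_real rnorm_sqr; case: (B f g) => x y.
    rewrite /=; ring.
  by rewrite pmulr_rge0 // subr_ge0.
rewrite -(@ler_pXn2r _ 2) ?nnegrE ?rnorm_ge0 ?mulr_ge0 ?rnorm_ge0 //.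
apply: le_trans CS _; have -> : (C * rnorm f * rnorm g) ^+ 2 =
  (C * rnorm f ^+ 2) * (C * rnorm g ^+ 2) by ring.
by apply: ler_pM.
Qed.

Variables (ell : H -> R[i]) (M : R).
Hypothesis ell_linear : forall a g h, ell (a *: g + h) = conjC a * ell g + ell h.
Hypothesis ell_bounded : forall g, rnorm (ell g) <= M * rnorm g.

(* Variational proof: the solution minimizes [b g - 2 Re (ell g)]. *)
Theorem riesz : exists f, forall g, B f g = ell g.
Proof.
have ell0 : ell 0 = 0.
  have := ell_linear 1 0 0; rewrite scaler0 addr0 rmorph1 mul1r => /eqP.
  by rewrite -subr_eq subrr eq_sym => /eqP.
have ellt g h (t : R) : ell (g + t%:C *: h) = ell g + t%:C * ell h.
  by rewrite addrC ell_linear addrC; congr (_ + _ * _); exact: conjc_real.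
pose Q g := b g - 2 * complex.Re (ell g).
have Q_lower g : - (M ^+ 2 / c) <= Q g.
  have h1 := b_lower g; have h2 : complex.Re (ell g) <= M * rnorm g.
    exact: le_trans (Re_le_rnorm _) (ell_bounded g).
  apply: (@le_trans _ _ (c * rnorm g ^+ 2 - 2 * (M * rnorm g))); last first.
    by rewrite /Q; lra.
  rewrite -subr_ge0.
  have -> : c * rnorm g ^+ 2 - 2 * (M * rnorm g) - - (M ^+ 2 / c) =
    (c * rnorm g - M) ^+ 2 / c by field; rewrite gt_eqF.
  by rewrite divr_ge0 ?sqr_ge0 // ltW.
have hi : has_inf (range Q).
  by split; [exists (Q 0); exists 0|exists (- (M ^+ 2 / c)) => _ [g _ <-]].
pose d := inf (range Q).
have dQ g : d <= Q g by apply: inf_lbound; [exact: hi.2|exists g].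
have [u hu] : exists u : nat -> H, forall n, Q (u n) < d + n.+1%:R^-1.
  suff h n : exists g, Q g < d + n.+1%:R^-1.
    by exists (fun n => projT1 (cid (h n))) => n; exact: projT2 (cid (h n)).
  have e0 : 0 < n.+1%:R^-1 :> R by rewrite invr_gt0 ltr0n.
  by have [_ [g _ <-] h] := inf_adherent e0 hi; exists g.
have Q_expand g h (t : R) : Q (g + t%:C *: h) =
    Q g + 2 * t * complex.Re (B g h - ell h) + t ^+ 2 * b h.
  rewrite /Q b_expand ellt raddfB /=.
  case: (ell g) (ell h) (B g h) => a1 a2 [b1 b2] [c1 c2] /=; ring.
(* Parallelogram identity: [b (g - h) / 2] equals [Q g + Q h] minus twice the value of [Q] at the
   midpoint, and that value is at least [d]. Minimizing sequences are therefore Cauchy. *)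
have mid g h : b (g - h) <= 2 * (Q g - d + (Q h - d)).
  have E1 : g = h + (1 : R)%:C *: (g - h) by rewrite scale1r addrC subrK.
  have := Q_expand h (g - h) 1; rewrite -E1.
  have := Q_expand h (g - h) (2^-1).
  have := dQ (h + (2^-1 : R)%:C *: (g - h)).
  move: (Q (h + _)) => q q1 q2 q3; rewrite expr1n in q3.
  have : (2^-1 : R) ^+ 2 = 4^-1 by field.
  move=> E2; rewrite E2 in q2; have := b_ge0 (g - h); lra.
have [f uf] : exists f, rnorm (u k - f) @[k --> \oo] --> (0 : R).
  apply: rnorm_complete => e e0.
  have ce : 0 < c * e ^+ 2 / 4 by rewrite divr_gt0 // mulr_gt0 // exprn_gt0.
  have [N hN] : exists N, forall n, (N <= n)%N -> n.+1%:R^-1 < c * e ^+ 2 / 4.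
    have /cvgrPdist_lt/(_ _ ce)[N _ hN] := @cvg_harmonic R.
    exists N => n Nn; have := hN n Nn; rewrite /= sub0r normrN ger0_norm // invr_ge0 ler0n //.
  exists N => j k Nj Nk.
  have h1 := hu j; have h2 := hu k; have h3 := hN j Nj; have h4 := hN k Nk.
  have h5 := mid (u j) (u k); have h6 := b_lower (u j - u k).
  rewrite -(@ltr_pXn2r _ 2) ?nnegrE ?rnorm_ge0 ?(ltW e0) // -(ltr_pM2l c0).
  apply: le_lt_trans h6 _; apply: le_lt_trans h5 _.
  have -> : c * e ^+ 2 = c * e ^+ 2 / 4 * 4 by rewrite divfK // pnatr_eq0.
  move: (c * e ^+ 2 / 4) h3 h4 => q; move: h1 h2.
  by move: j.+1%:R^-1 k.+1%:R^-1 (Q (u j)) (Q (u k)) => *; lra.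
exists f => h; apply/eqP; rewrite -subr_eq0; apply/eqP.
have re0 k : complex.Re (B f k - ell k) = 0.
  set D := complex.Re _.
  (* The first variation at the minimizer. Minimality is known only approximately along [u n],
     whence the vanishing error [s n], made of the gap [1/(n+1)] and of [|u n - f|]. *)
  have key (t : R) : 0 <= 2 * t * D + t ^+ 2 * b k.
    apply/ler_addgt0Pr => e e0; rewrite -lerBlDr sub0r.
    pose s : nat -> R := fun n => - (n.+1%:R^-1 + 2 * `|t| * (C * rnorm (u n - f) * rnorm k)).
    have sl : s n @[n --> \oo] --> (0 : R).
      rewrite -oppr0; apply: cvgN; rewrite -[X in _ --> X](addr0 0); apply: cvgD.
        exact: cvg_harmonic.
      rewrite -[X in _ --> X](mulr0 (2 * `|t|)); apply: cvgMl_tmp.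
      rewrite -[X in _ --> X](mul0r (rnorm k)); apply: cvgMr_tmp.
      by rewrite -[X in _ --> X](mulr0 C); apply: cvgMl_tmp.
    have : 0 <= 2 * t * D + t ^+ 2 * b k.
      apply: (@cvgr_to_le nat \oo _ R s 0 _ sl); apply: nearW => n.
      have := Q_expand (u n) k t; have := dQ (u n + t%:C *: k); have := hu n.
      have := form_CS (u n - f) k.
      have -> : B (u n - f) k = (B (u n) k - ell k) - (B f k - ell k).
        by rewrite -[- f]scaleN1r addrC B_linear mulN1r opprB addrA subrK addrC.
      move=> h1 h2 h3 h4.
      have h5 : `|complex.Re (B (u n) k - ell k) - D| <= C * rnorm (u n - f) * rnorm k.
        by apply: le_trans h1; rewrite -raddfB norm_Re_le.
      have h6 : `|t * (complex.Re (B (u n) k - ell k) - D)| <=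
          `|t| * (C * rnorm (u n - f) * rnorm k) by rewrite normrM ler_wpM2l.
      rewrite /s; move: h6; rewrite ler_norml => /andP[h6 h7].
      move: h2 h3 h4 h6 h7; move: (complex.Re _) => z; move: (C * _ * _) => w.
      move: (n.+1%:R^-1) => e' *; lra.
    by move=> h0; rewrite (le_trans _ h0) // oppr_le0 ltW.
  have [bk0|bk0] := eqVneq (b k) 0.
    by have := key D; have := key (- D); rewrite bk0 !mulr0 !addr0; nra.
  have bkp : 0 < b k by rewrite lt_neqAle eq_sym bk0 b_ge0.
  (* The minimum point of the quadratic polynomial in [t]; nonnegativity there forces [D = 0]. *)
  have := key (- D / b k).
  have -> : 2 * (- D / b k) * D + (- D / b k) ^+ 2 * b k = - (D ^+ 2 / b k) by field.
  rewrite oppr_ge0 pmulr_lle0 ?invr_gt0 // => h0.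
  by apply/eqP; rewrite -sqrf_eq0 eq_le h0 sqr_ge0.
(* Testing with ['i] times [h] turns the imaginary part into a real part. *)
have := re0 h; have := re0 ('i%C *: h + 0).
rewrite B_conj ell_linear [B f 0]B_herm B0 rmorph0 ell0 !addr0.
by case: (B f h) (ell h) => x y [x' y'] /= h1 h2; apply/eqP; rewrite eq_complex /=;
  apply/andP; split; apply/eqP; lra.
Qed.
End Riesz.

(** * Inner products and dual pairs of families *)

Section DualPair.
Context (R : realType) (H : completeNormedModType R[i]) (ip : {dot H for (@conjC R[i])}).
Context d (T : measurableType d) (mu : {measure set T -> \bar R}).
Hypothesis H_hilbert : hilbert_norm ip.
Local Open Scope complex_scope.

Lemma ip_herm f g : ip g f = conjC (ip f g).
Proof. by rewrite (hermC ip) /= expr0 mul1r. Qed.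

Lemma ip_linear a f g h : ip (a *: f + g) h = a * ip f h + ip g h.
Proof. by rewrite linearPl. Qed.

Lemma ip_conj a f g h : ip h (a *: f + g) = conjC a * ip h f + ip h g.
Proof. by rewrite ip_herm ip_linear rmorphD rmorphM /= -!ip_herm. Qed.

Lemma ip_norm f : complex.Re (ip f f) = rnorm f ^+ 2.
Proof. by rewrite H_hilbert rnormE -rmorphXn. Qed.

Lemma ip_CS f g : rnorm (ip f g) <= rnorm f * rnorm g.
Proof.
rewrite -[rnorm f]mul1r; apply: (form_CS (B := ip) (c := 1) ltr01 ler01) => //.
- exact: ip_linear.
- exact: ip_herm.
- by move=> h; rewrite ip_norm mul1r.
- by move=> h; rewrite ip_norm mul1r.
Qed.

Lemma ip_ext f g : (forall h, ip f h = ip g h) -> f = g.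
Proof.
move=> E; apply/eqP; rewrite -subr_eq0; apply/eqP/rnorm0_eq0/eqP; rewrite -sqrf_eq0 -ip_norm.
have -> : f - g = (-1) *: g + f by rewrite scaleN1r addrC.
by rewrite ip_linear E mulN1r addNr.
Qed.

(* Two families with [f = \int <f, q_y> p_y dy] weakly; the relation is
   symmetric in [p] and [q]. *)
Record dual_pair (p q : T -> H) : Prop := {
  dp_measl : forall f, cmeasurable (fun x : T => ip f (p x));
  dp_measr : forall f, cmeasurable (fun x : T => ip f (q x));
  dp_bound : exists M, forall x, rnorm (p x) <= M /\ rnorm (q x) <= M;
  dp_int : forall f g, cintegrable mu (fun y : T => ip f (q y) * ip (p y) g);
  dp_id : forall f g, ip f g = cintegral mu (fun y : T => ip f (q y) * ip (p y) g);
  dp_kernel : forall x y, ip (p y) (q x) = ip (q y) (p x) }.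

(** Conjugation exchanges the two families. It is what lets a single treatment of coorbit spaces
    serve both orders of the pair. *)
Lemma dual_pair_sym p q : dual_pair p q -> dual_pair q p.
Proof.
move=> [mp mq [M hM] ii id k].
have E f g : (fun y => ip f (p y) * ip (q y) g) = (fun y => conjC (ip g (q y) * ip (p y) f)).
  by apply/funext => y; rewrite rmorphM /= -!ip_herm mulrC.
split => //.
- by exists M => x; have [] := hM x.
- by move=> f g; rewrite E; exact: cint_conj.
- by move=> f g; rewrite E cintegral_conj // -id -ip_herm.
Qed.

End DualPair.

(** * Discretization in reproducing kernel spaces *)

Section Core.
Context (R : realType) d (T : measurableType d) (I : countType).
Variable mu : {measure set T -> \bar R}.
Variables (U : I -> set T) (xs : I -> T) (v : T -> R) (CU : R) (Nov : nat).
Variables (K : T -> T -> R[i]) (o : T -> T -> R) (mass : I -> R) (D C0 nR dl : R).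
Local Open Scope complex_scope.
Hypothesis mU : forall i, measurable (U i).
Hypothesis massE : forall i, mu (U i) = (mass i)%:E.
Hypothesis D0 : 0 < D.
Hypothesis massD : forall i, D <= mass i.
Hypothesis covU : forall y, exists i, U i y.
Hypothesis finU : forall y, finite_set [set i | U i y].
Hypothesis ovU : forall y, (#|` fset_set [set i | U i y] | <= Nov)%N.
Hypothesis xsU : forall i, U i (xs i).
Hypothesis mv : measurable_fun [set: T] v.
Hypothesis v1 : forall x, 1 <= v x.
Hypothesis CU1 : 1 <= CU.
Hypothesis vU : forall i y y', U i y -> U i y' -> v y <= CU * v y'.
Hypothesis K_herm : forall x y, K x y = conjC (K y x).
Hypothesis mK : forall x, cmeasurable (K x).
Hypothesis o0 : forall x y, 0 <= o x y.
Hypothesis mo : forall x, measurable_fun [set: T] (o x).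
Hypothesis moT : forall y, measurable_fun [set: T] (o^~ y).
Hypothesis o_bound : forall i x y y', U i y -> U i y' -> rnorm (K x y - K x y') <= o x y.
Hypothesis K_L1 : forall x, (\int[mu]_y (rnorm (K y x) * v y)%:E <= (C0 * v x)%:E)%E.
Hypothesis K_int : forall x y, cintegrable mu (fun t => K t y * K x t).
Hypothesis K_rep : forall x y, K x y = cintegral mu (fun t => K t y * K x t).
Hypothesis nR0 : 0 <= nR.
Hypothesis dl0 : 0 <= dl.

(** All that the discretization asks of a function space. [cs_avg] is the source of every pointwise
    bound: averages over a member of the covering grow at most like the weight [v]. *)
Record core_space (Y : set (T -> R[i])) (nY : (T -> R[i]) -> R) : Prop := {
  cs_solid : solid_space mu Y nY;
  cs_K : kernel_bound mu (fun x y => rnorm (K x y)) nR Y nY;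
  cs_o : kernel_bound mu o dl Y nY;
  cs_oT : kernel_bound mu (fun x y => o y x) dl Y nY;
  cs_avg : exists2 C : R, 0 <= C & forall F i y, Y F -> U i y ->
    (\int[mu]_t (rnorm (F t) * \1_(U i) t)%:E <= (C * nY F * mass i * v y)%:E)%E;
  cs_ind : forall i, Y (fun y => (\1_(U i) y)%:C) }.

Let v0 x : 0 < v x. Proof. exact: lt_le_trans ltr01 (v1 x). Qed.
Let vge0 x : 0 <= v x. Proof. exact: ltW. Qed.
Let mass0 i : 0 < mass i. Proof. exact: lt_le_trans D0 (massD i). Qed.
Let mass_ge0 i : 0 <= mass i. Proof. exact: ltW. Qed.

Let mKT x : cmeasurable (K^~ x).
Proof. by under eq_fun do rewrite K_herm; apply: cmeas_conj. Qed.

Let mind i : measurable_fun [set: T] (\1_(U i) : T -> R).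
Proof. exact: measurable_indic. Qed.

Let ind0 i y : 0 <= \1_(U i) y :> R. Proof. by rewrite indicE ler0n. Qed.

Let indT i y : U i y -> \1_(U i) y = 1 :> R.
Proof. by move=> Uy; rewrite indicE mem_set. Qed.

Let indF i y : ~ U i y -> \1_(U i) y = 0 :> R.
Proof. by move=> Uy; rewrite indicE memNset. Qed.

Lemma supp_ind (a : I -> R) : supported U (fun i y => a i * \1_(U i) y).
Proof. by move=> i y nU; rewrite indF ?mulr0. Qed.

Lemma int_ind i c : 0 <= c -> (\int[mu]_t (c * \1_(U i) t)%:E = (c * mass i)%:E)%E.
Proof.
move=> c0; rewrite nnintZ // integral_indic // setIT EFinM; congr (_ * _)%E.
exact: massE.
Qed.

Definition natF (l : I -> R[i]) : T -> R :=
  lsum (fun i y => rnorm (l i) * (mass i)^-1 * \1_(U i) y).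

Definition flatF (l : I -> R[i]) : T -> R :=
  lsum (fun i y => rnorm (l i) * \1_(U i) y).

Lemma natF_meas l : measurable_fun [set: T] (natF l).
Proof. by apply: lsum_meas => //; [exact: supp_ind|move=> i; exact: measurable_funM]. Qed.

Lemma flatF_meas l : measurable_fun [set: T] (flatF l).
Proof. by apply: lsum_meas => //; [exact: supp_ind|move=> i; exact: measurable_funM]. Qed.

Let nat_term0 (l : I -> R[i]) i y : 0 <= rnorm (l i) * (mass i)^-1 * \1_(U i) y.
Proof. by rewrite !mulr_ge0 ?rnorm_ge0 ?invr_ge0. Qed.

Let flat_term0 (l : I -> R[i]) i y : 0 <= rnorm (l i) * \1_(U i) y.
Proof. by rewrite !mulr_ge0 ?rnorm_ge0. Qed.

Lemma natF_ge0 l y : 0 <= natF l y.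
Proof. by apply: lsum_ge0 => //; exact: supp_ind. Qed.

Lemma flatF_ge0 l y : 0 <= flatF l y.
Proof. by apply: lsum_ge0 => //; exact: supp_ind. Qed.

Definition Yn (Y : set (T -> R[i])) : set (I -> R[i]) :=
  [set l | Y (fun y => (natF l y)%:C)].

Definition Yf (Y : set (T -> R[i])) : set (I -> R[i]) :=
  [set l | Y (fun y => (flatF l y)%:C)].

Definition nYn (nY : (T -> R[i]) -> R) (l : I -> R[i]) : R := nY (fun y => (natF l y)%:C).

Definition nYf (nY : (T -> R[i]) -> R) (l : I -> R[i]) : R := nY (fun y => (flatF l y)%:C).

(* [Z Y] is the reproducing kernel subspace of [Y]; the reproducing formula is
   imposed at every point, so its elements are genuine functions. *)
Definition Z (Y : set (T -> R[i])) : set (T -> R[i]) :=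
  [set F | Y F /\ forall x, cintegrable mu (fun y => F y * K x y) /\
                           F x = cintegral mu (fun y => F y * K x y)].

(** Absolute summability: the factor [(mass i)^-1] in [natF] cancels the measure of [U i], so the
    integral is the sum of the [|t i|]. *)
Definition acv (t : I -> R[i]) : Prop := (\int[mu]_y (natF t y)%:E < +oo)%E.

(* A sum over [I], written as an integral by spreading each term over its member
   of the covering, so that bounds and limits reduce to those of integrals. *)
Definition csum (t : I -> R[i]) : R[i] :=
  cintegral mu (lsum (fun i y => t i * ((mass i)^-1 * \1_(U i) y)%:C)).

Let supp_csum (t : I -> R[i]) :
  supported U (fun i y => t i * ((mass i)^-1 * \1_(U i) y)%:C).
Proof. by move=> i y nU; rewrite indF ?mulr0. Qed.

Let csum_norm (t : I -> R[i]) i y :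
  rnorm (t i * ((mass i)^-1 * \1_(U i) y)%:C) = rnorm (t i) * (mass i)^-1 * \1_(U i) y.
Proof. by rewrite rnormM rnormC ger0_norm ?mulr_ge0 ?invr_ge0 // mulrA. Qed.

Let csum_lnorm (t : I -> R[i]) :
  lsum (fun i y => rnorm (t i * ((mass i)^-1 * \1_(U i) y)%:C)) = natF t.
Proof. by congr lsum; apply/funext => i; apply/funext => y; exact: csum_norm. Qed.

Lemma csum_cvg t : acv t ->
  (fun J => rnorm (partial_sum t J - csum t)) @ totally --> (0 : R).
Proof.
move=> At.
have := @cint_lsum _ _ _ _ mu U finU (fun i y => t i * ((mass i)^-1 * \1_(U i) y)%:C).
rewrite csum_lnorm => /(_ (@supp_csum t) _ At)[].
  by move=> i; apply: cmeasZ; apply: cmeas_real; exact: measurable_funM.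
have E : (fun i => cintegral mu (fun y => t i * ((mass i)^-1 * \1_(U i) y)%:C)) = t.
  apply/funext => i.
  have ii : cintegrable mu (fun y => ((mass i)^-1 * \1_(U i) y)%:C).
    apply/cintegrableP; split; first by apply: cmeas_real; exact: measurable_funM.
    under eq_integral => y _ do rewrite rnormC ger0_norm ?mulr_ge0 ?invr_ge0 //.
    by rewrite int_ind ?invr_ge0 // ltry.
  rewrite cintegralZ // cintegral_real /Rintegral int_ind ?invr_ge0 //=.
  by rewrite mulVf ?gt_eqF // mulr1.
by rewrite E.
Qed.

Lemma csum_le t c : (\int[mu]_y (natF t y)%:E <= c%:E)%E -> rnorm (csum t) <= c.
Proof.
move=> h; have At : acv t by apply: le_lt_trans h _; exact: ltry.
have := @cint_lsum _ _ _ _ mu U finU (fun i y => t i * ((mass i)^-1 * \1_(U i) y)%:C).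
rewrite csum_lnorm => /(_ (@supp_csum t) _ At)[].
  by move=> i; apply: cmeasZ; apply: cmeas_real; exact: measurable_funM.
move=> il _ _; apply: rnorm_cintegral_le => //; apply: le_trans h.
apply: nnint_le; [exact: cmeas_rnorm (cint_meas il)|exact: natF_meas|by move=> y; exact: rnorm_ge0|].
by apply: aeW => y; rewrite -csum_lnorm; exact: rnorm_lsum.
Qed.

Lemma sum_le (t : I -> R[i]) (J : {fset I}) c : (\int[mu]_y (natF t y)%:E <= c%:E)%E ->
  \sum_(i <- J) rnorm (t i) <= c.
Proof.
move=> h; rewrite -lee_fin; apply: le_trans h.
have -> : ((\sum_(i <- J) rnorm (t i))%:E =
    \int[mu]_y (\sum_(i <- J) (rnorm (t i) * (mass i)^-1 * \1_(U i) y)%:E)%E)%E.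
  rewrite ge0_integral_sum //.
  + rewrite -sumEFin; apply: eq_bigr => i _.
    by rewrite int_ind ?mulr_ge0 ?rnorm_ge0 ?invr_ge0 // divfK ?gt_eqF.
  + by move=> i; apply/measurable_EFinP; exact: measurable_funM.
  + by move=> i y _; rewrite lee_fin.
under eq_integral => y _ do rewrite sumEFin.
apply: nnint_le; [by apply: measurable_sum => i; exact: measurable_funM|exact: natF_meas| |].
  by move=> y; exact: sumr_ge0.
apply: aeW => y; rewrite -subr_ge0 /natF -(lsum_off finU J y (supp_ind _)).
apply: (lsum_ge0 finU); first by apply: supported_off; exact: supp_ind.
by move=> i; rewrite /off; case: ifP.
Qed.

Lemma partial_le (t : I -> R[i]) J c : (\int[mu]_y (natF t y)%:E <= c%:E)%E ->
  rnorm (partial_sum t J) <= c.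
Proof. by move=> h; rewrite partial_sumE (le_trans (rnorm_sum _ _ _)) // sum_le. Qed.

Lemma natF_fin (t : I -> R[i]) (J : {fset I}) y : (forall i, i \notin J -> t i = 0) ->
  natF t y = \sum_(i <- J) rnorm (t i) * (mass i)^-1 * \1_(U i) y.
Proof.
move=> tJ; apply/eqP; rewrite -subr_eq0 /natF -(lsum_off finU J y (supp_ind _)).
rewrite (lsum_cover finU) ?big1 //; last by apply: supported_off; exact: supp_ind.
by move=> i _; rewrite /off; case: ifPn => // iJ; rewrite tJ // rnorm0 !mul0r.
Qed.

Lemma csum_fin (t : I -> R[i]) (J : {fset I}) : (forall i, i \notin J -> t i = 0) ->
  acv t /\ csum t = \sum_(i <- J) t i.
Proof.
move=> tJ; have At : acv t.
  rewrite /acv; under eq_integral => y _ do rewrite (natF_fin _ tJ) -sumEFin.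
  rewrite ge0_integral_sum //; last 2 first.
  - by move=> i; apply/measurable_EFinP; exact: measurable_funM.
  - by move=> i y _; rewrite lee_fin.
  rewrite (eq_bigr (fun i => (rnorm (t i))%:E)) ?sumEFin ?ltry // => i _.
  by rewrite int_ind ?mulr_ge0 ?rnorm_ge0 ?invr_ge0 // divfK ?gt_eqF.
split => //; apply: (@cvg_partial_unique _ _ t); first exact: csum_cvg.
apply: cvg_totally0 => [J'|e e0]; first exact: rnorm_ge0.
exists J => J' JJ; rewrite partial_sumE -(big_fset_incl _ JJ) ?subrr ?rnorm0 //.
by move=> i _ /tJ.
Qed.

Lemma csum_linear (a : R[i]) s t : acv s -> acv t ->
  csum (fun i => a * s i + t i) = a * csum s + csum t.
Proof.
move=> As At.
have il u : acv u -> cintegrable mu (lsum (fun i y => u i * ((mass i)^-1 * \1_(U i) y)%:C)).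
  move=> Au; have := @cint_lsum _ _ _ _ mu U finU (fun i y => u i * ((mass i)^-1 * \1_(U i) y)%:C).
  rewrite csum_lnorm => /(_ (@supp_csum u) _ Au)[] // i.
  by apply: cmeasZ; apply: cmeas_real; exact: measurable_funM.
rewrite /csum -(cintegralZ a (il _ As)) -(cintegralD (cintZ a (il _ As)) (il _ At)).
congr cintegral; apply/funext => y; rewrite -(lsumZl finU) //.
rewrite -(lsumD finU) //; last by move=> i z nU; rewrite indF ?mulr0.
by apply: eq_fsbigr => i _; rewrite mulrDl mulrA.
Qed.

(** * The reproducing kernel subspace of a function space *)

Section CoreY.
Variables (Y : set (T -> R[i])) (nY : (T -> R[i]) -> R).
Hypothesis YC : core_space Y nY.
Let YS := cs_solid YC.

(** Subtract two reproducing formulas. The point moves in the first argument of [K] but [o] measures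
    the second, so Hermitian symmetry brings in the transposed oscillation kernel. *)
Lemma Z_osc F i y y' : Z Y F -> U i y -> U i y' ->
  ((rnorm (F y - F y'))%:E <= \int[mu]_t (o t y * rnorm (F t))%:E)%E.
Proof.
move=> [YF ZF] Uy Uy'; have [i1 e1] := ZF y; have [i2 e2] := ZF y'.
rewrite e1 e2 -cintegralB //.
have iB := cintB i1 i2; apply: le_trans (rnorm_cintegral iB) _.
apply: nnint_le.
- exact: cmeas_rnorm (cint_meas iB).
- by apply: measurable_funM => //; apply: cmeas_rnorm; exact: (ss_meas YS YF).
- by move=> t; exact: rnorm_ge0.
- apply: aeW => t; rewrite -mulrBr rnormM mulrC ler_wpM2r ?rnorm_ge0 //.
  by rewrite (K_herm y) (K_herm y') -rmorphB rnorm_conj; exact: o_bound Uy Uy'.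
Qed.

(** The exceptional null set concerns [y] only; [y'] is arbitrary and may be a sampling point, even
    one of measure zero. *)
Lemma Z_osc_major F : Z Y F -> exists G : T -> R,
  [/\ forall x, 0 <= G x, measurable_fun [set: T] G, Y (fun x => (G x)%:C),
      nY (fun x => (G x)%:C) <= dl * nY F &
      {ae mu, forall y, forall i y', U i y -> U i y' -> rnorm (F y - F y') <= G y}].
Proof.
move=> ZF; have [G [G0 mG YG nG kG]] := ss_kernel_meas YS (cs_oT YC) ZF.1.
exists G; split => //; apply: filterS kG => y h i y' Uy Uy'.
by rewrite -lee_fin (le_trans (Z_osc ZF Uy Uy')).
Qed.

Lemma avg_real : exists2 C : R, 0 <= C & forall (g : T -> R) i y, (forall x, 0 <= g x) ->
  Y (fun x => (g x)%:C) -> U i y ->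
  (\int[mu]_t (g t * \1_(U i) t)%:E <= (C * nY (fun x => (g x)%:C) * mass i * v y)%:E)%E.
Proof.
have [C C_ge0 hC] := cs_avg YC; exists C => // g i y g0 Yg Uy.
apply: le_trans (hC _ _ _ Yg Uy); under [leRHS]eq_integral => t _ do rewrite rnormC ger0_norm //.
exact: lexx.
Qed.

(** For almost every [t] in a member [U i] containing [y], [|F(y)|] is at most [|F(t)| + G(t)];
    average this over [U i] and apply [cs_avg]. *)
Lemma Z_bound : exists2 C : R, 0 <= C &
  forall F, Z Y F -> forall y, rnorm (F y) <= C * nY F * v y.
Proof.
have [C C_ge0 hC] := avg_real; exists (C * (1 + dl)); first by rewrite mulr_ge0 ?addr_ge0.
move=> F ZF y; have [i Uy] := covU y.
have [G [G0 mG YG nG kG]] := Z_osc_major ZF.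
have [Yn' nF] := ss_abs YS ZF.1.
have mF : measurable_fun [set: T] (fun t => rnorm (F t)).
  by apply: cmeas_rnorm; exact: (ss_meas YS ZF.1).
have h1 := hC _ i y (fun x => rnorm_ge0 (F x)) Yn' Uy.
have h2 := hC _ i y G0 YG Uy.
have h : ((rnorm (F y) * mass i)%:E <=
    (C * nY (fun x => (rnorm (F x))%:C) * mass i * v y +
     C * nY (fun x => (G x)%:C) * mass i * v y)%:E)%E.
  rewrite EFinD; apply: le_trans (leeD h1 h2).
  rewrite -nnintD; last 4 first.
  - exact: measurable_funM.
  - by move=> t; rewrite mulr_ge0 ?rnorm_ge0.
  - exact: measurable_funM.
  - by move=> t; rewrite mulr_ge0.
  rewrite -int_ind ?rnorm_ge0 //; apply: nnint_le.
  - exact: measurable_funM.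
  - by apply: measurable_funD; apply: measurable_funM.
  - by move=> t; rewrite mulr_ge0 ?rnorm_ge0.
  - apply: filterS kG => t ht; rewrite -mulrDl.
    have [Ut|nUt] := pselect (U i t); last by rewrite indF // !mulr0.
    rewrite ler_wpM2r // (le_trans (rnorm_le_dist _ (F t))) // lerD2l rnorm_distC.
    exact: ht Ut Uy.
rewrite lee_fin in h.
rewrite -(ler_pM2r (mass0 i)); apply: le_trans h _.
rewrite -!mulrDl -mulrDr -!mulrA [v y * _]mulrC !mulrA.
rewrite ler_wpM2r // ler_wpM2r // -mulrA ler_wpM2l //.
rewrite mulrDl mul1r lerD //.
Qed.

Lemma Z_linear a F G : Z Y F -> Z Y G -> Z Y (a *: F + G).
Proof.
move=> [YF hF] [YG hG]; split; first exact: (ss_linear YS).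
move=> x; have [i1 e1] := hF x; have [i2 e2] := hG x.
have E : (fun y => (a *: F + G) y * K x y) = (fun y => a * (F y * K x y) + G y * K x y).
  by apply/funext => y; rewrite mulrA -mulrDl.
rewrite E; split; first by apply: cintD => //; exact: cintZ.
by rewrite cintegralD ?cintegralZ -?e1 -?e2 //; exact: cintZ.
Qed.

(** The reproducing integral does not see null sets. This is why the seminorm of [Y] becomes a norm
    on [Z Y]. *)
Lemma Z_ae0 F : Z Y F -> {ae mu, forall x, F x = 0} -> F = 0.
Proof.
move=> [YF ZF] F0; apply/funext => x; have [i1 ->] := ZF x.
apply/rnorm0_eq0/eqP; rewrite eq_le rnorm_ge0 andbT; apply: rnorm_cintegral_le => //.
have -> : (0%:E = \int[mu]_(x in [set: T]) (0 : R)%:E)%E by rewrite integral0.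
apply: nnint_le => //; first exact: cmeas_rnorm (cint_meas i1).
  by move=> y; exact: rnorm_ge0.
by apply: filterS F0 => y ->; rewrite mul0r rnorm0.
Qed.

Lemma nat_coef_bound : exists2 C : R, 0 <= C &
  forall l, Yn Y l -> forall i, rnorm (l i) <= C * nYn nY l * mass i * v (xs i).
Proof.
have [C C_ge0 hC] := avg_real; exists C => // l Yl i.
have := hC _ i (xs i) (natF_ge0 l) Yl (xsU i); rewrite -lee_fin; apply: le_trans.
rewrite -[X in (X%:E <= _)%E](@divfK _ (mass i)) ?gt_eqF // -int_ind; last first.
  by rewrite mulr_ge0 ?rnorm_ge0 ?invr_ge0.
apply: nnint_le.
- exact: measurable_funM.
- by apply: measurable_funM => //; exact: natF_meas.
- by move=> t; exact: nat_term0.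
apply: aeW => t; have [Ut|nUt] := pselect (U i t); last by rewrite indF // !mulr0.
by rewrite -[leLHS]mulr1 -(indT Ut) ler_wpM2r //; apply: (lsum_ge1 finU i (supp_ind _)).
Qed.

(** At almost every [t] at most [Nov] members contain [t], and each contributes at most
    [|F(t)| + G(t)] with [G] the oscillation majorant. *)
Lemma Z_sample F : Z Y F -> Yf Y (F \o xs) /\ nYf nY (F \o xs) <= Nov%:R * (1 + dl) * nY F.
Proof.
move=> ZF; have [G [G0 mG YG nG kG]] := Z_osc_major ZF.
have [Ya na] := ss_abs YS ZF.1.
have E : (fun x => (rnorm (F x) + G x)%:C) = (fun x => (rnorm (F x))%:C) + (fun x => (G x)%:C).
  by apply/funext => x; rewrite rmorphD.
have YD : Y (fun x => (rnorm (F x) + G x)%:C) by rewrite E; exact: ssD YS _ _ Ya YG.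
have [] := @ss_realZ _ _ _ _ _ _ YS Nov%:R (fun y => (flatF (F \o xs) y)%:C) _ (ler0n _ _) _ YD.
- by apply: cmeas_real; exact: flatF_meas.
- apply: filterS kG => t ht; rewrite rnormC ger0_norm ?flatF_ge0 //.
  rewrite /flatF (lsum_cover finU) //; last exact: supp_ind.
  apply: (@le_trans _ _ (\sum_(i <- fset_set [set i | U i t]) (rnorm (F t) + G t))).
    rewrite big_seq [leRHS]big_seq; apply: ler_sum => i; rewrite in_fset_set // inE => Ut.
    rewrite indT // mulr1 (le_trans (rnorm_le_dist _ (F t))) // lerD2l rnorm_distC.
    exact: ht Ut (xsU i).
  rewrite big_const_seq count_predT iter_addr addr0 -[leLHS]mulr_natl.
  by rewrite ler_wpM2r ?addr_ge0 ?rnorm_ge0 // ler_nat ovU.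
move=> Yfl h; split => //; apply: le_trans h _; rewrite -mulrA ler_wpM2l // E.
rewrite (le_trans (ss_triangle YS Ya YG)) // mulrDl mul1r lerD //.
Qed.

Lemma nat_le_flat l b : Yf Y b -> (forall i, rnorm (l i) <= mass i * rnorm (b i)) ->
  Yn Y l /\ nYn nY l <= nYf nY b.
Proof.
move=> Yb lb; apply: (ss_dom YS) Yb _; first by apply: cmeas_real; exact: natF_meas.
apply: aeW => y; rewrite rnormC ger0_norm ?natF_ge0 //.
apply: (ler_lsum finU); [exact: supp_ind|exact: supp_ind|move=> i _].
by rewrite ler_wpM2r // ler_pdivrMr // mulrC lb.
Qed.

Lemma Yn_fin l (J : {fset I}) : (forall i, i \notin J -> l i = 0) -> Yn Y l.
Proof.
move=> lJ; rewrite /Yn /=.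
have -> : (fun y => (natF l y)%:C) =
    \sum_(i <- J) ((rnorm (l i) * (mass i)^-1)%:C *: (fun y => (\1_(U i) y)%:C)).
  apply/funext => y; rewrite (natF_fin y lJ) fct_sumE rmorph_sum /=.
  by apply: eq_bigr => i _; rewrite rmorphM.
elim/big_ind: _ => [|F G|i _]; [exact: (ss_zero YS)|exact: (ssD YS)|].
by apply: (ssZ YS); exact: (cs_ind YC).
Qed.

(** By [Z_bound] a Cauchy sequence converges at every point. The bound is uniform along the sequence
    up to the factor [v], and [|K(y,x)| v(y)] is integrable in [y], so dominated convergence carries
    the reproducing formula to the limit. *)
Lemma Z_closed (u : nat -> T -> R[i]) : (forall k, Z Y (u k)) ->
  (forall eps, 0 < eps -> exists N, forall j k,
      (N <= j)%N -> (N <= k)%N -> nY (u j - u k) < eps) ->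
  exists2 F, Z Y F & nY (u k - F) @[k --> \oo] --> (0 : R).
Proof.
move=> Zu uC; have [C C_ge0 hC] := Z_bound.
have ZB j k : Z Y (u j - u k).
  by rewrite addrC -scaleN1r; exact: Z_linear.
have pC x e : 0 < e -> exists N, forall j k, (N <= j)%N -> (N <= k)%N ->
    rnorm (u j x - u k x) < e.
  move=> e0; have Cv : 0 < C * v x + 1 by rewrite ltr_wpDl ?mulr_ge0.
  have [|N hN] := uC (e / (C * v x + 1)); first by rewrite divr_gt0.
  exists N => j k Nj Nk; apply: le_lt_trans (hC _ (ZB j k) x) _.
  have := hN j k Nj Nk; rewrite ltr_pdivlMr //; apply: le_lt_trans.
  rewrite mulrAC mulrC ler_wpM2l ?lerDl //.
  exact: (ss_ge0 YS (ZB j k).1).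
have [F uF] : exists F : T -> R[i], forall x, rnorm (u k x - F x) @[k --> \oo] --> (0 : R).
  suff h x : exists l : R[i], rnorm (u k x - l) @[k --> \oo] --> (0 : R).
    by exists (fun x => projT1 (cid (h x))) => x; exact: projT2 (cid (h x)).
  by apply: rnorm_cauchy_cvg => e /(pC x).
have [YF nF] := ss_fatou YS (fun k => (Zu k).1) uC uF.
exists F => //; split => // x.
have [M hM] : exists M, forall k, nY (u k) <= M.
  have [N hN] := uC 1 ltr01.
  exists (\sum_(k < N) nY (u k) + (1 + nY (u N))) => k.
  have [kN|Nk] := ltnP k N.
    rewrite (bigD1 (Ordinal kN)) //= -addrA lerDl addr_ge0 //.
      by apply: sumr_ge0 => j _; exact: (ss_ge0 YS (Zu j).1).
    by rewrite addr_ge0 //; exact: (ss_ge0 YS (Zu N).1).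
  apply: ler_wpDl; first by apply: sumr_ge0 => j _; exact: (ss_ge0 YS (Zu j).1).
  have -> : u k = (u k - u N) + u N by rewrite subrK.
  apply: le_trans (ss_triangle YS (ZB k N).1 (Zu N).1) _.
  by rewrite lerD2r ltW // hN.
have M0 : 0 <= M by exact: le_trans (ss_ge0 YS (Zu 0%N).1) (hM 0%N).
have mKv : measurable_fun [set: T] (fun y => C * M * (rnorm (K y x) * v y)).
  by apply: measurable_funM => //; apply: measurable_funM => //; exact: cmeas_rnorm.
have [] := @cint_dominated _ _ _ mu (fun k y => u k y * K x y) (fun y => F y * K x y) _ _ mKv.
- by move=> k; apply: cmeasM => //; exact: (ss_meas YS (Zu k).1).
- move=> y; have -> : (fun k => rnorm (u k y * K x y - F y * K x y)) =
      (fun k => rnorm (u k y - F y) * rnorm (K x y)).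
    by apply/funext => k; rewrite -mulrBl rnormM.
  by rewrite -[X in _ --> X](mul0r (rnorm (K x y))); apply: cvgMr_tmp; exact: uF.
- move=> k y; rewrite rnormM K_herm rnorm_conj.
  have := hC _ (Zu k) y; have := hM k; have := rnorm_ge0 (K y x); have := v0 y.
  move=> h1 h2 h3 h4.
  rewrite [leRHS](_ : _ = (C * M * v y) * rnorm (K y x)); last by ring.
  by rewrite ler_wpM2r // (le_trans h4) // ler_wpM2r // ler_wpM2l.
- rewrite nnintZ //; last 3 first.
  + by apply: measurable_funM => //; exact: cmeas_rnorm.
  + by move=> y; rewrite mulr_ge0 ?rnorm_ge0.
  + by rewrite mulr_ge0.
  by rewrite lte_mul_pinfty ?lee_fin ?mulr_ge0 // (le_lt_trans (K_L1 x)) // ltry.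
move=> iF _ lim; split => //.
apply: (rnorm_cvg_unique (uF x)).
rewrite (_ : (fun k => rnorm (u k x - _)) =
  (fun k => rnorm (cintegral mu (fun y => u k y * K x y) - cintegral mu (fun y => F y * K x y)))) //.
by apply/funext => k; rewrite -((Zu k).2 x).2.
Qed.

Lemma Z_banach : banach_space (Z Y) nY.
Proof.
split; last by move=> F ZF n0; apply: Z_ae0 => //; exact: ss_definite YS _ ZF.1 n0.
split.
- split; first exact: (ss_zero YS).
  move=> x; have -> : (fun y => (0 : T -> R[i]) y * K x y) = (fun=> 0).
    by apply/funext => y; rewrite mul0r.
  by split; [exact: cint0|rewrite cintegral0].
- by move=> a F G; exact: Z_linear.
- by move=> F [YF _]; exact: (ss_ge0 YS).
- by move=> a F [YF _]; exact: (ss_scale YS).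
- by move=> F G [YF _] [YG _]; exact: (ss_triangle YS).
- exact: Z_closed.
Qed.
End CoreY.

(** * Synthesis and the pairing with the test space [Z L1v] *)

Notation L1v := (wL1 mu v).
Notation nL1v := (wL1n mu v).
Hypothesis L1S : core_space L1v nL1v.
Let L1SS := cs_solid L1S.

Definition col (x : T) : T -> R[i] := K^~ x.

Lemma C0_ge0 (x : T) : 0 <= C0.
Proof.
have : 0 <= C0 * v x.
  rewrite -lee_fin; apply: le_trans (K_L1 x); apply: integral_ge0 => y _.
  by rewrite lee_fin mulr_ge0 ?rnorm_ge0.
by rewrite pmulr_lge0.
Qed.

Lemma Z_col x : Z L1v (col x) /\ nL1v (col x) <= C0 * v x.
Proof.
have [L n] := wL1n_le v1 (mKT x) (K_L1 x).
by split => //; split => // y; split; [exact: K_int|exact: K_rep].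
Qed.

(* Coefficient families for which the synthesis converges at every point. *)
Definition bounded_coef (l : I -> R[i]) (C : R) : Prop :=
  0 <= C /\ forall i, rnorm (l i) <= C * mass i * v (xs i).

(** The factor [mass i] allowed in the coefficients turns the sum into an integral: on [U i] the
    sample of [G] is at most [|G| + H] almost everywhere, the weights at [xs i] and at [y] differ by
    a factor at most [CU], and at most [Nov] terms overlap. *)
Lemma L1v_pair : exists2 C1 : R, 0 <= C1 & forall l C G, bounded_coef l C -> Z L1v G ->
  (\int[mu]_y (natF (fun i => l i * conjC (G (xs i))) y)%:E <= (C * C1 * nL1v G)%:E)%E.
Proof.
exists (Nov%:R * CU * (1 + dl)); first by rewrite !mulr_ge0 ?addr_ge0 // (le_trans ler01).
move=> l C G [C_ge0 hl] ZG.
have CU0 : 0 <= CU by exact: le_trans ler01 CU1.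
have [H [H0 mH LH nH kH]] := Z_osc_major L1S ZG.
have mG : measurable_fun [set: T] (fun y => rnorm (G y) * v y).
  by apply: wL1_meas => //; exact: (ss_meas L1SS ZG.1).
have mHv : measurable_fun [set: T] (fun y => H y * v y) by exact: measurable_funM.
have c0 : 0 <= Nov%:R * (C * CU) :> R by rewrite !mulr_ge0.
apply: (@le_trans _ _ (\int[mu]_y (Nov%:R * (C * CU) * (rnorm (G y) * v y + H y * v y))%:E)%E).
  apply: nnint_le; [exact: natF_meas| |by move=> y; exact: natF_ge0|].
    by apply: measurable_funM => //; exact: measurable_funD.
  apply: filterS kH => y hy; rewrite /natF (lsum_cover finU); last exact: supp_ind.
  apply: (@le_trans _ _ (\sum_(i <- fset_set [set i | U i y])
      (C * CU * (rnorm (G y) * v y + H y * v y)))).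
    rewrite big_seq [leRHS]big_seq; apply: ler_sum => i; rewrite in_fset_set // inE => Uy.
    rewrite indT // mulr1 rnormM rnorm_conj ler_pdivrMr //.
    have h1 := hl i; have h2 := vU (xsU i) Uy.
    have h3 : rnorm (G (xs i)) <= rnorm (G y) + H y.
      rewrite (le_trans (rnorm_le_dist _ (G y))) // lerD2l rnorm_distC.
      exact: hy Uy (xsU i).
    apply: (@le_trans _ _ (C * mass i * (CU * v y) * (rnorm (G y) + H y))).
      apply: ler_pM => //; try exact: rnorm_ge0.
      by rewrite (le_trans h1) // ler_wpM2l ?mulr_ge0.
    by rewrite le_eqVlt; apply/orP; left; apply/eqP; ring.
  rewrite big_const_seq count_predT iter_addr addr0 -[leLHS]mulr_natl -!mulrA.
  rewrite ler_wpM2r ?ler_nat ?ovU // mulr_ge0 // mulr_ge0 // addr_ge0 //.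
  - by rewrite mulr_ge0 ?rnorm_ge0.
  - by rewrite mulr_ge0.
rewrite nnintZ //; last 2 first.
- exact: measurable_funD.
- by move=> y; rewrite addr_ge0 ?mulr_ge0 ?rnorm_ge0.
rewrite nnintD //; last 2 first.
- by move=> y; rewrite mulr_ge0 ?rnorm_ge0.
- by move=> y; rewrite mulr_ge0.
rewrite (wL1nE v1 ZG.1).
have -> : (\int[mu]_x (H x * v x)%:E = (nL1v (fun x => (H x)%:C))%:E)%E.
  by rewrite -wL1nE //; apply: eq_integral => y _; rewrite rnormC ger0_norm.
rewrite -EFinD -EFinM lee_fin.
apply: (@le_trans _ _ (Nov%:R * (C * CU) * (nL1v G + dl * nL1v G))).
  by rewrite ler_wpM2l // lerD2l.
by rewrite le_eqVlt; apply/orP; left; apply/eqP; ring.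
Qed.

Lemma acv_le t c : (\int[mu]_y (natF t y)%:E <= c%:E)%E -> acv t.
Proof. by move=> h; apply: le_lt_trans h _; exact: ltry. Qed.

Definition syn (l : I -> R[i]) (x : T) : R[i] := csum (fun i => l i * K x (xs i)).

Let col_conj x i : conjC (col x (xs i)) = K x (xs i).
Proof. by rewrite /col -K_herm. Qed.

(** [L1v_pair] with [G] the atom [col x], whose norm is at most [C0 * v x]. *)
Lemma syn_term : exists2 C2 : R, 0 <= C2 & forall l C, bounded_coef l C -> forall x,
  (\int[mu]_y (natF (fun i => l i * K x (xs i)) y)%:E <= (C * C2 * v x)%:E)%E.
Proof.
have [C1 C1_ge0 h1] := L1v_pair.
exists (C1 * `|C0|); first by rewrite mulr_ge0.
move=> l C lC x; have [Zc nc] := Z_col x.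
have := h1 l C _ lC Zc.
have -> : (fun i => l i * conjC (col x (xs i))) = (fun i => l i * K x (xs i)).
  by apply/funext => i; rewrite col_conj.
move=> /le_trans -> //; rewrite lee_fin -!mulrA ler_wpM2l ?lC.1 // ler_wpM2l //.
by rewrite (le_trans nc) // ler_wpM2r // ler_norm.
Qed.

Lemma syn_cvg l C x : bounded_coef l C ->
  (fun J => rnorm (partial_sum (fun i => l i * K x (xs i)) J - syn l x)) @ totally --> (0 : R).
Proof. by move=> lC; have [C2 _ h] := syn_term; apply: csum_cvg; exact: acv_le (h l C lC x). Qed.

Lemma syn_meas l C : bounded_coef l C -> cmeasurable (syn l).
Proof.
move=> lC; apply: (@cmeas_lim _ _ _ (fun n x => partial_sum (fun i => l i * K x (xs i)) (upto I n))).
  move=> n; under eq_fun do rewrite partial_sumE.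
  by apply: cmeas_sum => i; apply: cmeasZ; exact: mKT.
by move=> x; apply: cvg_partial_seq; exact: syn_cvg lC.
Qed.

Lemma syn_bound : exists2 C2 : R, 0 <= C2 & forall l C, bounded_coef l C -> forall x,
  rnorm (syn l x) <= C * C2 * v x.
Proof.
by have [C2 C20 h] := syn_term; exists C2 => // l C lC x; apply: csum_le; exact: h.
Qed.

Lemma K_col_pair G i : Z L1v G ->
  cintegrable mu (fun x => K x (xs i) * conjC (G x)) /\
  cintegral mu (fun x => K x (xs i) * conjC (G x)) = conjC (G (xs i)).
Proof.
move=> [LG ZG]; have [i1 e1] := ZG (xs i).
have E : (fun x => K x (xs i) * conjC (G x)) = (fun x => conjC (G x * K (xs i) x)).
  by apply/funext => x; rewrite rmorphM /= (K_herm x) mulrC.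
by rewrite E; split; [exact: cint_conj|rewrite cintegral_conj // -e1].
Qed.

(** All partial sums of the synthesis are bounded by the same multiple of [v], so they may be
    integrated termwise against [G]; the reproducing formula of [G] then evaluates each term as a
    sample. *)
Lemma syn_pair l C G : bounded_coef l C -> Z L1v G ->
  [/\ cintegrable mu (fun x => syn l x * conjC (G x)),
      acv (fun i => l i * conjC (G (xs i))) &
      cintegral mu (fun x => syn l x * conjC (G x)) = csum (fun i => l i * conjC (G (xs i)))].
Proof.
move=> lC ZG; have [C1 C10 h1] := L1v_pair; have [C2 C20 h2] := syn_term.
have A := acv_le (h1 l C G lC ZG).
have mG := ss_meas L1SS ZG.1.
have mb : measurable_fun [set: T] (fun x => C * C2 * (rnorm (G x) * v x)).
  by apply: measurable_funM => //; exact: wL1_meas.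
have CC : 0 <= C * C2 by rewrite mulr_ge0 ?lC.1.
have [] := @cint_dominated _ _ _ mu
  (fun n x => partial_sum (fun i => l i * K x (xs i)) (upto I n) * conjC (G x))
  (fun x => syn l x * conjC (G x)) _ _ mb.
- move=> n; apply: cmeasM; last exact: cmeas_conj.
  under eq_fun do rewrite partial_sumE.
  by apply: cmeas_sum => i; apply: cmeasZ; exact: mKT.
- move=> x; have -> : (fun n => rnorm (partial_sum (fun i => l i * K x (xs i)) (upto I n) * conjC (G x) -
        syn l x * conjC (G x))) =
      (fun n => rnorm (partial_sum (fun i => l i * K x (xs i)) (upto I n) - syn l x) * rnorm (G x)).
    by apply/funext => n; rewrite -mulrBl rnormM rnorm_conj.
  rewrite -[X in _ --> X](mul0r (rnorm (G x))); apply: cvgMr_tmp.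
  by apply: cvg_partial_seq; exact: syn_cvg lC.
- move=> n x; rewrite rnormM rnorm_conj mulrA mulrAC ler_wpM2r ?rnorm_ge0 //.
  exact: partial_le (h2 l C lC x).
- rewrite nnintZ //; last 2 first.
  + exact: wL1_meas.
  + by move=> x; exact: wL1_nn.
  by rewrite lte_mul_pinfty ?lee_fin //; case: ZG => -[].
move=> iF _ lim; split => //.
have E n : cintegral mu (fun x => partial_sum (fun i => l i * K x (xs i)) (upto I n) * conjC (G x)) =
    partial_sum (fun i => l i * conjC (G (xs i))) (upto I n).
  have -> : (fun x => partial_sum (fun i => l i * K x (xs i)) (upto I n) * conjC (G x)) =
      (fun x => \sum_(i <- upto I n) l i * (K x (xs i) * conjC (G x))).
    by apply/funext => x; rewrite partial_sumE mulr_suml; apply: eq_bigr => i _; rewrite mulrA.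
  rewrite cintegral_sum => [|i]; last by apply: cintZ; exact: (K_col_pair i ZG).1.
  rewrite partial_sumE; apply: eq_bigr => i _.
  by have [i1 e1] := K_col_pair i ZG; rewrite cintegralZ // e1.
have := cvg_partial_seq (csum_cvg A).
move: lim; under eq_fun do rewrite E.
by move=> l1 l2; exact: (rnorm_cvg_unique l1 l2).
Qed.

Lemma syn_repro l C x : bounded_coef l C ->
  cintegrable mu (fun y => syn l y * K x y) /\ syn l x = cintegral mu (fun y => syn l y * K x y).
Proof.
move=> lC; have [iF _ e] := syn_pair lC (Z_col x).1.
have E : (fun y => syn l y * conjC (col x y)) = (fun y => syn l y * K x y).
  by apply/funext => y; rewrite /col -K_herm.
rewrite -E; split => //; rewrite e; congr csum.
by apply/funext => i; rewrite col_conj.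
Qed.

(* The common ambient space of all the [Z Y]. *)
Definition Zv : set (T -> R[i]) :=
  [set F | [/\ cmeasurable F, exists2 C : R, 0 <= C & forall x, rnorm (F x) <= C * v x &
    forall x, F x = cintegral mu (fun y => F y * K x y)]].

Lemma Z_Zv Y nY F : core_space Y nY -> Z Y F -> Zv F.
Proof.
move=> YC [YF ZF]; split; first exact: (ss_meas (cs_solid YC) YF).
- have [C C_ge0 h] := Z_bound YC; exists (C * nY F); last exact: h.
  by rewrite mulr_ge0 ?(ss_ge0 (cs_solid YC)).
- by move=> x; case: (ZF x).
Qed.

(** The growth bound and [K_L1] supply the integrability, so inside [Zv] the only question is
    membership in [Y]. *)
Lemma Zv_Z Y F : Zv F -> Y F -> Z Y F.
Proof.
move=> [mF [C C_ge0 FC] rF] YF; split => // x; split => //.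
apply: (@cint_le _ _ _ _ _ (fun y => C * (rnorm (K y x) * v y))).
- exact: cmeasM.
- by apply: measurable_funM => //; apply: measurable_funM => //; exact: cmeas_rnorm.
- apply: aeW => y; rewrite rnormM K_herm rnorm_conj [rnorm (K y x) * _]mulrC mulrA.
  by rewrite ler_wpM2r ?rnorm_ge0.
- rewrite nnintZ //; last 2 first.
  + by apply: measurable_funM => //; exact: cmeas_rnorm.
  + by move=> y; rewrite mulr_ge0 ?rnorm_ge0.
  by rewrite lte_mul_pinfty ?lee_fin // (le_lt_trans (K_L1 x)) // ltry.
Qed.

Lemma Zv_pair F C G : cmeasurable F -> 0 <= C -> (forall x, rnorm (F x) <= C * v x) -> L1v G ->
  cintegrable mu (fun y => F y * conjC (G y)) /\
  rnorm (cintegral mu (fun y => F y * conjC (G y))) <= C * nL1v G.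
Proof.
move=> mF C_ge0 FC LG; have mG := ss_meas L1SS LG.
have mGv : measurable_fun [set: T] (fun y => rnorm (G y) * v y) by exact: wL1_meas.
have mFG : cmeasurable (fun y => F y * conjC (G y)) by apply: cmeasM => //; exact: cmeas_conj.
have FG y : rnorm (F y * conjC (G y)) <= C * (rnorm (G y) * v y).
  by rewrite rnormM rnorm_conj [rnorm (G y) * _]mulrC mulrA ler_wpM2r ?rnorm_ge0.
have Ev : (\int[mu]_y (C * (rnorm (G y) * v y))%:E = (C * nL1v G)%:E)%E.
  by rewrite nnintZ // ?(wL1nE v1 LG) ?EFinM // => y; exact: wL1_nn.
have iF : cintegrable mu (fun y => F y * conjC (G y)).
  apply: (cint_le mFG _ (aeW mu FG)); first exact: measurable_funM.
  by rewrite Ev ltry.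
split => //; apply: rnorm_cintegral_le => //; rewrite -Ev; apply: nnint_le.
- exact: cmeas_rnorm.
- exact: measurable_funM.
- by move=> y; exact: rnorm_ge0.
- exact: aeW.
Qed.

Lemma syn_Zv l C : bounded_coef l C -> Zv (syn l).
Proof.
move=> lC; split; first exact: syn_meas lC.
- have [C2 C20 h] := syn_bound; exists (C * C2); first by rewrite mulr_ge0 ?lC.1.
  exact: h.
- by move=> x; case: (syn_repro x lC).
Qed.

Lemma syn_linear a l C l' C' : bounded_coef l C -> bounded_coef l' C' ->
  syn (fun i => a * l i + l' i) = a *: syn l + syn l'.
Proof.
move=> lC lC'; have [C2 _ h] := syn_term; apply/funext => x.
rewrite [RHS](_ : _ = a * syn l x + syn l' x) // /syn -csum_linear.
- by congr csum; apply/funext => i; rewrite mulrDl mulrA.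
- exact: acv_le (h l C lC x).
- exact: acv_le (h l' C' lC' x).
Qed.

Lemma syn_fin l (J : {fset I}) : (forall i, i \notin J -> l i = 0) ->
  syn l = \sum_(i <- J) l i *: col (xs i).
Proof.
move=> lJ; apply/funext => x; rewrite fct_sumE /syn.
have h i : i \notin J -> l i * K x (xs i) = 0 by move=> /lJ ->; rewrite mul0r.
by have [_ ->] := csum_fin h.
Qed.

Lemma Yn_bounded Y nY l : core_space Y nY -> Yn Y l -> exists C, bounded_coef l C.
Proof.
move=> YC Yl; have [C C_ge0 h] := nat_coef_bound YC.
exists (C * nYn nY l); split; last by move=> i; exact: h.
by rewrite mulr_ge0 // (ss_ge0 (cs_solid YC)).
Qed.

(** For [y] in [U i], [|K(x,x_i)|] is at most [|K(x,y)| + o(x,y)]; hence the synthesis is dominated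
    by the kernels [|K|] and [o] applied to [natF l], which gives the constant [nR + dl]. *)
Lemma syn_Y Y nY l : core_space Y nY -> Yn Y l ->
  Z Y (syn l) /\ nY (syn l) <= (nR + dl) * nYn nY l.
Proof.
move=> YC Yl; have YS := cs_solid YC; have [C lC] := Yn_bounded YC Yl.
have [G1 [G10 mG1 YG1 nG1 k1]] := ss_kernel_meas YS (cs_K YC) Yl.
have [G2 [G20 mG2 YG2 nG2 k2]] := ss_kernel_meas YS (cs_o YC) Yl.
have mn := natF_meas l.
have mKx x : measurable_fun [set: T] (fun y => rnorm (K x y)) by exact: cmeas_rnorm.
have b x : (\int[mu]_y (natF (fun i => l i * K x (xs i)) y)%:E <=
    \int[mu]_y (rnorm (K x y) * rnorm (natF l y)%:C)%:E +
    \int[mu]_y (o x y * rnorm (natF l y)%:C)%:E)%E.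
  under [X in (_ <= X + _)%E]eq_integral => y _ do rewrite rnormC ger0_norm ?natF_ge0 //.
  under [X in (_ <= _ + X)%E]eq_integral => y _ do rewrite rnormC ger0_norm ?natF_ge0 //.
  rewrite -nnintD; last 4 first.
  - exact: measurable_funM.
  - by move=> y; rewrite mulr_ge0 ?rnorm_ge0 ?natF_ge0.
  - exact: measurable_funM.
  - by move=> y; rewrite mulr_ge0 ?natF_ge0.
  apply: nnint_le.
  - exact: natF_meas.
  - by apply: measurable_funD; apply: measurable_funM.
  - by move=> y; exact: natF_ge0.
  apply: aeW => y; rewrite -mulrDl /natF -(lsumZl finU); last exact: supp_ind.
  apply: (ler_lsum finU); first exact: supp_ind.
    by move=> i w nU; rewrite indF ?mulr0.
  move=> i Uy; rewrite rnormM !mulrA ler_wpM2r // ler_wpM2r ?invr_ge0 //.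
  rewrite mulrC ler_wpM2r ?rnorm_ge0 // (le_trans (rnorm_le_dist _ (K x y))) // lerD2l.
  by rewrite rnorm_distC; exact: o_bound Uy (xsU i).
have [] := @ss_dom2 _ _ _ _ _ _ YS (syn l) G1 G2 (syn_meas lC) YG1 YG2.
  apply: filterS2 k1 k2 => x h1 h2; apply: csum_le; apply: le_trans (b x) _.
  by rewrite EFinD leeD.
move=> Ys ns; split; first exact: (Zv_Z (syn_Zv lC) Ys).
by apply: le_trans ns _; rewrite mulrDl lerD.
Qed.

(** * A measurable partition subordinate to the covering *)

Lemma first_ex y : exists i, U i y /\ forall j, U j y -> (choice.pickle i <= choice.pickle j)%N.
Proof.
have exP : exists n, `[<exists2 i, U i y & choice.pickle i = n>].
  by have [i Uy] := covU y; exists (choice.pickle i); apply/asboolP; exists i.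
case: (ex_minnP exP) => n /asboolP[i Uy <-] h; exists i; split => // j Uj.
by apply: h; apply/asboolP; exists j.
Qed.

(** The first member containing [y] in the enumeration of [I]. Its level sets are the cells; some
    may be empty, in which case [cmass] is 0. *)
Definition fidx (y : T) : I := projT1 (cid (first_ex y)).

Lemma fidxU y : U (fidx y) y.
Proof. by rewrite /fidx; case: (cid _) => i [/=]. Qed.

Definition cell (i : I) : set T := [set y | fidx y = i].

Lemma cellE i : cell i = U i `\` \big[setU/set0]_(j <- upto I (choice.pickle i)) U j.
Proof.
rewrite /cell -bigcup_fset; apply/seteqP; split => y /=.
  move=> <-; split; first exact: fidxU.
  move=> [j /= ]; rewrite in_upto => ji Uj.
  move: ji; rewrite /fidx; case: (cid _) => i' [/= _ /(_ j Uj)] h.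
  by rewrite ltnNge h.
move=> [Uy nU]; rewrite /fidx; case: (cid _) => j [/= Uj h].
apply: (pcan_inj (@pickleK_inv I)); apply/eqP; rewrite eqn_leq h //= leqNgt; apply/negP => ij.
by apply: nU; exists j => //=; rewrite in_upto.
Qed.

Lemma cell_meas i : measurable (cell i).
Proof. by rewrite cellE; apply: measurableD => //; exact: bigsetU_measurable. Qed.

Lemma cellU i : cell i `<=` U i.
Proof. by rewrite cellE; exact: subDsetl. Qed.

Definition cmass (i : I) : R := fine (mu (cell i)).

Lemma cmassE i : mu (cell i) = (cmass i)%:E.
Proof.
rewrite /cmass fineK // ge0_fin_numE //; apply: le_lt_trans (ltry (mass i)).
rewrite -massE; apply: le_measure; rewrite ?inE //; [exact: cell_meas|exact: cellU].
Qed.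

Lemma cmass_ge0 i : 0 <= cmass i.
Proof. exact: fine_ge0. Qed.

Lemma cmass_le i : cmass i <= mass i.
Proof.
rewrite -lee_fin -cmassE -massE.
by apply: le_measure; rewrite ?inE //; [exact: cell_meas|exact: cellU].
Qed.

Let cell_term (b : I -> R[i]) i y := (\1_(cell i) y)%:C * b i.

Lemma lsum_fidx (V : zmodType) (h : I -> T -> V) : (forall i y, fidx y <> i -> h i y = 0) ->
  supported U h /\ forall y, lsum h y = h (fidx y) y.
Proof.
move=> hz; have hs : supported U h.
  by move=> i y nU; apply: hz => e; apply: nU; rewrite -e; exact: fidxU.
split => // y; rewrite (lsum_cover finU) //.
rewrite (big_fsetD1 (fidx y)) /=; last by apply: in_cover_fset => //; exact: fidxU.
rewrite big1_fset ?addr0 // => i.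
by rewrite !inE => /andP[/eqP iy _] _; rewrite hz // => e; apply: iy.
Qed.

Let ind_cell i y : fidx y <> i -> \1_(cell i) y = 0 :> R.
Proof. by move=> h; rewrite indicE memNset. Qed.

Let ind_fidx y : \1_(cell (fidx y)) y = 1 :> R.
Proof. by rewrite indicE mem_set. Qed.

Let supp_cell b : supported U (cell_term b).
Proof.
by apply: (lsum_fidx _).1 => i y h; rewrite /cell_term ind_cell ?mul0r.
Qed.

Lemma fidx_lsum (b : I -> R[i]) y : lsum (cell_term b) y = b (fidx y).
Proof.
rewrite (lsum_fidx _).2 /cell_term ?ind_fidx ?mul1r // => i w h.
by rewrite ind_cell ?mul0r.
Qed.

Let cell_term_norm b i y : rnorm (cell_term b i y) = rnorm (b i) * \1_(cell i) y.
Proof. by rewrite /cell_term rnormM rnormC ger0_norm 1?mulrC // indicE ler0n. Qed.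

Let cell_term_meas b i : cmeasurable (cell_term b i).
Proof.
apply: cmeasM; last exact: cmeas_cst.
by apply: cmeas_real; apply: measurable_indic; exact: cell_meas.
Qed.

Lemma fidx_meas (b : I -> R[i]) : cmeasurable (fun y => b (fidx y)).
Proof.
rewrite (_ : (fun _ => _) = lsum (cell_term b)); last by apply/funext => y; rewrite fidx_lsum.
exact: (lsum_cmeas finU).
Qed.

Lemma int_cell i c : 0 <= c -> (\int[mu]_t (c * \1_(cell i) t)%:E = (c * cmass i)%:E)%E.
Proof.
move=> c_ge0; rewrite nnintZ //; last by apply: measurable_indic; exact: cell_meas.
rewrite integral_indic //; last exact: cell_meas.
by rewrite setIT EFinM; congr (_ * _)%E; exact: cmassE.
Qed.

Let lsum_cell_norm b y : lsum (fun i y => rnorm (cell_term b i y)) y = rnorm (b (fidx y)).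
Proof.
rewrite (lsum_fidx _).2 /cell_term ?ind_fidx ?mul1r // => i w h.
by rewrite ind_cell ?mul0r ?rnorm0.
Qed.

Let supp_cell_norm b : supported U (fun i y => rnorm (cell_term b i y)).
Proof. by move=> i y nU; rewrite supp_cell // rnorm0. Qed.

(** The sums over [upto] are eventually constant at each point and their integrals are finite sums
    bounded by [c]; Fatou's lemma concludes. *)
Lemma fidx_int (b : I -> R[i]) c : (\int[mu]_y (natF (fun i => (cmass i)%:C * b i) y)%:E <= c%:E)%E ->
  (\int[mu]_y (rnorm (b (fidx y)))%:E <= c%:E)%E.
Proof.
move=> h.
have -> : (fun y => (rnorm (b (fidx y)))%:E) =
    (fun y => limn_einf (fun n => (\sum_(i <- upto I n) rnorm (cell_term b i y))%:E)).
  apply/funext => y; apply/esym.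
  have H : (\sum_(i <- upto I n) rnorm (cell_term b i y))%:E @[n --> \oo] --> (rnorm (b (fidx y)))%:E.
    apply: cvg_near_cst; apply: filterS (lsum_near finU y (@supp_cell_norm b)) => n ->.
    by rewrite lsum_cell_norm.
  by rewrite (cvg_limn_einf_sup H).1.
apply: le_trans (fatou mu measurableT _ _) _.
- move=> n; apply/measurable_EFinP; apply: measurable_sum => i.
  exact: cmeas_rnorm.
- by move=> n y _; rewrite lee_fin sumr_ge0 // => i _; exact: rnorm_ge0.
apply: limn_einf_le; apply: nearW => n.
have -> : (\int[mu]_y (\sum_(i <- upto I n) rnorm (cell_term b i y))%:E =
    (\sum_(i <- upto I n) rnorm ((cmass i)%:C * b i))%:E)%E.
  under eq_integral => y _ do rewrite -sumEFin.
  rewrite ge0_integral_sum //; last 2 first.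
  - by move=> i; apply/measurable_EFinP; exact: cmeas_rnorm.
  - by move=> i y _; rewrite lee_fin rnorm_ge0.
  rewrite -sumEFin; apply: eq_bigr => i _.
  under eq_integral => y _ do rewrite cell_term_norm.
  by rewrite int_cell ?rnorm_ge0 // rnormM rnormC ger0_norm ?cmass_ge0 // mulrC.
by rewrite lee_fin; exact: (sum_le (t := fun i => (cmass i)%:C * b i)).
Qed.

(** The function [b (fidx y)] is the step function with value [b i] on cell [i]. Through this
    identity a discretized sum becomes an integral comparable with the reproducing formula. *)
Lemma fidx_csum (b : I -> R[i]) : acv (fun i => (cmass i)%:C * b i) ->
  cintegrable mu (fun y => b (fidx y)) /\
  csum (fun i => (cmass i)%:C * b i) = cintegral mu (fun y => b (fidx y)).
Proof.
move=> A.
have Af : (\int[mu]_y (natF (fun i => (cmass i)%:C * b i) y)%:E)%E \is a fin_num.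
  by rewrite ge0_fin_numE //; apply: integral_ge0 => y _; rewrite lee_fin natF_ge0.
have h : (\int[mu]_y (rnorm (b (fidx y)))%:E < +oo)%E.
  have := @fidx_int b (fine (\int[mu]_y (natF (fun i => (cmass i)%:C * b i) y)%:E)%E).
  by rewrite fineK // => /(_ (lexx _)) /le_lt_trans; apply.
have ic i : cintegrable mu (fun y => (\1_(cell i) y)%:C : R[i]).
  apply/cintegrableP; split.
    by apply: cmeas_real; apply: measurable_indic; exact: cell_meas.
  rewrite (eq_integral (fun y => (1 * \1_(cell i) y)%:E)) ?int_cell ?ltry // => y _.
  by rewrite rnormC ger0_norm ?mul1r // indicE ler0n.
have [] := @cint_lsum _ _ _ _ mu U finU (cell_term b) (@supp_cell b) (cell_term_meas b).
  by under eq_integral => y _ do rewrite lsum_cell_norm.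
rewrite (_ : lsum (cell_term b) = (fun y => b (fidx y))); last first.
  by apply/funext => y; rewrite fidx_lsum.
move=> il _ lim; split => //.
have E : (fun i => cintegral mu (cell_term b i)) = (fun i => (cmass i)%:C * b i).
  apply/funext => i; rewrite mulrC.
  rewrite (_ : cell_term b i = (fun y => b i * (\1_(cell i) y)%:C)); last first.
    by apply/funext => y; rewrite mulrC.
  rewrite cintegralZ // cintegral_real /Rintegral.
  by rewrite (eq_integral (fun y => (1 * \1_(cell i) y)%:E)) ?int_cell ?mul1r // => y _; rewrite mul1r.
rewrite E in lim; exact: (cvg_partial_unique (csum_cvg A) lim).
Qed.

(** * The discretized frame operator *)

Definition samp (F : T -> R[i]) (i : I) : R[i] := (cmass i)%:C * F (xs i).

(* The discretized frame operator [\sum_i mu(cell i) F(x_i) K(., x_i)]. *)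
Definition Uop (F : T -> R[i]) : T -> R[i] := syn (samp F).

Lemma samp_bounded F C : 0 <= C -> (forall x, rnorm (F x) <= C * v x) -> bounded_coef (samp F) C.
Proof.
move=> C_ge0 FC; split => // i; rewrite /samp rnormM rnormC ger0_norm ?cmass_ge0 //.
rewrite -mulrA [mass i * _]mulrC mulrA mulrC.
by apply: ler_pM; rewrite ?rnorm_ge0 ?cmass_ge0 ?cmass_le.
Qed.

Lemma samp_bc Y nY F : core_space Y nY -> Z Y F -> exists C, bounded_coef (samp F) C.
Proof.
move=> YC ZF; have [_ [C C_ge0 FC] _] := Z_Zv YC ZF.
by exists C; exact: samp_bounded.
Qed.

Lemma samp_Yn Y nY F : core_space Y nY -> Z Y F ->
  Yn Y (samp F) /\ nYn nY (samp F) <= nYf nY (F \o xs).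
Proof.
move=> YC ZF; apply: (nat_le_flat YC) => [|i]; first exact: (Z_sample YC ZF).1.
by rewrite /samp rnormM rnormC ger0_norm ?cmass_ge0 // ler_wpM2r ?rnorm_ge0 ?cmass_le.
Qed.

Lemma Uop_Z Y nY F : core_space Y nY -> Z Y F -> Z Y (Uop F).
Proof. by move=> YC ZF; exact: (syn_Y YC (samp_Yn YC ZF).1).1. Qed.

Lemma samp_linear a F G : samp (a *: F + G) = (fun i => a * samp F i + samp G i).
Proof.
apply/funext => i; rewrite /samp [(a *: F + G) _]/(a * F (xs i) + G (xs i)) mulrDr.
by rewrite mulrCA.
Qed.

Lemma Uop_linear Y nY a F G : core_space Y nY -> Z Y F -> Z Y G ->
  Uop (a *: F + G) = a *: Uop F + Uop G.
Proof.
move=> YC ZF ZG; have [C h] := samp_bc YC ZF; have [C' h'] := samp_bc YC ZG.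
by rewrite /Uop samp_linear (syn_linear a h h').
Qed.

(** The summand [nR] comes from replacing [F] by its samples, the summand [nR + dl] from replacing
    [K(x,y)] by [K(x,x_i)]. *)
Definition theta : R := dl * (nR + (nR + dl)).

Lemma theta_ge0 : 0 <= theta.
Proof. by rewrite mulr_ge0 ?addr_ge0. Qed.

(** By [fidx_csum] both [F x] and [Uop F x] are integrals over [T], so their difference is a single
    integral; it is split by adding and subtracting [K(x,y) F(x_i)]. *)
Lemma Uop_close Y nY F : core_space Y nY -> Z Y F -> nY (F - Uop F) <= theta * nY F.
Proof.
move=> YC ZF; have YS := cs_solid YC; have [YF rF] := ZF; have mF := ss_meas YS YF.
have [A [A0 mA YA nA hA]] := Z_osc_major YC ZF.
have [G1 [G10 mG1 YG1 nG1 k1]] := ss_kernel_meas YS (cs_K YC) YF.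
have [G2 [G20 mG2 YG2 nG2 k2]] := ss_kernel_meas YS (cs_oT YC) YF.
pose B y := rnorm (F (xs (fidx y))).
have cB : cmeasurable (fun y => F (xs (fidx y))) by exact: (fidx_meas (F \o xs)).
have mB : measurable_fun [set: T] B by exact: cmeas_rnorm.
have B0 y : 0 <= B y by exact: rnorm_ge0.
have mKx x : measurable_fun [set: T] (fun y => rnorm (K x y)) by exact: cmeas_rnorm.
have mrF := cmeas_rnorm mF.
(* The sampled function is bounded through the reproducing formula at the sampling point, with [K]
   moved back to [y] at the cost of the oscillation; its norm is thus at most [(nR + dl) * nY F],
   whatever the overlap. *)
have BG : {ae mu, forall y, rnorm ((B y)%:C) <= G1 y + G2 y}.
  apply: filterS2 k1 k2 => y h1 h2; rewrite rnormC ger0_norm //.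
  have [i1 e1] := rF (xs (fidx y)).
  rewrite -lee_fin EFinD; apply: le_trans (leeD h1 h2).
  rewrite /B e1; apply: le_trans (rnorm_cintegral i1) _.
  rewrite -nnintD; last 4 first.
  - exact: measurable_funM.
  - by move=> t; rewrite mulr_ge0 ?rnorm_ge0.
  - exact: measurable_funM.
  - by move=> t; rewrite mulr_ge0 ?rnorm_ge0.
  apply: nnint_le.
  - exact: cmeas_rnorm (cint_meas i1).
  - by apply: measurable_funD; apply: measurable_funM.
  - by move=> t; exact: rnorm_ge0.
  apply: aeW => t; rewrite -mulrDl rnormM mulrC ler_wpM2r ?rnorm_ge0 //.
  rewrite (K_herm _ t) rnorm_conj (K_herm y) rnorm_conj.
  rewrite (le_trans (rnorm_le_dist _ (K t y))) // lerD2l rnorm_distC.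
  exact: o_bound (fidxU y) (xsU _).
have [YB nB] := ss_dom2 YS (cmeas_real mB) YG1 YG2 BG.
have [G3 [G30 mG3 YG3 nG3 k3]] := ss_kernel_meas YS (cs_K YC) YA.
have [G4 [G40 mG4 YG4 nG4 k4]] := ss_kernel_meas YS (cs_o YC) YB.
have [C lC] := samp_bc YC ZF.
have [C2 C20 hs] := syn_term.
have mD : cmeasurable (F - Uop F) by apply: cmeasB; [exact: mF|exact: syn_meas lC].
have [] := @ss_dom2 _ _ _ _ _ _ YS (F - Uop F) G3 G4 mD YG3 YG4.
  apply: filterS2 k3 k4 => x h3 h4.
  have acvx : acv (fun i => (cmass i)%:C * (F (xs i) * K x (xs i))).
    have := acv_le (hs _ C lC x); congr acv; apply/funext => i.
    by rewrite /samp mulrA.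
  have [iU eU] := fidx_csum acvx; have [iF eF] := rF x.
  have -> : (F - Uop F) x = cintegral mu (fun y => F y * K x y - F (xs (fidx y)) * K x (xs (fidx y))).
    rewrite cintegralB // -eF -eU [LHS]/(F x - Uop F x); congr (_ - _).
    by rewrite /Uop /syn; congr csum; apply/funext => i; rewrite /samp mulrA.
  have iB := cintB iF iU; rewrite -lee_fin; apply: le_trans (rnorm_cintegral iB) _.
  rewrite EFinD; apply: le_trans (leeD h3 h4).
  under [X in (_ <= X + _)%E]eq_integral => y _ do rewrite rnormC ger0_norm //.
  under [X in (_ <= _ + X)%E]eq_integral => y _ do rewrite rnormC ger0_norm //.
  rewrite -nnintD; last 4 first.
  - exact: measurable_funM.
  - by move=> y; rewrite mulr_ge0 ?rnorm_ge0.
  - exact: measurable_funM.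
  - by move=> y; rewrite mulr_ge0.
  apply: nnint_le.
  - exact: cmeas_rnorm (cint_meas iB).
  - by apply: measurable_funD; apply: measurable_funM.
  - by move=> y; exact: rnorm_ge0.
  apply: filterS hA => y hy.
  have -> : F y * K x y - F (xs (fidx y)) * K x (xs (fidx y)) =
      K x y * (F y - F (xs (fidx y))) + (K x y - K x (xs (fidx y))) * F (xs (fidx y)) by ring.
  apply: le_trans (rnormD _ _) _; rewrite !rnormM; apply: lerD.
    by rewrite ler_wpM2l ?rnorm_ge0 //; exact: hy (fidxU y) (xsU _).
  by rewrite -/(B y) ler_wpM2r //; exact: o_bound (fidxU y) (xsU _).
move=> _ h; apply: le_trans h _.
have nF0 := ss_ge0 YS YF.
have nB' : nY (fun y => (B y)%:C) <= (nR + dl) * nY F.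
  by apply: le_trans nB _; rewrite mulrDl lerD.
rewrite /theta mulrDr mulrDl; apply: lerD.
  by apply: le_trans nG3 _; rewrite (mulrC dl) -mulrA ler_wpM2l.
by apply: le_trans nG4 _; rewrite -[leRHS]mulrA ler_wpM2l.
Qed.

Hypothesis theta1 : theta < 1.

Lemma Uop_onto Y nY F : core_space Y nY -> Z Y F ->
  exists G, [/\ Z Y G, Uop G = F & nY G <= (1 - theta)^-1 * nY F].
Proof.
move=> YC ZF; have [ZB Zd] := Z_banach YC.
apply: (near_id_onto ZB Zd) => //.
- by move=> G; exact: (Uop_Z YC).
- by move=> a G H; exact: (Uop_linear _ YC).
- exact: theta_ge0.
- by move=> G; exact: (Uop_close YC).
Qed.

Lemma Uop_lower Y nY F : core_space Y nY -> Z Y F -> nY F <= (1 - theta)^-1 * nY (Uop F).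
Proof.
move=> YC ZF; have [ZB Zd] := Z_banach YC.
rewrite mulrC ler_pdivlMr ?subr_gt0 // mulrC.
apply: (near_id_lower ZB) => //.
- by move=> G; exact: (Uop_Z YC).
- by move=> G; exact: (Uop_close YC).
Qed.

(** * Tails, functionals on [Z L1v], and duality *)

Definition offc (J : {fset I}) (l : I -> R[i]) (i : I) : R[i] := if i \in J then 0 else l i.

Definition onc (J : {fset I}) (l : I -> R[i]) (i : I) : R[i] := if i \in J then l i else 0.

Lemma onc_bounded J l C : bounded_coef l C -> bounded_coef (onc J l) C.
Proof.
move=> [C_ge0 lC]; split => // i; rewrite /onc; case: ifP => // _.
by rewrite rnorm0 !mulr_ge0.
Qed.

Lemma offc_bounded J l C : bounded_coef l C -> bounded_coef (offc J l) C.
Proof.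
move=> [C_ge0 lC]; split => // i; rewrite /offc; case: ifP => // _.
by rewrite rnorm0 !mulr_ge0.
Qed.

Lemma syn_onc J l : syn (onc J l) = \sum_(i <- J) l i *: col (xs i).
Proof.
rewrite (@syn_fin _ J) => [|i /negbTE]; last by rewrite /onc => ->.
by apply: eq_big_seq => i iJ; rewrite /onc iJ.
Qed.

Lemma syn_split J l C : bounded_coef l C -> syn l = syn (onc J l) + syn (offc J l).
Proof.
move=> lC; rewrite -[syn (onc J l)]scale1r.
rewrite -(syn_linear 1 (onc_bounded J lC) (offc_bounded J lC)); congr syn.
by apply/funext => i; rewrite /onc /offc mul1r; case: ifP; rewrite ?addr0 ?add0r.
Qed.

Lemma offc_le Y nY J l : core_space Y nY -> Yn Y l ->
  Yn Y (offc J l) /\ nYn nY (offc J l) <= nYn nY l.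
Proof.
move=> YC Yl; apply: (ss_dom (cs_solid YC) _ Yl); first by apply: cmeas_real; exact: natF_meas.
apply: aeW => y; rewrite rnormC ger0_norm ?natF_ge0 //.
apply: (ler_lsum finU); [exact: supp_ind|exact: supp_ind|move=> i _].
rewrite ler_wpM2r // ler_wpM2r ?invr_ge0 // /offc; case: ifP => // _.
by rewrite rnorm0 rnorm_ge0.
Qed.

(** With the weight [v] absorbed into each term, the norm is the integral of a nonnegative locally
    finite sum, so its tails are small by [tail_small]. *)
Lemma L1v_tail l : Yn L1v l -> forall e, 0 < e ->
  exists J0, forall J, (J0 `<=` J)%fset -> nYn nL1v (offc J l) < e.
Proof.
move=> Ll e e0.
pose h i y := rnorm (l i) * (mass i)^-1 * \1_(U i) y * v y.
have hs : supported U h by move=> i y nU; rewrite /h indF ?mulr0 ?mul0r.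
have nE l' y : rnorm ((natF l' y)%:C) * v y =
    lsum (fun i y => rnorm (l' i) * (mass i)^-1 * \1_(U i) y * v y) y.
  rewrite rnormC ger0_norm ?natF_ge0 // /natF !(lsum_cover finU) ?mulr_suml //.
    by move=> i w nU; rewrite indF ?mulr0 ?mul0r.
  exact: supp_ind.
have [] := @tail_small _ _ _ _ mu U finU h hs _ _ _ e e0.
- by move=> i; apply: measurable_funM => //; exact: measurable_funM.
- by move=> i y; rewrite mulr_ge0.
- by case: Ll => _; rewrite /wL1_norm; under eq_integral => y _ do rewrite nE.
move=> J0 hJ; exists J0 => J JJ; rewrite -lte_fin -wL1nE //; last first.
  exact: (offc_le J L1S Ll).1.
under eq_integral => y _ do rewrite nE.
apply: le_lt_trans (hJ J JJ); rewrite le_eqVlt; apply/orP; left; apply/eqP.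
apply: eq_integral => y _; congr (_%:E); apply: eq_fsbigr => i _.
by rewrite /off /offc /h; case: ifP; rewrite // rnorm0 !mul0r.
Qed.

Definition antilinear_on_L1v (f : (T -> R[i]) -> R[i]) : Prop :=
  (forall a F G, Z L1v F -> Z L1v G -> f (a *: F + G) = conjC a * f F + f G) /\
  exists c : R, forall F, Z L1v F -> rnorm (f F) <= c * nL1v F.

(** In [Z L1v] the synthesis converges in norm, so a bounded functional may be applied term by
    term. *)
Lemma antilinear_syn f l : antilinear_on_L1v f -> Yn L1v l ->
  (fun J => rnorm (partial_sum (fun i => conjC (l i) * f (col (xs i))) J - f (syn l)))
    @ totally --> (0 : R).
Proof.
move=> [fL [c fc]] Ll; have [C lC] := Yn_bounded L1S Ll.
have Z0 : Z L1v 0 by exact: (csn_zero (Z_banach L1S).1).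
have f0 : f 0 = 0.
  have := fL 1 0 0 Z0 Z0; rewrite scaler0 addr0 rmorph1 mul1r => /eqP.
  by rewrite addrC -subr_eq subrr eq_sym => /eqP.
have fsum J : f (\sum_(i <- J) l i *: col (xs i)) = \sum_(i <- J) conjC (l i) * f (col (xs i)).
  suff [] : Z L1v (\sum_(i <- J) l i *: col (xs i)) /\
     f (\sum_(i <- J) l i *: col (xs i)) = \sum_(i <- J) conjC (l i) * f (col (xs i)) by [].
  elim: J => [|i s [ZS ih]]; first by rewrite !big_nil.
  rewrite !big_cons (fL _ _ _ (Z_col _).1 ZS) ih.
  by split; [exact: (Z_linear L1S _ (Z_col _).1 ZS)|].
have c0 : 0 <= `|c| * (nR + dl) + 1 by rewrite addr_ge0 // mulr_ge0 ?addr_ge0.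
apply: cvg_totally0 => [J|e e0]; first exact: rnorm_ge0.
have cc : 0 < `|c| * (nR + dl) + 1 by rewrite ltr_wpDl // mulr_ge0 ?addr_ge0.
have [|J0 hJ] := @L1v_tail l Ll (e / (`|c| * (nR + dl) + 1)); first by rewrite divr_gt0.
exists J0 => J JJ; rewrite partial_sumE -fsum -syn_onc rnorm_distC.
have [Lo no] := offc_le J L1S Ll; have [Zo nso] := syn_Y L1S Lo.
have Lon : Yn L1v (onc J l).
  by apply: (Yn_fin L1S (J := J)) => i /negbTE; rewrite /onc => ->.
have [Zn _] := syn_Y L1S Lon.
have -> : f (syn l) - f (syn (onc J l)) = f (syn (offc J l)).
  rewrite (syn_split J lC) -[syn (onc J l) in LHS]scale1r fL // rmorph1 mul1r.
  by rewrite scale1r addrAC subrr add0r.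
apply: le_lt_trans (fc _ Zo) _.
have := hJ J JJ; rewrite ltr_pdivlMr //; apply: le_lt_trans.
have n0 : 0 <= nYn nL1v (offc J l) by exact: wL1n_ge0.
have s0 : 0 <= nL1v (syn (offc J l)) by exact: wL1n_ge0.
apply: (@le_trans _ _ (`|c| * ((nR + dl) * nYn nL1v (offc J l)))).
  apply: (@le_trans _ _ (`|c| * nL1v (syn (offc J l)))); first by rewrite ler_wpM2r // ler_norm.
  by rewrite ler_wpM2l.
by rewrite [leRHS]mulrDr mulr1 mulrA mulrC lerDl.
Qed.

(** Pairing identifies a function of [Zv] with a functional on [Z L1v], and testing on the atoms
    recovers the function. *)
Lemma Zv_functional A : Zv A ->
  antilinear_on_L1v (fun G => cintegral mu (fun y => A y * conjC (G y))) /\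
  forall x, cintegral mu (fun y => A y * conjC (col x y)) = A x.
Proof.
move=> [mA [C C_ge0 AC] rA]; split; last first.
  move=> x; rewrite [RHS]rA; congr cintegral; apply/funext => y.
  by rewrite /col -K_herm.
split; last by exists C => F [LF _]; case: (Zv_pair mA C_ge0 AC LF).
move=> a F G [LF _] [LG _].
have [i1 _] := Zv_pair mA C_ge0 AC LF; have [i2 _] := Zv_pair mA C_ge0 AC LG.
rewrite -cintegralZ // -cintegralD //; last exact: cintZ.
congr cintegral; apply/funext => y.
rewrite [(a *: F + G) y]/(a * F y + G y) rmorphD rmorphM /=; ring.
Qed.

(** Both sides are the sum of [cmass i * A (xs i) * conjC (G (xs i))]: on the left the functional of
    [A] is applied termwise to [Uop G], on the right the synthesis [Uop A] is paired with [G]. *)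
Lemma Uop_adj A G : Zv A -> Z L1v G ->
  cintegral mu (fun y => A y * conjC (Uop G y)) = cintegral mu (fun y => Uop A y * conjC (G y)).
Proof.
move=> ZA ZG; have [fA colA] := Zv_functional ZA.
have [mA [C C_ge0 AC] rA] := ZA.
have lim := antilinear_syn fA (samp_Yn L1S ZG).1.
have [_ acvA ->] := syn_pair (samp_bounded C_ge0 AC) ZG.
have lim' := csum_cvg acvA.
apply: (cvg_partial_unique lim).
rewrite (_ : (fun i => conjC (samp G i) * _) = (fun i => samp A i * conjC (G (xs i)))) //.
apply/funext => i; rewrite colA /samp rmorphM /=.
rewrite (_ : conjC (cmass i)%:C = (cmass i)%:C); last exact: conjc_real.
by rewrite mulrAC.
Qed.

(** The value [A x] is the pairing of [A] with [col x]. Since [col x] is some [Uop G] with [G] in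
    [Z L1v], self-adjointness moves [Uop] onto [A]. *)
Lemma Uop_inj A : Zv A -> Uop A = 0 -> A = 0.
Proof.
move=> ZA UA; have [_ colA] := Zv_functional ZA.
apply/funext => x; rewrite -colA.
have [G [ZG <- _]] := Uop_onto L1S (Z_col x).1.
rewrite (Uop_adj ZA ZG) UA.
rewrite (_ : (fun y => _) = (fun=> 0)) ?cintegral0 //.
by apply/funext => y; rewrite mul0r.
Qed.

Lemma Zv_sub A B : Zv A -> Zv B -> Zv (A - B) /\ Uop (A - B) = Uop A - Uop B.
Proof.
move=> [mA [C C_ge0 AC] rA] [mB [C' C'_ge0 BC] rB].
have iA x : cintegrable mu (fun y => A y * K x y).
  have [] := Zv_pair mA C_ge0 AC (Z_col x).1.1.
  by under eq_fun do rewrite /col -K_herm.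
have iB x : cintegrable mu (fun y => B y * K x y).
  have [] := Zv_pair mB C'_ge0 BC (Z_col x).1.1.
  by under eq_fun do rewrite /col -K_herm.
split.
  split; first exact: cmeasB.
  - exists (C + C') => [|x]; first exact: addr_ge0.
    by rewrite (le_trans (rnormB _ _)) // mulrDl lerD.
  - move=> x; transitivity (cintegral mu (fun y => A y * K x y) - cintegral mu (fun y => B y * K x y)).
      by rewrite -rA -rB.
    rewrite -cintegralB //.
    by congr cintegral; apply/funext => y; rewrite -mulrBl.
have E : A - B = (-1) *: B + A by rewrite scaleN1r addrC.
rewrite /Uop E samp_linear (syn_linear (-1) (samp_bounded C'_ge0 BC) (samp_bounded C_ge0 AC)).
by rewrite scaleN1r addrC.
Qed.

(** * Weighted solid sequence spaces *)

Section SequenceSpace.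
Variables (Y : set (T -> R[i])) (nY : (T -> R[i]) -> R) (w : I -> R).
Hypothesis YC : core_space Y nY.
Hypothesis w0 : forall i, 0 < w i.
Let YS := cs_solid YC.

Let wge0 i : 0 <= w i. Proof. exact: ltW. Qed.

(** The weight [w = 1] gives the flat space and [w i = (mass i)^-1] the natural one, so both are
    handled together. *)
Definition seqF (l : I -> R[i]) : T -> R := lsum (fun i y => rnorm (l i) * w i * \1_(U i) y).

Let B : set (I -> R[i]) := [set l | Y (fun y => (seqF l y)%:C)].
Let n (l : I -> R[i]) : R := nY (fun y => (seqF l y)%:C).

Let term0 (l : I -> R[i]) i y : 0 <= rnorm (l i) * w i * \1_(U i) y.
Proof. by rewrite !mulr_ge0 ?rnorm_ge0. Qed.

Let seqF_ge0 l y : 0 <= seqF l y.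
Proof. by apply: lsum_ge0 => //; exact: supp_ind. Qed.

Let seqF_meas l : cmeasurable (fun y => (seqF l y)%:C).
Proof.
by apply: cmeas_real; apply: lsum_meas => //; [exact: supp_ind|move=> i; exact: measurable_funM].
Qed.

Let seqF_tri (l l1 l2 : I -> R[i]) y : (forall i, rnorm (l i) <= rnorm (l1 i) + rnorm (l2 i)) ->
  seqF l y <= seqF l1 y + seqF l2 y.
Proof.
move=> h; rewrite /seqF -(lsumD finU); [|exact: supp_ind|exact: supp_ind].
apply: (ler_lsum finU); first exact: supp_ind.
  by move=> i t nU; rewrite indF ?mulr0 ?addr0.
by move=> i _; rewrite -!mulrDl ler_wpM2r // ler_wpM2r.
Qed.

Let B_tri (l l1 l2 : I -> R[i]) : B l1 -> B l2 ->
  (forall i, rnorm (l i) <= rnorm (l1 i) + rnorm (l2 i)) -> B l /\ n l <= n l1 + n l2.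
Proof.
move=> B1 B2 h; apply: (ss_dom2 YS) => //.
by apply: aeW => y; rewrite rnormC ger0_norm // seqF_tri.
Qed.

Lemma seq_dom (l l1 : I -> R[i]) : B l1 -> (forall i, rnorm (l i) <= rnorm (l1 i)) ->
  B l /\ n l <= n l1.
Proof.
move=> B1 h; apply: (ss_dom YS) => //; apply: aeW => y; rewrite rnormC ger0_norm //.
apply: (ler_lsum finU); [exact: supp_ind|exact: supp_ind|move=> i _].
by rewrite ler_wpM2r // ler_wpM2r.
Qed.

Let B_scale a l : B l -> B (a *: l) /\ n (a *: l) = rnorm a * n l.
Proof.
move=> Bl.
have E : (fun y => (seqF (a *: l) y)%:C) = (rnorm a)%:C *: (fun y => (seqF l y)%:C).
  apply/funext => y; rewrite [RHS](_ : _ = (rnorm a)%:C * (seqF l y)%:C) //.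
  rewrite -rmorphM /seqF -(lsumZl finU) ?(supp_ind (fun i => _)) //; last exact: supp_ind.
  congr (_%:C); apply: eq_fsbigr => i _.
  by rewrite [(a *: l) i]/(a * l i) rnormM !mulrA.
rewrite /B /n /= E; split; first exact: (ssZ YS).
by rewrite (ss_scale YS) // rnormC ger0_norm ?rnorm_ge0.
Qed.

Let coef_bound : exists C : I -> R, (forall i, 0 <= C i) /\
  forall l i, B l -> rnorm (l i) <= C i * n l.
Proof.
have [C C_ge0 hC] := avg_real YC; exists (fun i => (w i)^-1 * C * v (xs i)); split.
  by move=> i; rewrite !mulr_ge0 // invr_ge0.
move=> l i Bl.
have := hC _ i (xs i) (seqF_ge0 l) Bl (xsU i).
have : ((rnorm (l i) * w i * mass i)%:E <= \int[mu]_t (seqF l t * \1_(U i) t)%:E)%E.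
  rewrite -int_ind ?mulr_ge0 ?rnorm_ge0 //; apply: nnint_le.
  - exact: measurable_funM.
  - by apply: measurable_funM => //; exact: (seqF_meas l).1.
  - by move=> t; exact: term0.
  apply: aeW => t; have [Ut|nUt] := pselect (U i t); last by rewrite indF // !mulr0.
  by rewrite -[leLHS]mulr1 -(indT Ut) ler_wpM2r //; apply: (lsum_ge1 finU i (supp_ind _)).
move=> /le_trans h /h; rewrite lee_fin [leRHS]mulrAC ler_pM2r // => h'.
rewrite [leRHS](_ : _ = C * n l * v (xs i) / w i); last by ring.
by rewrite ler_pdivlMr.
Qed.

Lemma seq_banach : banach_space B n.
Proof.
have [C [C_ge0 hC]] := coef_bound.
have BB l1 l2 : B l1 -> B l2 -> B (l1 - l2) /\ n (l1 - l2) <= n l1 + n l2.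
  by move=> B1 B2; apply: B_tri => // i; exact: rnormB.
split; last first.
  move=> l Bl n0; apply/funext => i; apply/rnorm0_eq0/eqP; rewrite eq_le rnorm_ge0 andbT.
  by rewrite (le_trans (hC l i Bl)) // n0 mulr0.
split.
- rewrite /B /=; have -> : (fun y => (seqF 0 y)%:C) = 0.
    apply/funext => y; rewrite /seqF (lsum_cover finU) ?big1 //; last exact: supp_ind.
    by move=> i _; rewrite rnorm0 !mul0r.
  exact: (ss_zero YS).
- move=> a l l' Bl Bl'; apply: (B_tri (B_scale a Bl).1 Bl' _).1 => i; exact: rnormD.
- by move=> l Bl; exact: (ss_ge0 YS).
- by move=> a l Bl; case: (B_scale a Bl).
- by move=> l l' Bl Bl'; apply: (B_tri Bl Bl' _).2 => i; exact: rnormD.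
move=> u Bu uC.
have [l ul] : exists l : I -> R[i], forall i, rnorm (u k i - l i) @[k --> \oo] --> (0 : R).
  suff h i : exists a : R[i], rnorm (u k i - a) @[k --> \oo] --> (0 : R).
    by exists (fun i => projT1 (cid (h i))) => i; exact: projT2 (cid (h i)).
  apply: rnorm_cauchy_cvg => e e0.
  have Ci : 0 < C i + 1 by rewrite ltr_wpDl.
  have [|N hN] := uC (e / (C i + 1)); first by rewrite divr_gt0.
  exists N => j k Nj Nk; have Bjk := (BB _ _ (Bu j) (Bu k)).1.
  apply: le_lt_trans (hC _ i Bjk) _; have := hN j k Nj Nk.
  rewrite ltr_pdivlMr //; apply: le_lt_trans.
  by rewrite mulrC ler_wpM2l ?lerDl // (ss_ge0 YS).
(* The coordinatewise limit [l] is placed in the space by [ss_fatou]: the functions of [u j - u k]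
   are Cauchy in [Y] as [j] grows, by the reverse triangle inequality, and converge at every point
   to the function of [l - u k]. *)
have fat k : B (l - u k) /\
    nY ((fun y => (seqF (u j - u k) y)%:C) - (fun y => (seqF (l - u k) y)%:C)) @[j --> \oo] --> (0 : R).
  apply: (ss_fatou YS (u := fun j y => (seqF (u j - u k) y)%:C)).
  - by move=> j; exact: (BB _ _ (Bu j) (Bu k)).1.
  - move=> e /uC[N hN]; exists N => j j' Nj Nj'; apply: le_lt_trans (hN j j' Nj Nj').
    apply: (ss_dom YS (g := seqF (u j - u j')) _ _ _).2.
    + by apply: cmeasB; exact: seqF_meas.
    + exact: (BB _ _ (Bu j) (Bu j')).1.
    apply: aeW => y.
    rewrite [X in rnorm X](_ : _ = (seqF (u j - u k) y - seqF (u j' - u k) y)%:C); last by rewrite rmorphB.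
    rewrite rnormC ler_norml; apply/andP; split.
      rewrite lerNl opprB lerBlDl; apply: seqF_tri => i.
      rewrite [rnorm ((u j - u j') i)]rnorm_distC.
      by rewrite (le_trans (rnorm_distD (u j i) _ _)) // addrC.
    rewrite lerBlDl; apply: seqF_tri => i.
    by rewrite (le_trans (rnorm_distD (u j' i) _ _)) // addrC.
  - move=> y.
    have E a : seqF a y = \sum_(i <- fset_set [set i | U i y]) rnorm (a i) * w i * \1_(U i) y.
      by rewrite /seqF (lsum_cover finU) //; exact: supp_ind.
    apply: (@squeeze_cvgr _ _ _ _ (cst 0) (fun j =>
      \sum_(i <- fset_set [set i | U i y]) rnorm (u j i - l i) * (w i * \1_(U i) y))).
    + apply: nearW => j; rewrite rnorm_ge0 /= -rmorphB rnormC !E -sumrB.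
      apply: le_trans (ler_norm_sum _ _ _) _; apply: ler_sum => i _.
      rewrite -!mulrA -mulrBl normrM [X in _ * X]ger0_norm; last by rewrite mulr_ge0.
      rewrite ler_wpM2r ?mulr_ge0 // (le_trans (rnorm_distdist _ _)) //.
      by rewrite [(u j - u k) i]/(u j i - u k i) [(l - u k) i]/(l i - u k i) opprB addrA subrK.
    + exact: cvg_cst.
    + suff H : \sum_(i <- fset_set [set i | U i y]) rnorm (u j i - l i) * (w i * \1_(U i) y)
          @[j --> \oo] --> \sum_(i <- fset_set [set i | U i y]) (0 : R).
        by rewrite big1_eq in H.
      elim: (enum_fset (fset_set [set i | U i y])) => [|i r ih].
        by rewrite big_nil; under eq_fun do rewrite big_nil; exact: cvg_cst.
      rewrite big_cons; under eq_fun do rewrite big_cons.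
      apply: cvgD => //; rewrite -[X in _ --> X](mul0r (w i * \1_(U i) y)).
      by apply: cvgMr_tmp; exact: ul.
have Bl : B l.
  have -> : l = (l - u 0%N) + u 0%N by rewrite subrK.
  by apply: (B_tri (fat 0%N).1 (Bu 0%N) _).1 => i; exact: rnormD.
exists l => //; apply/cvgrPdist_lt => e e0; have e2 : 0 < e / 2 by rewrite divr_gt0.
have [N hN] := uC _ e2; exists N => // k /= Nk.
rewrite sub0r normrN ger0_norm; last by apply: (ss_ge0 YS); exact: (BB _ _ (Bu k) Bl).1.
have [Bk /cvgrPdist_lt/(_ _ e2)[N' _ hN']] := fat k.
have {}hN' := hN' (maxn N N') (leq_maxr _ _).
set j := maxn N N' in hN'.
have Bjk := (BB _ _ (Bu j) (Bu k)).1.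
rewrite /= sub0r normrN ger0_norm in hN'; last by apply: (ss_ge0 YS); exact: (ssB YS).
have -> : n (u k - l) = n (l - u k).
  congr nY; apply/funext => y; congr (_%:C); apply: eq_fsbigr => i _.
  by congr (_ * _ * _); exact: rnorm_distC.
rewrite (splitr e).
have -> : n (l - u k) = nY ((fun y => (seqF (u j - u k) y)%:C) -
   ((fun y => (seqF (u j - u k) y)%:C) - (fun y => (seqF (l - u k) y)%:C))) by rewrite subKr.
have YD : Y ((fun y => (seqF (u j - u k) y)%:C) - (fun y => (seqF (l - u k) y)%:C)).
  exact: (ssB YS).
rewrite -[X in nY (_ - X)]scale1r -scaleNr.
apply: le_lt_trans (ss_triangle YS Bjk (ssZ YS _ YD)) _.
rewrite (ss_scale YS) // rnormN rnorm1 mul1r ltrD //.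
by apply: hN => //; rewrite leq_maxl.
Qed.

Lemma seq_BK : BK_space B n.
Proof.
split; first exact: seq_banach.
move=> s l Bs Bl sl i; have [C [C_ge0 hC]] := coef_bound.
apply: (@squeeze_cvgr _ _ _ _ (cst 0) (fun k => C i * n (s k - l))).
- apply: nearW => k; rewrite rnorm_ge0 /=; apply: hC.
  by apply: (B_tri (Bs k) Bl _).1 => j; exact: rnormB.
- exact: cvg_cst.
- by rewrite -[X in _ --> X](mulr0 (C i)); exact: cvgMl_tmp.
Qed.

(** Once [J] contains the support of a finite approximant [l'], the tail of [l] off [J] is dominated
    by [|l - l'|]. *)
Lemma seq_dense_tail l : finite_sequences_dense B n -> B l -> forall e, 0 < e ->
  exists J0, forall J, (J0 `<=` J)%fset -> n (offc J l) < e.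
Proof.
move=> dn Bl e e0; have [l' [fl' Bl' nl]] := dn l e Bl e0.
exists (fset_set [set i | l' i != 0]) => J JJ; apply: le_lt_trans nl.
apply: (seq_dom _ _).2; first by apply: (B_tri Bl Bl' _).1 => i; exact: rnormB.
move=> i; rewrite /offc; case: ifPn => iJ; first by rewrite rnorm0 rnorm_ge0.
have : i \notin fset_set [set i | l' i != 0] by apply: contra iJ; exact: (fsubsetP JJ).
rewrite in_fset_set // => /negP h.
have -> : (l - l') i = l i - l' i by [].
suff -> : l' i = 0 by rewrite subr0.
by apply/eqP; apply: contrapT => /negP li; apply: h; rewrite inE.
Qed.
End SequenceSpace.

(** * Expansions in atoms and in the dual family *)

Section CoreFrames.
Variables (Y : set (T -> R[i])) (nY : (T -> R[i]) -> R).
Hypothesis YC : core_space Y nY.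
Let YS := cs_solid YC.

Lemma flatF_seqF : flatF = seqF (fun=> 1).
Proof.
apply/funext => l; apply/funext => y; apply: eq_fsbigr => i _.
by rewrite mulr1.
Qed.

Lemma Yn_BK : BK_space (Yn Y) (nYn nY).
Proof. by apply: (seq_BK (w := fun i => (mass i)^-1) YC) => i; rewrite invr_gt0. Qed.

Lemma Yf_BK : BK_space (Yf Y) (nYf nY).
Proof. by rewrite /Yf /nYf flatF_seqF; apply: (seq_BK YC) => i; exact: ltr01. Qed.

Lemma Yn_tail l : finite_sequences_dense (Yn Y) (nYn nY) -> Yn Y l -> forall e, 0 < e ->
  exists J0, forall J, (J0 `<=` J)%fset -> nYn nY (offc J l) < e.
Proof. by apply: (seq_dense_tail (w := fun i => (mass i)^-1) YC) => i; rewrite invr_gt0. Qed.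

Lemma Yf_tail l : finite_sequences_dense (Yf Y) (nYf nY) -> Yf Y l -> forall e, 0 < e ->
  exists J0, forall J, (J0 `<=` J)%fset -> nYf nY (offc J l) < e.
Proof. by rewrite /Yf /nYf flatF_seqF; apply: (seq_dense_tail YC) => i; exact: ltr01. Qed.

Lemma Yf_offc J l : Yf Y l -> Yf Y (offc J l).
Proof.
rewrite /Yf /= flatF_seqF => Yl; apply: (seq_dom YC _ Yl _).1 => // i.
by rewrite /offc; case: ifP; rewrite // rnorm0 rnorm_ge0.
Qed.

Lemma col_Z i : Z Y (col (xs i)).
Proof.
have hd : forall j, j \notin [fset i]%fset -> (if j == i then 1 else 0 : R[i]) = 0.
  by move=> j; rewrite inE => /negbTE ->.
have [ZS _] := syn_Y YC (Yn_fin YC hd).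
by rewrite (syn_fin hd) big_seq_fset1 eqxx scale1r in ZS.
Qed.

(** The Neumann series in [Z Y] yields a preimage of [Uop E], which by injectivity on [Zv] is [E].
    This is how solutions found in [Z L1v] are transferred to [Z Y]. *)
Lemma Uop_regular E : Zv E -> Z Y (Uop E) -> Z Y E.
Proof.
move=> ZE /(Uop_onto YC)[G [ZG GE _]].
have ZG' := Z_Zv YC ZG; have [Zs Us] := Zv_sub ZE ZG'.
suff -> : E = G by [].
by apply/eqP; rewrite -subr_eq0; apply/eqP; apply: (Uop_inj Zs); rewrite Us GE subrr.
Qed.

Lemma syn_norm_cvg l : finite_sequences_dense (Yn Y) (nYn nY) -> Yn Y l ->
  forall e, 0 < e -> exists J0, forall J, (J0 `<=` J)%fset ->
    nY (\sum_(i <- J) l i *: col (xs i) - syn l) < e.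
Proof.
move=> dn Yl e e0; have c0 : 0 < nR + dl + 1 by rewrite ltr_wpDl ?addr_ge0.
have [|J0 hJ] := Yn_tail dn Yl (e := e / (nR + dl + 1)); first by rewrite divr_gt0.
exists J0 => J /hJ; rewrite ltr_pdivlMr // => h; apply: le_lt_trans h.
have [C lC] := Yn_bounded YC Yl.
have Yo := (offc_le J YC Yl).1.
rewrite (syn_split J lC) syn_onc opprD addrA subrr add0r -scaleN1r.
rewrite (ss_scale YS); last exact: (syn_Y YC Yo).1.1.
rewrite rnormN rnorm1 mul1r (le_trans (syn_Y YC Yo).2) // mulrC ler_wpM2l ?lerDl //.
exact: (ss_ge0 YS).
Qed.

Variable E : I -> T -> R[i].
Hypothesis ZE : forall i, Z L1v (E i).
Hypothesis UE : forall i, Uop (E i) = (cmass i)%:C *: col (xs i).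

Lemma dual_Z i : Z Y (E i).
Proof.
apply: Uop_regular; first exact: Z_Zv L1S (ZE i).
rewrite UE; apply: (csnZ (Z_banach YC).1); exact: col_Z.
Qed.

(** [Uop] is moved onto [E i], where it gives a multiple of the atom at [xs i], and pairing with
    that atom evaluates [G] there. *)
Lemma dual_coef i F G : Z Y G -> Uop G = F ->
  cintegral mu (fun y => F y * conjC (E i y)) = samp G i.
Proof.
move=> ZG <-; have ZG' := Z_Zv YC ZG.
rewrite -(Uop_adj ZG' (ZE i)) UE.
have [_ colA] := Zv_functional ZG'.
have [mG [C C_ge0 GC] _] := ZG'.
have [i1 _] := Zv_pair mG C_ge0 GC (Z_col (xs i)).1.1.
rewrite /samp -colA -cintegralZ //; congr cintegral; apply/funext => y.
rewrite [((cmass i)%:C *: col (xs i)) y]/((cmass i)%:C * col (xs i) y) rmorphM /=.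
rewrite (_ : conjC (cmass i)%:C = (cmass i)%:C); last exact: conjc_real.
by rewrite mulrCA.
Qed.

(** [Uop] maps the partial sums to partial sums of the synthesis of [samp F], whose limit is
    [Uop F]. The image of the error is thus, up to sign, a synthesized tail, and [Uop_lower] carries
    the estimate back. *)
Lemma dual_norm_cvg F : finite_sequences_dense (Yf Y) (nYf nY) -> Z Y F ->
  forall e, 0 < e -> exists J0, forall J, (J0 `<=` J)%fset ->
    nY (\sum_(i <- J) F (xs i) *: E i - F) < e.
Proof.
move=> df ZF e e0; pose c := (1 - theta)^-1 * (nR + dl) + 1.
have t0 : 0 <= (1 - theta)^-1 by rewrite invr_ge0 subr_ge0 ltW.
have c0 : 0 < c by rewrite ltr_wpDl // mulr_ge0 // addr_ge0.
have [|J0 hJ] := Yf_tail df (Z_sample YC ZF).1 (e := e / c); first by rewrite divr_gt0.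
exists J0 => J /hJ; rewrite ltr_pdivlMr // => h; apply: le_lt_trans h.
have [ZB _] := Z_banach YC.
have ZS (s : seq I) : Z Y (\sum_(i <- s) F (xs i) *: E i) /\
    Uop (\sum_(i <- s) F (xs i) *: E i) = \sum_(i <- s) samp F i *: col (xs i).
  elim: s => [|i s [ZSs US]].
    have Z0 := csn_zero ZB; rewrite !big_nil; split => //.
    have := Uop_linear 1 YC Z0 Z0; rewrite scaler0 addr0 scale1r => /eqP.
    by rewrite -subr_eq subrr eq_sym => /eqP.
  have ZFE : Z Y (F (xs i) *: E i) by apply: (csnZ ZB); exact: dual_Z.
  rewrite !big_cons; split; first exact: (csnD ZB).
  rewrite (Uop_linear (F (xs i)) YC (dual_Z i) ZSs) US UE scalerA.
  by congr (_ *: _ + _); rewrite /samp mulrC.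
have [ZJ UJ] := ZS J; have ZD := csnB ZB ZJ ZF.
have [C lC] := samp_bc YC ZF; have [Ys ns] := samp_Yn YC ZF.
have Yo := (offc_le J YC Ys).1.
apply: le_trans (Uop_lower YC ZD) _.
have -> : Uop (\sum_(i <- J) F (xs i) *: E i - F) = (-1) *: syn (offc J (samp F)).
  rewrite addrC -scaleN1r (Uop_linear (-1) YC ZF ZJ) UJ [Uop F](syn_split J lC) syn_onc.
  by rewrite scalerDr addrAC scaleN1r addNr add0r.
rewrite (ss_scale YS); last exact: (syn_Y YC Yo).1.1.
rewrite rnormN rnorm1 mul1r.
apply: (@le_trans _ _ ((1 - theta)^-1 * ((nR + dl) * nYn nY (offc J (samp F))))).
  by rewrite ler_wpM2l // (syn_Y YC Yo).2.
have [_ nn] : Yn Y (offc J (samp F)) /\ nYn nY (offc J (samp F)) <= nYf nY (offc J (F \o xs)).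
  apply: (nat_le_flat YC); first by apply: Yf_offc; exact: (Z_sample YC ZF).1.
  move=> i; rewrite /offc; case: ifP => _; first by rewrite !rnorm0 mulr0.
  by rewrite /samp rnormM rnormC ger0_norm ?cmass_ge0 // ler_wpM2r ?rnorm_ge0 ?cmass_le.
rewrite mulrA [leRHS]mulrC /c mulrDl mul1r.
apply: (@le_trans _ _ ((1 - theta)^-1 * (nR + dl) * nYf nY (offc J (F \o xs)))).
  by rewrite ler_wpM2l // mulr_ge0 // addr_ge0.
rewrite lerDl; apply: (ss_ge0 YS); apply: Yf_offc; exact: (Z_sample YC ZF).1.
Qed.
End CoreFrames.

(** * Coorbit spaces *)

Section Coorbit.
Context (H : completeNormedModType R[i]) (ip : {dot H for (@conjC R[i])}).
Variables p q : T -> H.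
Hypothesis H_hilbert : hilbert_norm ip.
Hypothesis pq : dual_pair ip mu p q.
Hypothesis K_ip : forall x y, K x y = ip (p y) (q x).

(** For [p = psi] and [q = dual_frame] this is the transform [W], which defines the test space of
    [Co Y]; with the roles exchanged it is [V]. *)
Definition tr (g : H) : T -> R[i] := ip g \o q.

Notation dom := [set g | L1v (ip g \o q)].
Notation ndom := (fun g => nL1v (ip g \o q)).

Let trE (g : H) : ip g \o q = tr g. Proof. by []. Qed.

Lemma tr_Z g : L1v (tr g) -> Z L1v (tr g).
Proof.
move=> Dg; split => // x; split.
  by under eq_fun do rewrite K_ip; exact: (dp_int pq).
by rewrite /tr /= (dp_id pq); congr cintegral; apply/funext => y; rewrite K_ip.
Qed.

(** The vector is the weak integral of [G y] times [p y], given by Riesz representation: [G] is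
    integrable because [v >= 1], and the family [p] is bounded. *)
Lemma tr_onto G : Z L1v G -> exists g, tr g = G.
Proof.
move=> [LG rG]; have [M hM] := dp_bound pq; have mG := LG.1.
have M0 : 0 <= M.
  by have [i _] := covU (point : T); apply: le_trans (rnorm_ge0 _) (hM point).1.
have mp h : cmeasurable (fun y => ip (p y) h).
  under eq_fun do rewrite ip_herm; apply: cmeas_conj; exact: (dp_measl pq).
have G_int : (\int[mu]_y (rnorm (G y))%:E <= (nL1v G)%:E)%E.
  rewrite -(wL1nE v1 LG); apply: nnint_le.
  + exact: cmeas_rnorm.
  + exact: (wL1_meas mv mG).
  + by move=> y; exact: rnorm_ge0.
  + by apply: aeW => y; rewrite ler_peMr ?rnorm_ge0.
have Gp_le h y : rnorm (G y * ip (p y) h) <= (M * rnorm h) * rnorm (G y).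
  rewrite rnormM mulrC ler_wpM2r ?rnorm_ge0 //; apply: le_trans (ip_CS H_hilbert _ _) _.
  by rewrite ler_wpM2r ?rnorm_ge0 // (hM y).1.
have Gp_int h : cintegrable mu (fun y => G y * ip (p y) h) /\
    rnorm (cintegral mu (fun y => G y * ip (p y) h)) <= M * rnorm h * nL1v G.
  have Mh : 0 <= M * rnorm h by rewrite mulr_ge0 ?rnorm_ge0.
  have h1 : (\int[mu]_y ((M * rnorm h) * rnorm (G y))%:E <= (M * rnorm h * nL1v G)%:E)%E.
    rewrite nnintZ //; [|exact: cmeas_rnorm|by move=> y; exact: rnorm_ge0].
    by rewrite [leRHS]EFinM lee_wpmul2l // lee_fin.
  have i1 : cintegrable mu (fun y => G y * ip (p y) h).
    apply: (@cint_le _ _ _ _ _ (fun y => (M * rnorm h) * rnorm (G y))).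
    + exact: cmeasM.
    + by apply: measurable_funM; [exact: measurable_cst|exact: cmeas_rnorm].
    + by apply: aeW => y; exact: Gp_le.
    + by apply: le_lt_trans h1 _; exact: ltry.
  split => //; rewrite -lee_fin; apply: le_trans h1; apply: le_trans (rnorm_cintegral i1) _.
  apply: nnint_le.
  + by apply: cmeas_rnorm; exact: cmeasM.
  + by apply: measurable_funM; [exact: measurable_cst|exact: cmeas_rnorm].
  + by move=> y; exact: rnorm_ge0.
  + by apply: aeW => y; exact: Gp_le.
have [g hg] : exists g, forall h, ip g h = cintegral mu (fun y => G y * ip (p y) h).
  apply: (@riesz _ _ ip 1 1 ltr01 ler01 _ _ _ _ _ (M * nL1v G)).
  - exact: ip_linear.
  - exact: ip_herm.
  - by move=> h; rewrite ip_norm // mul1r.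
  - by move=> h; rewrite ip_norm // mul1r.
  - move=> a h k; rewrite -(cintegralZ _ (Gp_int h).1) -cintegralD.
    + by congr cintegral; apply/funext => y; rewrite ip_conj mulrDr mulrCA.
    + exact: cintZ (Gp_int h).1.
    + exact: (Gp_int k).1.
  - by move=> h; rewrite -mulrA [nL1v G * _]mulrC mulrA; exact: (Gp_int h).2.
exists g; apply/funext => x; rewrite /tr /= hg (rG x).2.
by congr cintegral; apply/funext => y; rewrite K_ip.
Qed.

Lemma tr_inj : injective tr.
Proof.
move=> g h gh; apply: (ip_ext H_hilbert) => f; rewrite !(dp_id pq).
congr cintegral; apply/funext => y; congr (_ * _).
by have := congr1 (fun F : T -> R[i] => F y) gh.
Qed.

Lemma tr_linear a g h : tr (a *: g + h) = a *: tr g + tr h.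
Proof. by apply/funext => y; rewrite /tr /= ip_linear. Qed.

Lemma tr_p x : tr (p x) = col x.
Proof. by apply/funext => y; rewrite /tr /col /= K_ip. Qed.

Definition rep (G : T -> R[i]) : H := xget 0 [set g | tr g = G].

Lemma repK G : Z L1v G -> tr (rep G) = G.
Proof.
by move=> ZG; rewrite /rep; case: xgetP => [g _ //|]; have [g hg] := tr_onto ZG => /(_ g).
Qed.

Lemma rep_linear a F G : Z L1v F -> Z L1v G -> rep (a *: F + G) = a *: rep F + rep G.
Proof.
move=> ZF ZG; apply: tr_inj.
by rewrite tr_linear (repK ZF) (repK ZG) (repK (Z_linear L1S a ZF ZG)).
Qed.

(** Preimages are unique, so this choice is linear on [Z L1v]; the default 0 is taken only outside
    that space. *)
Definition Uinv (F : T -> R[i]) : T -> R[i] := xget 0 [set G | Z L1v G /\ Uop G = F].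

Lemma UinvP F : Z L1v F -> [/\ Z L1v (Uinv F), Uop (Uinv F) = F &
  nL1v (Uinv F) <= (1 - theta)^-1 * nL1v F].
Proof.
move=> ZF; rewrite /Uinv; case: xgetP => [G _ [ZG UG]|]; last first.
  by have [G [ZG UG _]] := Uop_onto L1S ZF => /(_ G); case.
by split => //; have := Uop_lower L1S ZG; rewrite UG.
Qed.

Lemma Uop_uniq F G : Zv F -> Zv G -> Uop F = Uop G -> F = G.
Proof.
move=> ZF ZG E; have [ZFG UFG] := Zv_sub ZF ZG.
by apply/eqP; rewrite -subr_eq0; apply/eqP/Uop_inj => //; rewrite UFG E subrr.
Qed.

Lemma Uinv_linear a F G : Z L1v F -> Z L1v G -> Uinv (a *: F + G) = a *: Uinv F + Uinv G.
Proof.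
move=> ZF ZG; have [ZUF UF _] := UinvP ZF; have [ZUG UG _] := UinvP ZG.
have [Z1 U1 _] := UinvP (Z_linear L1S a ZF ZG).
apply: Uop_uniq.
- exact: (Z_Zv L1S Z1).
- exact: (Z_Zv L1S (Z_linear L1S a ZUF ZUG)).
by rewrite U1 (Uop_linear a L1S ZUF ZUG) UF UG.
Qed.

(* Expanding [f] along [Uop (tr g) = g] identifies [f \o p] with a synthesized
   function, which gives its measurability and reproducing property. *)
Lemma antidual_rep f : antidual dom ndom f ->
  Zv (f \o p) /\ forall g, L1v (tr g) -> f g = cintegral mu (fun y => f (p y) * conjC (tr g y)).
Proof.
move=> [_ fl [c fb]].
have c0 : 0 <= `|c| by exact: normr_ge0.
have fb' g : L1v (tr g) -> rnorm (f g) <= `|c| * nL1v (tr g).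
  move=> Dg; apply: le_trans (fb g Dg) _; apply: ler_wpM2r (ler_norm c).
  exact: (ss_ge0 L1SS).
have th0 : 0 <= (1 - theta)^-1 by rewrite invr_ge0 subr_ge0 ltW.
(* The functional [f] read on [Z L1v] and preceded by the inverse of [Uop], so that
   [f g = ft (Uop (tr g))] expands into a series in the samples of [tr g]. *)
pose ft G := f (rep (Uinv G)).
have aft : antilinear_on_L1v ft.
  split.
    move=> a F G ZF ZG; have [ZUF _ _] := UinvP ZF; have [ZUG _ _] := UinvP ZG.
    by rewrite /ft Uinv_linear // rep_linear // fl //= trE repK //; [case: ZUF|case: ZUG].
  exists (`|c| * (1 - theta)^-1) => F ZF; have [ZUF _ nUF] := UinvP ZF.
  apply: le_trans (fb' _ _) _; rewrite repK //; first by case: ZUF.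
  by rewrite -mulrA ler_wpM2l.
pose a i := ft (col (xs i)).
pose b i : R[i] := (cmass i)%:C * a i.
have ba : exists C, bounded_coef b C.
  have [ca hca] := aft.2; have C00 := C0_ge0 (point : T).
  exists (`|ca| * C0); split; first by rewrite mulr_ge0.
  move=> i; rewrite /b rnormM rnormC ger0_norm ?cmass_ge0 //.
  have [Zc nc] := Z_col (xs i).
  have h : rnorm (a i) <= `|ca| * (C0 * v (xs i)).
    apply: le_trans (hca _ Zc) _; apply: le_trans (ler_wpM2r _ (ler_norm ca)) _.
      exact: (ss_ge0 L1SS) Zc.1.
    by rewrite ler_wpM2l.
  apply: le_trans (ler_pM (cmass_ge0 i) (rnorm_ge0 _) (cmass_le i) h) _.
  by rewrite le_eqVlt; apply/orP; left; apply/eqP; ring.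
have {ba}[C bC] := ba.
have key g : L1v (tr g) -> f g = cintegral mu (fun y => syn b y * conjC (tr g y)).
  move=> Dg; have Zg := tr_Z Dg; have [_ acvb ->] := syn_pair bC Zg.
  have E : ft (Uop (tr g)) = f g.
    rewrite /ft; congr f; apply: tr_inj.
    have ZU := Uop_Z L1S Zg; have [Z1 U1 _] := UinvP ZU; rewrite repK //.
    by apply: Uop_uniq U1; [exact: (Z_Zv L1S Z1)|exact: (Z_Zv L1S Zg)].
  rewrite -E; apply: cvg_partial_unique (csum_cvg acvb).
  have := antilinear_syn aft (samp_Yn L1S Zg).1; rewrite -/(Uop _).
  have -> // : (fun i => conjC (samp (tr g) i) * ft (col (xs i))) =
    (fun i => b i * conjC (tr g (xs i))).
  apply/funext => i; rewrite /samp /b /a rmorphM /= mulrAC.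
  by congr (_ * _ * _); exact: conjc_real.
(* The vector [p x] has transform [col x], so the pairing formula at [g = p x] evaluates [syn b] at
   [x]. *)
have fp : f \o p = syn b.
  apply/funext => x; rewrite /= key ?tr_p; last exact: (Z_col x).1.1.
  exact: (Zv_functional (syn_Zv bC)).2.
split; first by rewrite fp; exact: syn_Zv bC.
by move=> g Dg; rewrite key // -fp.
Qed.

(** The inverse of [f |-> f \o p]. Extension by 0 off [dom] matches the encoding of anti-dual
    elements, so equality of functions on [H] is equality of functionals. *)
Definition func (A : T -> R[i]) : H -> R[i] :=
  patch (fun=> 0) dom (fun g => cintegral mu (fun y => A y * conjC (tr g y))).

Lemma func_in A g : L1v (tr g) -> func A g = cintegral mu (fun y => A y * conjC (tr g y)).
Proof. by move=> Dg; rewrite /func patchT // inE. Qed.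

Lemma func_out A g : ~ L1v (tr g) -> func A g = 0.
Proof. by move=> Dg; rewrite /func patchN // notin_setE. Qed.

Lemma func_antidual A : Zv A -> antidual dom ndom (func A).
Proof.
move=> ZA; have [[lA [c bA]] _] := Zv_functional ZA; split.
- by move=> g nDg; exact: func_out.
- move=> a g h Dg Dh; have Zg := tr_Z Dg; have Zh := tr_Z Dh.
  have E := tr_linear a g h; have ZL := Z_linear L1S a Zg Zh.
  rewrite !func_in //; last by rewrite E; case: ZL.
  by rewrite E; exact: lA.
- by exists c => g Dg; rewrite func_in //; apply: bA; exact: tr_Z.
Qed.

Lemma funcK A : Zv A -> func A \o p = A.
Proof.
move=> ZA; apply/funext => x /=; rewrite func_in tr_p; last exact: (Z_col x).1.1.
exact: (Zv_functional ZA).2.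
Qed.

Lemma func_linear a A B : Zv A -> Zv B -> func (a *: A + B) = a *: func A + func B.
Proof.
move=> [mA [C C_ge0 AC] _] [mB [C' C'0 BC] _]; apply/funext => g.
have -> : (a *: func A + func B) g = a * func A g + func B g :> R[i] by [].
have [Dg|nDg] := pselect (L1v (tr g)); last by rewrite !func_out // mulr0 addr0.
have [iA _] := Zv_pair mA C_ge0 AC Dg; have [iB _] := Zv_pair mB C'0 BC Dg.
rewrite !func_in // -(cintegralZ a iA) -(cintegralD (cintZ a iA) iB).
by congr cintegral; apply/funext => y; rewrite mulrA -mulrDl.
Qed.

Lemma antidual_func f : antidual dom ndom f -> f = func (f \o p).
Proof.
move=> Af; have [Zf fE] := antidual_rep Af; apply/funext => g.
have [Dg|nDg] := pselect (L1v (tr g)); first by rewrite func_in // fE.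
by rewrite func_out //; have [-> ] := Af.
Qed.

(** For an embedded vector the pairing with its transform is the reconstruction formula of the pair,
    read with [p] and [q] exchanged. *)
Lemma embed_Zv h : Zv (ip h \o p) /\ embed ip dom h = func (ip h \o p).
Proof.
have [M hM] := dp_bound pq.
have M0 : 0 <= M by apply: le_trans (rnorm_ge0 _) (hM (point : T)).1.
split.
  split; first exact: (dp_measl pq).
    exists (rnorm h * M); first by rewrite mulr_ge0 ?rnorm_ge0.
    move=> x; apply: le_trans (ip_CS H_hilbert _ _) _.
    apply: (@le_trans _ _ (rnorm h * M)); first by rewrite ler_wpM2l ?rnorm_ge0 // (hM x).1.
    by rewrite ler_peMr // mulr_ge0 ?rnorm_ge0.
  move=> x; rewrite /= (dp_id (dual_pair_sym pq)).
  by congr cintegral; apply/funext => y; rewrite K_ip (dp_kernel pq).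
apply/funext => g; have [Dg|nDg] := pselect (L1v (tr g)); last first.
  by rewrite func_out // /embed patchN // notin_setE.
rewrite func_in // /embed patchT ?inE // (dp_id (dual_pair_sym pq)).
by congr cintegral; apply/funext => y; rewrite /tr /= [ip (q y) g]ip_herm.
Qed.

Section CoorbitSpace.
Variables (Y : set (T -> R[i])) (nY : (T -> R[i]) -> R).
Hypothesis YC : core_space Y nY.

Definition coorb : set (H -> R[i]) := [set f | antidual dom ndom f /\ Y (f \o p)].

Definition ncoorb (f : H -> R[i]) : R := nY (f \o p).

Let ZB := (Z_banach YC).1.
Let kap := (1 - theta)^-1.
Let kap0 : 0 <= kap. Proof. by rewrite invr_ge0 subr_ge0 ltW. Qed.

Lemma coorb_Z f : coorb f -> Z Y (f \o p) /\ f = func (f \o p).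
Proof.
by move=> [Af Yf]; split; [exact: Zv_Z (antidual_rep Af).1 Yf|exact: antidual_func].
Qed.

Lemma Z_coorb F : Z Y F -> coorb (func F).
Proof.
move=> ZF; have ZvF := Z_Zv YC ZF.
by split; [exact: func_antidual|rewrite funcK //; case: ZF].
Qed.

Lemma ncoorb_func F : Z Y F -> ncoorb (func F) = nY F.
Proof. by move=> ZF; rewrite /ncoorb funcK //; exact: (Z_Zv YC). Qed.

Lemma coorb_linear a f g : coorb f -> coorb g -> coorb (a *: f + g).
Proof.
move=> Cf Cg; have [Zf fE] := coorb_Z Cf; have [Zg gE] := coorb_Z Cg.
have -> : a *: f + g = func (a *: (f \o p) + (g \o p)).
  by rewrite func_linear -?fE -?gE //; exact: (Z_Zv YC).
by apply: Z_coorb; exact: (Z_linear YC).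
Qed.

Lemma func0 : func 0 = 0.
Proof.
have Z0 : Zv 0 by exact: (Z_Zv YC (csn_zero ZB)).
have := func_linear (-1) Z0 Z0; rewrite scaler0 addr0 scaleN1r addNr.
exact.
Qed.

Lemma coorb_banach : banach_space coorb ncoorb.
Proof.
split; last first.
  move=> f Cf nf; have [Zf fE] := coorb_Z Cf.
  by rewrite fE ((Z_banach YC).2 _ Zf nf) func0.
split.
- by rewrite -func0; apply: Z_coorb; exact: (csn_zero ZB).
- exact: coorb_linear.
- by move=> f /coorb_Z[Zf _]; exact: (csn_ge0 ZB).
- by move=> a f /coorb_Z[Zf _]; exact: (csn_scale ZB a Zf).
- by move=> f g /coorb_Z[Zf _] /coorb_Z[Zg _]; exact: (csn_triangle ZB Zf Zg).
- move=> u Cu uC.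
  have Zu k : Z Y (u k \o p) := (coorb_Z (Cu k)).1.
  have [F ZF hF] := csn_complete ZB Zu uC.
  exists (func F); first exact: Z_coorb.
  have FK := funcK (Z_Zv YC ZF).
  have -> // : (fun k => ncoorb (u k - func F)) = (fun k => nY (u k \o p - F)).
  by apply/funext => k; rewrite -[in RHS]FK.
Qed.

Lemma func_sum (c : I -> R[i]) (A : I -> T -> R[i]) (J : {fset I}) : (forall i, Z Y (A i)) ->
  Z Y (\sum_(i <- J) c i *: A i) /\
  func (\sum_(i <- J) c i *: A i) = \sum_(i <- J) c i *: func (A i).
Proof.
move=> ZA; elim: (enum_fset J) => [|i s [Zs fs]].
  by rewrite !big_nil func0; split => //; exact: (csn_zero ZB).
rewrite !big_cons; split; first by apply: (Z_linear YC).
by rewrite func_linear ?fs //; exact: (Z_Zv YC).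
Qed.

Lemma coorb_norm_cvg (c : I -> R[i]) (A : I -> T -> R[i]) F : (forall i, Z Y (A i)) -> Z Y F ->
  (forall e, 0 < e -> exists J0, forall J, (J0 `<=` J)%fset ->
    nY (\sum_(i <- J) c i *: A i - F) < e) ->
  norm_cvg coorb ncoorb (partial_sum (fun i => c i *: func (A i))) (func F).
Proof.
move=> ZA ZF h.
have sE J : partial_sum (fun i => c i *: func (A i)) J = func (\sum_(i <- J) c i *: A i).
  by rewrite partial_sumE (func_sum c J ZA).2.
have nE J : ncoorb (partial_sum (fun i => c i *: func (A i)) J - func F) =
    nY (\sum_(i <- J) c i *: A i - F).
  rewrite sE /ncoorb -{2}[F](funcK (Z_Zv YC ZF)).
  by rewrite -{2}[\sum_(i <- J) _](funcK (Z_Zv YC (func_sum c J ZA).1)).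
split; first by move=> J; rewrite sE; apply: Z_coorb; exact: (func_sum c J ZA).1.
apply: cvg_totally0 => [J|e /h[J0 hJ]]; rewrite ?nE.
  by apply: (csn_ge0 ZB); apply: (csnB ZB) => //; exact: (func_sum c J ZA).1.
by exists J0 => J /hJ; rewrite nE.
Qed.

Lemma embed_q i : embed ip dom (q (xs i)) = func (col (xs i)).
Proof.
rewrite (embed_Zv (q (xs i))).2; congr func; apply/funext => x /=.
by rewrite -(dp_kernel pq) /col K_ip.
Qed.

(** Evaluated at [g], the series becomes the sum of [l i] times the conjugate of [tr g (xs i)],
    which converges absolutely because [tr g] lies in [Z L1v]. *)
Lemma func_weakstar l : Yn Y l ->
  weakstar_cvg dom (partial_sum (fun i => l i *: func (col (xs i)))) (func (syn l)).
Proof.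
move=> Yl g Dg; have [C lC] := Yn_bounded YC Yl; have Zg := tr_Z Dg.
have [_ Al Es] := syn_pair lC Zg; rewrite (func_in _ Dg) Es.
have -> // : (fun J => rnorm (partial_sum (fun i => l i *: func (col (xs i))) J g -
    csum (fun i => l i * conjC (tr g (xs i))))) =
  (fun J => rnorm (partial_sum (fun i => l i * conjC (tr g (xs i))) J -
    csum (fun i => l i * conjC (tr g (xs i))))); last exact: csum_cvg.
apply/funext => J; congr (rnorm (_ - _)); rewrite !partial_sumE fct_sumE.
apply: eq_bigr => i _; rewrite [LHS]/(l i * func (col (xs i)) g); congr (_ * _).
rewrite func_in // -[in RHS]((Zv_functional (Z_Zv L1S Zg)).2 (xs i)) -cintegral_conj.
  by congr cintegral; apply/funext => y; rewrite rmorphM /= conjCK mulrC.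
have [mg [c c0 hc] _] := Z_Zv L1S Zg.
exact: (Zv_pair mg c0 hc (Z_col (xs i)).1.1).1.
Qed.

Variables (E : I -> T -> R[i]).
Hypothesis ZE : forall i, Z L1v (E i).
Hypothesis UE : forall i, Uop (E i) = (cmass i)%:C *: col (xs i).

Definition syncvg (s : {fset I} -> H -> R[i]) (f : H -> R[i]) : Prop :=
  (finite_sequences_dense (Yn Y) (nYn nY) -> norm_cvg coorb ncoorb s f) /\
  (~ finite_sequences_dense (Yn Y) (nYn nY) -> weakstar_cvg dom s f).

Lemma syn_syncvg l : Yn Y l ->
  syncvg (partial_sum (fun i => l i *: embed ip dom (q (xs i)))) (func (syn l)).
Proof.
move=> Yl; under eq_fun do rewrite embed_q.
split; last by move=> _; exact: func_weakstar.
move=> dn; apply: coorb_norm_cvg.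
- by move=> i; exact: (col_Z YC).
- exact: (syn_Y YC Yl).1.
- exact: (syn_norm_cvg YC).
Qed.

(** Reduces every statement about the coefficients [f (e i)] to weighted samples of the solution [G]
    of [Uop G = f \o p]. *)
Lemma coef_samp (e : I -> H) f : (forall i, tr (e i) = E i) -> coorb f ->
  exists G, [/\ Z Y G, Uop G = f \o p, nY G <= kap * ncoorb f & forall i, f (e i) = samp G i].
Proof.
move=> Ee Cf; have [Zf fE] := coorb_Z Cf; have [G [ZG UG nG]] := Uop_onto YC Zf.
exists G; split => // i; have [De _] := ZE i.
by rewrite fE func_in ?Ee //; exact: (dual_coef YC).
Qed.

Let cN : R := Nov%:R * (1 + dl).
Let cN0 : 0 <= cN. Proof. by rewrite mulr_ge0 ?ler0n // addr_ge0. Qed.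

Lemma samp_upper G : Z Y G -> Yn Y (samp G) /\ nYn nY (samp G) <= cN * nY G.
Proof.
move=> ZG; have [Ys ns] := samp_Yn YC ZG; split => //.
by apply: le_trans ns _; exact: (Z_sample YC ZG).2.
Qed.

Lemma coef_equivalence (e : I -> H) : (forall i, tr (e i) = E i) ->
  norm_equivalence coorb ncoorb (Yn Y) (nYn nY) (fun i f => f (e i)).
Proof.
move=> Ee; have c1 : 0 < nR + dl + 1 by rewrite ltr_wpDl ?addr_ge0.
(* The lower constant comes from synthesis, the upper one from sampling after inverting [Uop];
   adding 1 makes both positive. *)
exists (nR + dl + 1)^-1, (cN * kap + 1); split.
- by rewrite invr_gt0.
- by rewrite ltr_wpDl // mulr_ge0.
move=> f Cf; have [G [ZG UG nG fG]] := coef_samp Ee Cf.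
have -> : (fun i => f (e i)) = samp G by apply/funext.
have [Ys ns] := samp_upper ZG; have nf0 : 0 <= ncoorb f by exact: (csn_ge0 coorb_banach.1).
have nYn0 : 0 <= nYn nY (samp G) by exact: (ss_ge0 (cs_solid YC)).
split => //.
  rewrite ler_pdivrMl // /ncoorb -UG; apply: le_trans (syn_Y YC Ys).2 _.
  by rewrite ler_wpM2r // lerDl.
apply: le_trans ns _; rewrite mulrDl mul1r -mulrA; apply: ler_wpDr => //.
by rewrite ler_wpM2l.
Qed.

Lemma coef_bounded (e : I -> H) i : (forall i, tr (e i) = E i) ->
  bounded_functional coorb ncoorb (fun f => f (e i)).
Proof.
move=> Ee; split => // ; have [C C_ge0 hC] := Z_bound YC.
exists (cmass i * (C * kap * v (xs i))) => f Cf; have [G [ZG UG nG ->]] := coef_samp Ee Cf.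
rewrite /samp rnormM rnormC ger0_norm ?cmass_ge0 // -mulrA ler_wpM2l ?cmass_ge0 //.
apply: le_trans (hC G ZG _) _; by rewrite [leRHS]mulrAC ler_wpM2r // -mulrA ler_wpM2l.
Qed.

Lemma coorb_reconstruct (e : I -> H) f : (forall i, tr (e i) = E i) -> coorb f ->
  syncvg (partial_sum (fun i => f (e i) *: embed ip dom (q (xs i)))) f.
Proof.
move=> Ee Cf; have [G [ZG UG nG fG]] := coef_samp Ee Cf.
have -> : (fun i => f (e i) *: embed ip dom (q (xs i))) =
    (fun i => samp G i *: embed ip dom (q (xs i))) by apply/funext => i; rewrite fG.
rewrite [X in syncvg _ X](coorb_Z Cf).2 -UG; apply: syn_syncvg.
exact: (samp_Yn YC ZG).1.
Qed.

Lemma coorb_atomic (e : I -> H) : (forall i, tr (e i) = E i) ->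
  atomic_decomposition coorb ncoorb (Yn Y) (nYn nY) syncvg (fun i => embed ip dom (q (xs i))).
Proof.
move=> Ee; split.
- exact: coorb_banach.
- exact: Yn_BK.
- by move=> i; rewrite embed_q; apply: Z_coorb; exact: (col_Z YC).
exists (fun i f => f (e i)); split.
- by move=> i; exact: coef_bounded.
- have [C1 [C2 [_ C20 h]]] := coef_equivalence Ee.
  by exists C2 => // f /h[].
- exists (nR + dl + 1); first by rewrite ltr_wpDl ?addr_ge0.
  move=> l Yl; have [Zs ns] := syn_Y YC Yl; exists (func (syn l)); split.
  + exact: Z_coorb.
  + exact: syn_syncvg.
  + rewrite ncoorb_func //; apply: le_trans ns _.
    by rewrite ler_wpM2r ?lerDl //; exact: (ss_ge0 (cs_solid YC)).
- by move=> f Cf; exact: coorb_reconstruct.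
Qed.

Lemma sample_equivalence :
  norm_equivalence coorb ncoorb (Yf Y) (nYf nY) (fun i f => f (p (xs i))).
Proof.
have c0 : 0 <= kap * (nR + dl) by rewrite mulr_ge0 // addr_ge0.
exists (kap * (nR + dl) + 1)^-1, (cN + 1); split.
- by rewrite invr_gt0 ltr_wpDl.
- by rewrite ltr_wpDl.
move=> f Cf; have [Zf _] := coorb_Z Cf; have [Yff nf] := Z_sample YC Zf.
have nf0 : 0 <= ncoorb f by exact: (csn_ge0 coorb_banach.1).
have nYf0 : 0 <= nYf nY ((f \o p) \o xs) by exact: (ss_ge0 (cs_solid YC)).
split => //; last first.
  by apply: le_trans nf _; rewrite mulrDl mul1r lerDl.
have [Ys ns] := samp_Yn YC Zf.
rewrite ler_pdivrMl ?ltr_wpDl //; apply: le_trans (Uop_lower YC Zf) _.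
apply: (@le_trans _ _ (kap * (nR + dl) * nYf nY ((f \o p) \o xs))); last first.
  by rewrite ler_wpM2r // lerDl.
rewrite -mulrA ler_wpM2l //; apply: le_trans (syn_Y YC Ys).2 _.
by rewrite ler_wpM2l ?addr_ge0.
Qed.

(** The inverse of [Uop] taken in [Z Y] instead of [Z L1v]; [Uop_uniq] again makes it single valued
    and linear there. *)
Definition UinvY (F : T -> R[i]) : T -> R[i] := xget 0 [set G | Z Y G /\ Uop G = F].

Lemma UinvYP F : Z Y F -> [/\ Z Y (UinvY F), Uop (UinvY F) = F & nY (UinvY F) <= kap * nY F].
Proof.
move=> ZF; rewrite /UinvY; case: xgetP => [G _ [ZG UG]|]; last first.
  by have [G [ZG UG _]] := Uop_onto YC ZF => /(_ G); case.
by split => //; have := Uop_lower YC ZG; rewrite UG.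
Qed.

Let wgt (b : I -> R[i]) (i : I) : R[i] := (cmass i)%:C * b i.

Let wgt_Yn b : Yf Y b -> Yn Y (wgt b) /\ nYn nY (wgt b) <= nYf nY b.
Proof.
move=> Yb; apply: (nat_le_flat YC) => // i.
by rewrite /wgt rnormM rnormC ger0_norm ?cmass_ge0 // ler_wpM2r ?rnorm_ge0 ?cmass_le.
Qed.

Lemma coorb_frame : banach_frame coorb ncoorb (Yf Y) (nYf nY) (fun i f => f (p (xs i))).
Proof.
split.
- exact: coorb_banach.
- exact: Yf_BK.
- move=> i; split => //; have [C C_ge0 hC] := Z_bound YC.
  exists (C * v (xs i)) => f Cf; have [Zf _] := coorb_Z Cf.
  by rewrite mulrAC; exact: hC.
- exact: sample_equivalence.
(* With [b] the samples of [F], [syn (wgt b)] is [Uop F]; the same formula makes sense and is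
   bounded on the whole flat sequence space. *)
exists (fun b => func (UinvY (syn (wgt b)))); split.
- move=> b Yb; apply: Z_coorb; have [Yw _] := wgt_Yn Yb.
  by have [] := UinvYP (syn_Y YC Yw).1.
- move=> a b b' Yb Yb'; have [Yw _] := wgt_Yn Yb; have [Yw' _] := wgt_Yn Yb'.
  have [Zs _] := syn_Y YC Yw; have [Zs' _] := syn_Y YC Yw'.
  have [ZU UU _] := UinvYP Zs; have [ZU' UU' _] := UinvYP Zs'.
  rewrite -func_linear; [|exact: (Z_Zv YC)|exact: (Z_Zv YC)]; congr func.
  have [C hC] := Yn_bounded YC Yw; have [C' hC'] := Yn_bounded YC Yw'.
  have E1 : syn (wgt (a *: b + b')) = a *: syn (wgt b) + syn (wgt b').
    rewrite -(syn_linear a hC hC'); congr syn; apply/funext => i.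
    by rewrite /wgt [(a *: b + b') i]/(a * b i + b' i) mulrDr mulrCA.
  have ZL := Z_linear YC a Zs Zs'; have [Z1 U1 _] := UinvYP ZL.
  rewrite E1; apply: Uop_uniq.
  + exact: (Z_Zv YC).
  + by apply: (Z_Zv YC); exact: (Z_linear YC).
  + by rewrite U1 (Uop_linear a YC ZU ZU') UU UU'.
- exists (kap * (nR + dl)) => b Yb; have [Yw nw] := wgt_Yn Yb.
  have [Zs ns] := syn_Y YC Yw; have [ZU _ nU] := UinvYP Zs.
  rewrite ncoorb_func //; apply: le_trans nU _; rewrite -mulrA ler_wpM2l //.
  by apply: le_trans ns _; rewrite ler_wpM2l ?addr_ge0.
- move=> f Cf; have [Zf fE] := coorb_Z Cf; rewrite [RHS]fE; congr func.
  have ZU := Uop_Z YC Zf; have [Z1 U1 _] := UinvYP ZU.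
  by apply: Uop_uniq U1; [exact: (Z_Zv YC Z1)|exact: (Z_Zv YC Zf)].
Qed.

Lemma coorb_frame_series (e : I -> H) f : (forall i, ip (e i) \o p = E i) ->
  finite_sequences_dense (Yf Y) (nYf nY) -> coorb f ->
  norm_cvg coorb ncoorb (partial_sum (fun i => f (p (xs i)) *: embed ip dom (e i))) f.
Proof.
move=> Ee dn Cf; have [Zf fE] := coorb_Z Cf.
have -> : (fun i => f (p (xs i)) *: embed ip dom (e i)) =
    (fun i => f (p (xs i)) *: func (E i)).
  by apply/funext => i; rewrite (embed_Zv (e i)).2 Ee.
rewrite {2}fE; apply: coorb_norm_cvg => //.
- by move=> i; exact: (dual_Z YC).
- exact: (dual_norm_cvg YC ZE UE dn Zf).
Qed.
End CoorbitSpace.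

End Coorbit.

(** * Both coorbit spaces of a dual pair *)

Section Discretization.
Context (H : completeNormedModType R[i]) (ip : {dot H for (@conjC R[i])}).
Variables psi phi : T -> H.
Hypothesis H_hilbert : hilbert_norm ip.
Hypothesis pq : dual_pair ip mu psi phi.
Hypothesis K_ip : forall x y, K x y = ip (psi y) (phi x).
Variables (Y : set (T -> R[i])) (nY : (T -> R[i]) -> R).
Hypothesis YC : core_space Y nY.

Let qp : dual_pair ip mu phi psi := dual_pair_sym pq.
Let K_ip' x y : K x y = ip (phi y) (psi x).
Proof. by rewrite K_ip (dp_kernel pq). Qed.

(** The coorbit construction is used with [(phi, psi)] for the atomic decomposition and with
    [(psi, phi)] for the Banach frame. Both have the same kernel [K], hence the same operator [Uop]
    and the same dual functions [E i], so one family [e] serves both. *)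
Theorem discretization : exists e : I -> H,
  [/\ forall i, L1v (ip (e i) \o psi) /\ L1v (ip (psi (xs i)) \o phi),
    atomic_decomposition (coorb ip phi psi Y) (ncoorb phi nY) (Yn Y) (nYn nY)
      (syncvg ip phi psi Y nY)
      (fun i => embed ip [set g | L1v (ip g \o psi)] (psi (xs i))),
    banach_frame (coorb ip psi phi Y) (ncoorb psi nY) (Yf Y) (nYf nY)
      (fun i f => f (psi (xs i))),
    norm_equivalence (coorb ip phi psi Y) (ncoorb phi nY) (Yn Y) (nYn nY) (fun i f => f (e i)) &
    (forall f, coorb ip phi psi Y f -> syncvg ip phi psi Y nY
      (partial_sum (fun i => f (e i) *: embed ip [set g | L1v (ip g \o psi)] (psi (xs i)))) f) /\
    (finite_sequences_dense (Yf Y) (nYf nY) -> forall f, coorb ip psi phi Y f ->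
      norm_cvg (coorb ip psi phi Y) (ncoorb psi nY)
        (partial_sum (fun i => f (psi (xs i)) *:
          embed ip [set g | L1v (ip g \o phi)] (e i))) f)].
Proof.
pose F i := (cmass i)%:C *: col (xs i).
have ZF i : Z L1v (F i).
  by apply: (csnZ (Z_banach L1S).1); exact: (Z_col (xs i)).1.
pose E i := Uinv (F i).
have ZE i : Z L1v (E i) by have [] := UinvP (ZF i).
have UE i : Uop (E i) = F i by have [] := UinvP (ZF i).
have [e Ee] : exists e : I -> H, forall i, tr ip psi (e i) = E i.
  by exists (fun i => rep ip psi (E i)) => i; exact: (repK H_hilbert qp K_ip').
exists e; split.
- move=> i; split; first by have [] := ZE i; rewrite -(Ee i).
  by have [] := (Z_col (xs i)).1; rewrite -(tr_p K_ip).
- exact: (coorb_atomic H_hilbert qp K_ip' YC ZE UE Ee).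
- exact: (coorb_frame H_hilbert pq K_ip YC).
- exact: (coef_equivalence H_hilbert qp K_ip' YC ZE UE Ee).
- split.
  + by move=> f Cf; exact: (coorb_reconstruct H_hilbert qp K_ip' YC ZE UE Ee Cf).
  + by move=> dn f Cf; exact: (coorb_frame_series H_hilbert pq K_ip YC ZE UE Ee dn Cf).
Qed.
End Discretization.

End Core.

(** * Continuous frames *)

Lemma continuous_borel_measurable (R : realType) (X : ptopologicalType) (f : X -> R) :
  continuous f -> measurable_fun [set: borel X] (f : borel X -> R).
Proof.
move=> cf; apply: (measurability _ (measurable_realfun.RGenOpens.measurableE R)).
move=> _ [_ [a [b ->]] <-]; rewrite setTI; apply: sub_sigma_algebra.
by apply: (open_comp (f := f)) => [x _|]; [exact: cf|exact: interval_open].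
Qed.

Lemma continuous_cmeasurable (R : realType) (X : ptopologicalType) (F : X -> R[i]) :
  continuous (F : X -> R[i]^o) -> cmeasurable (F : borel X -> R[i]).
Proof.
move=> cF.
have h x (e : R) : 0 < e -> \forall y \near x, rnorm (F x - F y) < e.
  move=> e0; have /cvgrPdist_lt/(_ (e%:C)%C) := cF x; rewrite ltcR => /(_ e0).
  by apply: filterS => y; rewrite rnormE ltcR.
split; apply: continuous_borel_measurable => x; apply/cvgrPdist_lt => e e0;
  apply: filterS (h x e e0) => y; apply: le_lt_trans; rewrite -raddfB.
  exact: norm_Re_le.
exact: norm_Im_le.
Qed.

Section FrameDualPair.
Context (R : realType) (H : completeNormedModType R[i]) (ip : {dot H for (@conjC R[i])}).
Context (X : ptopologicalType) (mu : {measure set (borel X) -> \bar R}).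
Hypothesis H_hilbert : hilbert_norm ip.
Local Open Scope complex_scope.
Variable psi : X -> H.
Hypothesis psi_frame : continuous_frame ip mu psi.

Let mpsi f : cmeasurable (fun x : borel X => ip f (psi x)).
Proof. by have [_ cf _] := psi_frame; exact: (continuous_cmeasurable (cf f)). Qed.

Let L2 f : (\int[mu]_x (rnorm (ip f (psi x)) ^+ 2)%:E < +oo)%E.
Proof.
by have [[C1 [C2 [_ _ h]]] _ _] := psi_frame; apply: le_lt_trans (h f).2 _; exact: ltry.
Qed.

Let frame_int f g : cintegrable mu (fun x : borel X => ip f (psi x) * ip (psi x) g).
Proof.
have mf2 f' : measurable_fun [set: borel X] (fun x : borel X => rnorm (ip f' (psi x)) ^+ 2).
  by apply: measurable_funX; exact: cmeas_rnorm.
apply: (@cint_le _ _ _ _ _ 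
  (fun x : borel X => rnorm (ip f (psi x)) ^+ 2 + rnorm (ip g (psi x)) ^+ 2)).
- apply: cmeasM => //; under eq_fun do rewrite ip_herm; exact: cmeas_conj.
- exact: measurable_funD.
- apply: aeW => x; rewrite rnormM [ip (psi x) g]ip_herm rnorm_conj.
  have := sqr_ge0 (rnorm (ip f (psi x)) - rnorm (ip g (psi x))).
  have := rnorm_ge0 (ip f (psi x)); have := rnorm_ge0 (ip g (psi x)); nra.
- rewrite nnintD; [exact: lte_add_pinfty (L2 f) (L2 g)|exact: mf2| |exact: mf2|] => x;
    exact: sqr_ge0.
Qed.

(** The form of the frame operator [S]. Riesz representation for [ip] produces [S f]; Riesz
    representation for [fB], coercive by the lower frame bound, produces its inverse. *)
Let fB f g := cintegral mu (fun x : borel X => ip f (psi x) * ip (psi x) g).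

Let fB_linear a f g h : fB (a *: f + g) h = a * fB f h + fB g h.
Proof.
rewrite /fB -(cintegralZ a (frame_int f h)) -(cintegralD (cintZ a (frame_int f h)) (frame_int g h)).
by congr cintegral; apply/funext => x; rewrite ip_linear mulrDl mulrA.
Qed.

Let fB_herm f g : fB g f = conjC (fB f g).
Proof.
rewrite /fB -(cintegral_conj (frame_int f g)); congr cintegral; apply/funext => x.
by rewrite rmorphM /= -!ip_herm mulrC.
Qed.

Let fB_norm f : ((complex.Re (fB f f))%:E = \int[mu]_x (rnorm (ip f (psi x)) ^+ 2)%:E)%E.
Proof.
have E : (fun x => ip f (psi x) * ip (psi x) f) = (fun x => (rnorm (ip f (psi x)) ^+ 2)%:C).
  by apply/funext => x; rewrite [ip (psi x) f]ip_herm rnorm_conjM.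
rewrite /fB E cintegral_real /= /Rintegral fineK // ge0_fin_numE //.
by apply: integral_ge0 => x _; rewrite lee_fin sqr_ge0.
Qed.

Let fB_bounds : exists C1 C2 : R, [/\ 0 < C1, 0 < C2 &
  forall f, C1 * rnorm f ^+ 2 <= complex.Re (fB f f) /\ complex.Re (fB f f) <= C2 * rnorm f ^+ 2].
Proof.
have [[C1 [C2 [C10 C20 h]]] _ _] := psi_frame; exists C1, C2; split => // f.
by rewrite -!lee_fin fB_norm; exact: h.
Qed.

Let frame_opE f g : ip (frame_op ip mu psi f) g = fB f g.
Proof.
have [C1 [C2 [C10 C20 hB]]] := fB_bounds.
have [h hh] : exists h, forall g, ip h g = fB f g.
  apply: (@riesz _ _ ip 1 1 ltr01 ler01 _ _ _ _ (fB f) (C2 * rnorm f)).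
  - exact: ip_linear.
  - exact: ip_herm.
  - by move=> h; rewrite ip_norm // mul1r.
  - by move=> h; rewrite ip_norm // mul1r.
  - move=> a h k; rewrite [LHS]fB_herm fB_linear rmorphD rmorphM /=.
    by rewrite -!fB_herm.
  - move=> k; apply: (form_CS (B := fB) (c := C1) C10 (ltW C20)) => //.
    + by move=> k'; exact: (hB k').1.
    + by move=> k'; exact: (hB k').2.
rewrite /frame_op; case: xgetP => [h' _ /= h2|/(_ h)]; first exact: h2.
by move=> /(_ hh).
Qed.

Let frame_op_invE f g : fB (frame_op_inv ip mu psi f) g = ip f g.
Proof.
have [C1 [C2 [C10 C20 hB]]] := fB_bounds.
have [h hh] : exists h, forall g, fB h g = ip f g.
  apply: (@riesz _ _ fB C1 C2 C10 (ltW C20) _ _ _ _ (ip f) (rnorm f)) => //.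
  - by move=> k; exact: (hB k).1.
  - by move=> k; exact: (hB k).2.
  - by move=> a k l; exact: ip_conj.
  - by move=> k; exact: (ip_CS H_hilbert).
rewrite -frame_opE /frame_op_inv; case: xgetP => [h' _ /= -> //|/(_ h)].
by case; apply: (ip_ext H_hilbert) => k; rewrite frame_opE.
Qed.

Local Notation q := (dual_frame ip mu psi).

(** Self-adjointness of the inverse frame operator. Measurability, integrability and the reproducing
    formula for the dual family reduce through it to those of [psi]. *)
Let dual_sym f x : ip f (q x) = ip (frame_op_inv ip mu psi f) (psi x).
Proof. by rewrite -frame_op_invE fB_herm frame_op_invE -ip_herm. Qed.

Lemma frame_dual_pair : dual_pair ip mu (psi : borel X -> H) q.
Proof.
have [C1 [C2 [C10 C20 hB]]] := fB_bounds.
have [_ _ [M hM]] := psi_frame.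
split.
- exact: mpsi.
- by move=> f; under eq_fun do rewrite dual_sym; exact: mpsi.
(* The bound [M / C1] for the dual vector [q x] follows from [C1 |q x|^2 <= fB (q x) (q x) = ip (psi
   x) (q x) <= M |q x|]. *)
- exists (Num.max M (M / C1)) => x; rewrite !le_max hM /=; split => //.
  rewrite ler_pdivlMr // mulrC; apply/orP; right.
  have [->|q0] := eqVneq (rnorm (q x)) 0.
    by rewrite mulr0 (le_trans (rnorm_ge0 _) (hM x)).
  have qp : 0 < rnorm (q x) by rewrite lt_neqAle eq_sym q0 rnorm_ge0.
  rewrite -(ler_pM2r qp) -mulrA -expr2; apply: le_trans (hB (q x)).1 _.
  rewrite frame_op_invE; apply: le_trans (Re_le_rnorm _) _.
  by apply: le_trans (ip_CS H_hilbert _ _) _; rewrite ler_wpM2r ?rnorm_ge0.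
- move=> f g; under eq_fun do rewrite dual_sym; exact: frame_int.
- move=> f g; under eq_fun do rewrite dual_sym; by rewrite -/(fB _ _) frame_op_invE.
- by move=> x y; rewrite dual_sym.
Qed.
End FrameDualPair.

(** * Admissible kernels *)

(** Here [mu] carries only a measure structure; sigma-finiteness is a hypothesis, packed into a
    structure for the proof only. *)
Lemma tonelli_sigma (R : realType) d (T : measurableType d) (mu : {measure set T -> \bar R})
  (f : T * T -> \bar R) : sigma_finite [set: T] mu ->
  measurable_fun [set: T * T] f -> (forall x, (0 <= f x)%E) ->
  (\int[mu]_x \int[mu]_y f (x, y) = \int[mu]_y \int[mu]_x f (x, y))%E /\
  measurable_fun [set: T] (fun x => \int[mu]_y f (x, y))%E.
Proof.
move=> sf mf f0.
pose h1 := isSFinite.Build _ _ _ _ (sfinite_measure_sigma_finite sf).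
pose h2 := isSigmaFinite.Build _ _ _ _ sf.
pose mu' := HB.pack_for {sigma_finite_measure set T -> \bar R} (Measure.sort mu) h1 h2.
split; first exact: (@fubini_tonelli _ _ _ _ _ mu' mu' f mf f0).
exact: (@measurable_fun_fubini_tonelli_F _ _ _ _ _ mu' f mf f0).
Qed.

Lemma open_borel (X : ptopologicalType) (A : set X) : open A -> measurable (A : set (borel X)).
Proof. exact: sub_sigma_algebra. Qed.

Lemma closed_borel (X : ptopologicalType) (A : set X) : closed A -> measurable (A : set (borel X)).
Proof.
move=> cA; rewrite -(setCK (A : set (borel X))); apply: measurableC; apply: open_borel.
exact: closed_openC.
Qed.

(** Each point of [C] has an open rectangle inside [W]; finitely many of them cover [C], and their
    union is measurable for the product sigma-algebra. *)
Lemma open_rect_cover (X : ptopologicalType) (W C : set (X * X)) : open W -> compact C ->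
  C `<=` W -> exists P : set (borel X * borel X), [/\ measurable P, C `<=` P & P `<=` W].
Proof.
move=> oW cC CW.
have h p : exists AB : set X * set X, W p ->
    [/\ open AB.1, open AB.2, (AB.1 `*` AB.2) p & AB.1 `*` AB.2 `<=` W].
  have [Wp|nW] := pselect (W p); last by exists (set0, set0).
  have [[A B] /= [nA nB] AB] : nbhs p W by exact: open_nbhs_nbhs.
  exists (A°, B°) => _ /=; split; [exact: open_interior|exact: open_interior| |].
    by split; exact: nbhs_singleton (nbhs_interior _).
  by move=> [x y] [/interior_subset Ax /interior_subset By]; exact: AB.
pose f p := projT1 (cid (h p)); have hf p := projT2 (cid (h p)).
pose XX : ptopologicalType := HB.pack_for ptopologicalType (X * X)%type
  (Topological.class (X * X)%type) (Pointed.class (X * X)%type).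
move: cC; rewrite (compact_cover XX) => /(_ _ W (fun p => (f p).1 `*` (f p).2))[].
- move=> p /hf[oA oB _ _]; rewrite openE => -[x y] [Ax By].
  by exists ((f p).1, (f p).2) => //=; split; exact: open_nbhs_nbhs.
- by move=> p /CW Wp; exists p => //; have [] := hf p Wp.
move=> D DW CD; exists (\bigcup_(p in [set` D]) ((f p).1 `*` (f p).2)); split => //.
- apply: fin_bigcup_measurable; first exact: finite_fset.
  move=> p pD; have [oA oB _ _] := hf p (set_mem (DW p pD)).
  by apply: measurableX; exact: open_borel.
- by move=> q [p pD]; have [_ _ _] := hf p (set_mem (DW p pD)); apply.
Qed.

(* The product of the Borel sigma-algebras may be smaller than the Borel
   sigma-algebra of [X * X] when [X] is not second countable; by
   sigma-compactness the superlevel sets of a continuous function are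
   nevertheless countable unions of finite unions of open rectangles. *)
Lemma continuous_prod_measurable (R : realType) (X : ptopologicalType) (m : X * X -> R) :
  sigma_compact X -> continuous m ->
  measurable_fun [set: borel X * borel X] (m : borel X * borel X -> R).
Proof.
move=> [Kc [cK KX]] cm.
apply: (measurability _ (measurable_realfun.RGenOInfty.measurableE R)).
move=> _ [_ [a ->] <-]; rewrite setTI.
pose W := m @^-1` `]a, +oo[.
have oW : open W by apply: (open_comp (f := m)) => [x _|]; [exact: cm|exact: interval_open].
pose C n k l := (Kc k `*` Kc l) `&` m @^-1` `[a + n.+1%:R^-1, +oo[.
have [P hP] : exists P : nat -> nat -> nat -> set (borel X * borel X),
    forall n k l, [/\ measurable (P n k l), C n k l `<=` P n k l & P n k l `<=` W].
  suff h n k l : exists P : set (borel X * borel X),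
      [/\ measurable P, C n k l `<=` P & P `<=` W].
    by exists (fun n k l => projT1 (cid (h n k l))) => n k l; exact: projT2 (cid (h n k l)).
  apply: open_rect_cover => //.
    apply: compact_closedI; first exact: compact_setX.
    by apply: (closed_comp (f := m)) => [x _|]; [exact: cm|exact: interval_closed].
  move=> p [_ /=]; rewrite /W /= !in_itv /= !andbT; apply: lt_le_trans.
  by rewrite ltrDl invr_gt0 ltr0n.
have -> : m @^-1` `]a, +oo[ = \bigcup_n \bigcup_k \bigcup_l P n k l.
  apply/seteqP; split => [p Wp|p [n _ [k _ [l _]]]]; last by have [_ _] := hP n k l; apply.
  have d0 : 0 < m p - a by rewrite subr_gt0; move: Wp; rewrite /= in_itv /= andbT.
  have /cvgrPdist_lt/(_ _ d0)[n _ /(_ n (leqnn n))] := @cvg_harmonic R.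
  rewrite /= sub0r normrN ger0_norm ?invr_ge0 ?ler0n // => hn.
  have [k _ kp] : (\bigcup_k Kc k) p.1 by rewrite KX.
  have [l _ lp] : (\bigcup_k Kc k) p.2 by rewrite KX.
  exists n => //; exists k => //; exists l => //.
  have [_ CP _] := hP n k l; apply: CP; split => //=.
  by rewrite in_itv /= andbT -lerBrDl ltW.
apply: bigcup_measurable => n _; apply: bigcup_measurable => k _.
by apply: bigcup_measurable => l _; have [] := hP n k l.
Qed.

Lemma sigma_compact_sigma_finite (R : realType) (X : ptopologicalType)
    (mu : {measure set (borel X) -> \bar R}) :
  hausdorff_space X -> sigma_compact X -> radon_measure mu -> sigma_finite [set: borel X] mu.
Proof.
move=> hX [Kc [cK KX]] [fin _ _]; exists Kc => // k; split; last exact: fin.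
by apply: closed_borel; exact: compact_closed.
Qed.

(** * Kernels acting on weighted L^1 *)

Section KernelBounds.
Context (R : realType) d (T : measurableType d).
Variable mu : {measure set T -> \bar R}.
Variables (m : T -> T -> R) (z : T).
Hypothesis mu_sf : sigma_finite [set: T] mu.
Hypothesis mm : measurable_fun [set: T * T] (fun p => m p.1 p.2).
Hypothesis m1 : forall x y, 1 <= m x y.
Hypothesis m_sub : forall x y t, m x y <= m x t * m t y.
Local Open Scope complex_scope.
Let v y := m y z.

Let m0 x y : 0 <= m x y. Proof. exact: le_trans ler01 (m1 x y). Qed.

Lemma section_meas1 (f : T * T -> R) x : measurable_fun [set: T * T] f ->
  measurable_fun [set: T] (fun y => f (x, y)).
Proof. by move=> mf; apply: (measurableT_comp mf); exact: pair1_measurable. Qed.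

Lemma section_meas2 (f : T * T -> R) y : measurable_fun [set: T * T] f ->
  measurable_fun [set: T] (fun x => f (x, y)).
Proof. by move=> mf; apply: (measurableT_comp mf); exact: pair2_measurable. Qed.

Let mv : measurable_fun [set: T] v.
Proof. exact: (section_meas2 z mm). Qed.

Lemma wL1_kernel_bound (k : T -> T -> R) c : 0 <= c -> (forall x y, 0 <= k x y) ->
  measurable_fun [set: T * T] (fun p => k p.1 p.2) ->
  {ae mu, forall y, (\int[mu]_x (k x y * m x y)%:E <= c%:E)%E} ->
  kernel_bound mu k c (wL1 mu v) (wL1n mu v).
Proof.
move=> c0 k0 mk kc F LF; have v1 y : 1 <= v y by exact: m1.
have v0 y : 0 <= v y by exact: m0.
have mF := cmeas_rnorm LF.1.
have mkF : measurable_fun [set: T * T] (fun p => k p.1 p.2 * rnorm (F p.2)).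
  by apply: measurable_funM => //; apply: (measurableT_comp mF); exact: measurable_snd.
have [_ mI] := @tonelli_sigma _ _ _ mu (fun p => (k p.1 p.2 * rnorm (F p.2))%:E) mu_sf
  ((measurable_EFinP _ _).2 mkF) (fun p => mulr_ge0 (k0 _ _) (rnorm_ge0 _)).
pose I x := (\int[mu]_y (k x y * rnorm (F y))%:E)%E.
have I0 x : (0 <= I x)%E.
  by apply: integral_ge0 => y _; rewrite lee_fin mulr_ge0 ?rnorm_ge0.
have mkv : measurable_fun [set: T * T] (fun p => v p.1 * (k p.1 p.2 * rnorm (F p.2))).
  by apply: measurable_funM => //; apply: (measurableT_comp mv); exact: measurable_fst.
have kv0 p : 0 <= v p.1 * (k p.1 p.2 * rnorm (F p.2)) by rewrite !mulr_ge0 ?rnorm_ge0.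
have [tone _] := @tonelli_sigma _ _ _ mu (fun p => (v p.1 * (k p.1 p.2 * rnorm (F p.2)))%:E) mu_sf
  ((measurable_EFinP _ _).2 mkv) kv0.
have mk2 y : measurable_fun [set: T] (fun x => k x y) by exact: (section_meas2 y mk).
have mk1 x : measurable_fun [set: T] (fun y => k x y) by exact: (section_meas1 x mk).
have mm2 y : measurable_fun [set: T] (fun x => m x y) by exact: (section_meas2 y mm).
have Iv : (\int[mu]_x ((v x)%:E * I x) <= (c * wL1n mu v F)%:E)%E.
  have -> : (\int[mu]_x ((v x)%:E * I x) =
      \int[mu]_x \int[mu]_y (v x * (k x y * rnorm (F y)))%:E)%E.
    apply: eq_integral => x _; rewrite /I -(@nnintZ _ _ _ mu _ (fun y => k x y * rnorm (F y))).
    + by [].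
    + by apply: measurable_funM; [exact: mk1|exact: mF].
    + by move=> y; apply: mulr_ge0; [exact: k0|exact: rnorm_ge0].
    + exact: v0.
  rewrite tone EFinM -(wL1nE v1 LF) -(nnintZ mu (wL1_meas mv LF.1) (wL1_nn v1 F) c0).
  apply: ae_ge0_le_integral; first exact: measurableT.
  + by move=> y _; apply: integral_ge0 => x _; rewrite lee_fin; exact: (kv0 (x, y)).
  + have mkv' : measurable_fun [set: T * T] (fun p => v p.2 * (k p.2 p.1 * rnorm (F p.1))).
      apply: (measurableT_comp mkv (g := fun p => (p.2, p.1))).
      by apply: measurable_fun_pair; [exact: measurable_snd|exact: measurable_fst].
    exact: (@tonelli_sigma _ _ _ mu (fun p => (v p.2 * (k p.2 p.1 * rnorm (F p.1)))%:E) mu_sf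
      ((measurable_EFinP _ _).2 mkv') (fun p => kv0 (p.2, p.1))).2.
  + by move=> y _; rewrite lee_fin; apply: mulr_ge0; [exact: c0|exact: wL1_nn].
  + apply/measurable_EFinP; apply: measurable_funM; first exact: measurable_cst.
    exact: (wL1_meas mv LF.1).
  apply: filterS kc => y hy _.
  apply: (@le_trans _ _ (\int[mu]_x ((rnorm (F y) * v y) * (k x y * m x y))%:E)%E).
    apply: nnint_le.
    + apply: measurable_funM; first exact: mv.
      by apply: measurable_funM; [exact: mk2|exact: (measurable_cst (rnorm (F y)))].
    + apply: measurable_funM; first exact: measurable_cst.
      by apply: measurable_funM; [exact: mk2|exact: mm2].
    + by move=> x; exact: (kv0 (x, y)).
    apply: aeW => x; have := m_sub x z y; rewrite -/(v x) -/(v y) => h.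
    have kF : 0 <= k x y * rnorm (F y) by rewrite mulr_ge0 ?rnorm_ge0.
    apply: le_trans (ler_wpM2r kF h) _.
    by rewrite le_eqVlt; apply/orP; left; apply/eqP; ring.
  rewrite (@nnintZ _ _ _ mu _ (fun x => k x y * m x y)); last exact: (wL1_nn v1 F).
  + rewrite [leRHS]EFinM muleC; apply: lee_wpmul2r; last exact: hy.
    by rewrite lee_fin; exact: (wL1_nn v1 F).
  + by apply: measurable_funM; [exact: mk2|exact: mm2].
  + by move=> x; apply: mulr_ge0; [exact: k0|exact: m0].
have mI' : measurable_fun [set: T] I by exact: mI.
have m_v : measurable_fun [set: T] (fun x => (v x)%:E) by apply/measurable_EFinP; exact: mv.
clear tone mI mkv kv0 mkF.
have mvI : measurable_fun [set: T] (fun x => (v x)%:E * I x)%E.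
  by apply: emeasurable_funM; [exact: m_v|exact: mI'].
have vI0 x : (0 <= (v x)%:E * I x)%E by apply: mule_ge0; [rewrite lee_fin; exact: v0|exact: I0].
have If : {ae mu, forall x, I x \is a fin_num}.
  have ivI : mu.-integrable [set: T] (fun x => (v x)%:E * I x)%E.
    apply/integrableP; split; first exact: mvI.
    under eq_integral => x _ do rewrite (gee0_abs (vI0 x)).
    by apply: le_lt_trans Iv _; exact: ltry.
  apply: filterS (integrable_ae measurableT ivI) => x /(_ Logic.I).
  rewrite !ge0_fin_numE; [|exact: I0|exact: vI0]; apply: contraTT; rewrite -!leNgt !leye_eq => /eqP ->.
  by rewrite gt0_muley // lte_fin (lt_le_trans ltr01).
(* The integral [I x] is finite almost everywhere because [v >= 1]; on the exceptional null set
   [fine] returns 0. *)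
exists (fun x => fine (I x)).
have G0 x : 0 <= fine (I x) by exact: fine_ge0 (I0 x).
have mG : cmeasurable (fun x => (fine (I x))%:C).
  by apply: cmeas_real; apply: (measurableT_comp (fine_measurable measurableT) mI').
have Gle : (\int[mu]_x (rnorm ((fine (I x))%:C) * v x)%:E <= (c * wL1n mu v F)%:E)%E.
  apply: le_trans Iv; apply: ge0_le_integral; first exact: measurableT.
  - by move=> x _; rewrite lee_fin; exact: (mulr_ge0 (rnorm_ge0 _) (v0 x)).
  - by apply/measurable_EFinP; exact: (wL1_meas mv mG).
  - exact: mvI.
  - move=> x _; rewrite rnormC (ger0_norm (G0 x)) mulrC EFinM.
    apply: lee_wpmul2l; first by rewrite lee_fin.
    by have := I0 x; case: (I x) => [r|//|//] _ /=; rewrite ?leey.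
have [LG nG] := wL1n_le v1 mG Gle.
split; [exact: G0|exact: LG|exact: nG|].
by apply: filterS If => x h; rewrite fineK.
Qed.
End KernelBounds.

(* [filterS] for [ae], also usable when [T] is only convertible to the carrier
   of the sigma-algebra, as for functions on [X] and measures on [borel X]. *)
Lemma ae_mono (R : realType) d (T : measurableType d) (mu : {measure set T -> \bar R})
    (P Q : T -> Prop) : (forall x, P x -> Q x) -> {ae mu, forall x, P x} -> {ae mu, forall x, Q x}.
Proof. exact: filterS. Qed.

Lemma limn_einf_rnorm (R : realType) (u : nat -> R[i]) (a b : R[i]) :
  rnorm (u k - a) @[k --> \oo] --> (0 : R) ->
  (rnorm (a - b))%:E = limn_einf (fun k => (rnorm (u k - b))%:E).
Proof.
move=> ua; apply/esym.
have H : (rnorm (u k - b))%:E @[k --> \oo] --> (rnorm (a - b))%:E.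
  apply: cvg_EFin; first exact: nearW.
  apply/cvgrPdist_lt => r r0; have /cvgrPdist_lt/(_ r r0) := ua; apply: filterS => k.
  rewrite sub0r normrN ger0_norm ?rnorm_ge0 //; apply: le_lt_trans.
  by apply: le_trans (rnorm_distdist _ _) _; rewrite opprB addrA subrK rnorm_distC.
by rewrite (cvg_limn_einf_sup H).1.
Qed.

(** * Banach function spaces with property (Y1) *)

Section FunctionSpace.
Context (R : realType) (X : ptopologicalType) (mu : {measure set (borel X) -> \bar R}).
Variables (Y : set (X -> R[i])) (nY : (X -> R[i]) -> R).
Hypothesis X_hausdorff : hausdorff_space X.
Hypothesis X_sc : sigma_compact X.
Hypothesis Y_1 : property_Y1 mu Y nY.
Local Open Scope complex_scope.

Let YB := Y1_complete Y_1.

Let Ymeas F : Y F -> cmeasurable (F : borel X -> R[i]).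
Proof. by move=> /(Y1_L1loc Y_1)[]. Qed.

Lemma compact_borel (A : set X) : compact A -> measurable (A : set (borel X)).
Proof. by move=> cA; apply: closed_borel; exact: compact_closed. Qed.

(** Local integrability of [F] is inherited from [G], so a measurable dominated function qualifies
    for solidity. *)
Let Ysolid F G : cmeasurable (F : borel X -> R[i]) -> Y G ->
  {ae mu, forall x, rnorm (F x) <= rnorm (G x)} -> Y F /\ nY F <= nY G.
Proof.
move=> mF YG FG; apply: (Y1_solid Y_1) => //; split => // A cA.
have [mG hG] := Y1_L1loc Y_1 YG; apply: le_lt_trans (hG A cA).
apply: ae_ge0_le_integral; first exact: compact_borel.
- by move=> x _; rewrite lee_fin rnorm_ge0.
- by apply/measurable_EFinP; apply: (measurable_funS measurableT) (cmeas_rnorm mF).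
- by move=> x _; rewrite lee_fin rnorm_ge0.
- by apply/measurable_EFinP; apply: (measurable_funS measurableT) (cmeas_rnorm mG).
- by apply: filterS FG => x h _; rewrite lee_fin.
Qed.

(* A norm limit agrees almost everywhere with a pointwise limit: the embedding
   into [L^1_loc] and Fatou's lemma bound their distance on compact sets. *)
Let Yfatou (u : nat -> X -> R[i]) F : (forall k, Y (u k)) ->
  (forall eps, 0 < eps -> exists N, forall j k,
    (N <= j)%N -> (N <= k)%N -> nY (u j - u k) < eps) ->
  (forall x, rnorm (u k x - F x) @[k --> \oo] --> (0 : R)) ->
  Y F /\ nY (u k - F) @[k --> \oo] --> (0 : R).
Proof.
move=> Yu uC uF; have [L YL uL] := csn_complete YB Yu uC.
have mF : cmeasurable (F : borel X -> R[i]) by apply: (@cmeas_lim _ _ (borel X) u F _ uF) => k; exact: Ymeas.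
have mL := Ymeas YL.
have onK (A : set X) : compact A -> {ae mu, forall x, A x -> F x = L x}.
  move=> cA; have mA := compact_borel cA; have [c hc] := Y1_embedding Y_1 cA.
  have mD G : cmeasurable (G : borel X -> R[i]) ->
      measurable_fun (A : set (borel X)) (fun x => (rnorm (G x))%:E).
    by move=> mG; apply/measurable_EFinP; apply: (measurable_funS measurableT) (cmeas_rnorm mG).
  have h0 : (\int[mu]_(x in A) (rnorm (F x - L x))%:E <= 0)%E.
    apply/lee_addgt0Pr => e e0; rewrite add0e.
    have -> : (\int[mu]_(x in A) (rnorm (F x - L x))%:E =
        \int[mu]_(x in A) limn_einf (fun k => (rnorm (u k x - L x))%:E))%E.
      by apply: eq_integral => x _; exact: limn_einf_rnorm.
    apply: le_trans (fatou mu mA _ _) _.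
    + by move=> k; apply: mD; apply: cmeasB => //; exact: Ymeas.
    + by move=> k x _; rewrite lee_fin rnorm_ge0.
    apply: limn_einf_le; have c1 : 0 < `|c| + 1 by rewrite ltr_wpDl.
    have /cvgrPdist_lt/(_ (e / (`|c| + 1))) := uL; rewrite divr_gt0 // => /(_ isT).
    apply: filterS => k; rewrite sub0r normrN => hk.
    have YD : Y (u k - L) := csnB YB (Yu k) YL.
    apply: le_trans (hc _ YD) _; rewrite lee_fin.
    apply: (@le_trans _ _ ((`|c| + 1) * `|nY (u k - L)|)); last first.
      by rewrite mulrC -ler_pdivlMr // ltW.
    have n0 : 0 <= nY (u k - L) := csn_ge0 YB YD; rewrite (ger0_norm n0).
    have cc : c <= `|c| + 1 by rewrite (le_trans (ler_norm c)) // lerDl.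
    exact: (ler_wpM2r n0 cc).
  have mFL := mD _ (cmeasB mF mL).
  have h1 : (\int[mu]_(x in A) `|(rnorm (F x - L x))%:E| = 0)%E.
    apply/eqP; rewrite eq_le integral_ge0 ?andbT //.
    apply: le_trans h0; rewrite le_eqVlt; apply/orP; left; apply/eqP.
    by apply: eq_integral => x _; rewrite gee0_abs // lee_fin rnorm_ge0.
  have := (ae_eq_integral_abs mu mA mFL).1 h1; apply: filterS => x h /h /= [] /rnorm0_eq0/eqP.
  by rewrite subr_eq0 => /eqP.
have FL : {ae mu, forall x, F x = L x}.
  have [Kc [cK KX]] := X_sc.
  have := ae_foralln (fun k => onK _ (cK k)); apply: filterS => x h.
  by have [k _ /h] : (\bigcup_k Kc k) x by rewrite KX.
have YF : Y F by apply: (Ysolid mF YL _).1; apply: ae_mono FL => x ->.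
split => //.
have -> // : (fun k => nY (u k - F)) = (fun k => nY (u k - L)).
apply/funext => k; have mu' := Ymeas (Yu k); apply/eqP; rewrite eq_le; apply/andP; split.
  apply: (Ysolid _ _ _).2; [exact: cmeasB|exact: (csnB YB)|].
  by apply: ae_mono FL => x h; rewrite [(u k - F) x]/(u k x - F x) h.
apply: (Ysolid _ _ _).2; [exact: cmeasB|exact: (csnB YB)|].
by apply: ae_mono FL => x h; rewrite [(u k - F) x]/(u k x - F x) h.
Qed.

Lemma Y1_solid_space : solid_space mu Y nY.
Proof.
split.
- exact: (csn_zero YB).
- exact: (csn_linear YB).
- exact: (csn_ge0 YB).
- exact: (csn_scale YB).
- exact: (csn_triangle YB).
- exact: Ymeas.
- exact: Ysolid.
- exact: (Y1_definite Y_1).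
- exact: Yfatou.
Qed.
End FunctionSpace.

(** * Kernels of the algebra [Am] *)

Section AdmissibleKernels.
Context (R : realType) (X : ptopologicalType) (mu : {measure set (borel X) -> \bar R}).
Variable m : X -> X -> R.
Hypothesis m_adm : admissible_weight m.
Hypothesis X_hausdorff : hausdorff_space X.
Hypothesis X_sc : sigma_compact X.
Hypothesis mu_radon : radon_measure mu.
Local Open Scope complex_scope.

Let m1 x y : 1 <= m x y. Proof. by have [_ h] := m_adm. Qed.
Let m_sub x y t : m x y <= m x t * m t y. Proof. by have [_ _ h] := m_adm. Qed.
Let m_sym x y : m x y = m y x. Proof. by have [_ _ _ h] := m_adm. Qed.
Let m_gt0 x y : 0 < m x y. Proof. exact: lt_le_trans ltr01 (m1 x y). Qed.
Let m_ge0 x y : 0 <= m x y. Proof. exact: ltW. Qed.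

Lemma weight_meas : measurable_fun [set: borel X * borel X] (fun p => m p.1 p.2).
Proof. by have [cm _ _ _ _] := m_adm; exact: (continuous_prod_measurable X_sc cm). Qed.

Lemma weight_inv_meas : measurable_fun [set: borel X * borel X] (fun p => (m p.1 p.2)^-1).
Proof.
have [cm _ _ _ _] := m_adm; apply: continuous_prod_measurable => // p.
by apply: cvgV; [rewrite gt_eqF|exact: cm].
Qed.

Lemma Am_normP (k : X -> X -> R[i]) c : (Am_norm mu m k <= c)%E <->
  {ae mu, forall x : borel X, (\int[mu]_y (rnorm (k x y) * m x y)%:E <= c)%E} /\
  {ae mu, forall y : borel X, (\int[mu]_x (rnorm (k x y) * m x y)%:E <= c)%E}.
Proof.
have E x y : rnorm (weighted m k x y) = rnorm (k x y) * m x y.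
  by rewrite /weighted rnormM rnormC ger0_norm.
rewrite /Am_norm /A1_norm ge_max.
have -> : (fun x : borel X => \int[mu]_y (rnorm (weighted m k x y))%:E)%E =
    (fun x : borel X => \int[mu]_y (rnorm (k x y) * m x y)%:E)%E.
  by apply/funext => x; apply: eq_integral => y _; rewrite E.
have -> : (fun y : borel X => \int[mu]_x (rnorm (weighted m k x y))%:E)%E =
    (fun y : borel X => \int[mu]_x (rnorm (k x y) * m x y)%:E)%E.
  by apply/funext => y; apply: eq_integral => x _; rewrite E.
split; first by move=> /andP[/ess_supP h1 /ess_supP h2].
by move=> [h1 h2]; apply/andP; split; apply/ess_supP.
Qed.

(* Nonnegative kernels of [A_m] of norm at most [c]. *)
Record am_bound (k : X -> X -> R) (c : R) : Prop := {
  am_ge0 : forall x y, 0 <= k x y;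
  am_meas : measurable_fun [set: borel X * borel X] (fun p => k p.1 p.2);
  am_row : {ae mu, forall x : borel X, (\int[mu]_y (k x y * m x y)%:E <= c%:E)%E};
  am_col : {ae mu, forall y : borel X, (\int[mu]_x (k x y * m x y)%:E <= c%:E)%E} }.

Lemma am_bound_T k c : am_bound k c -> am_bound (fun x y => k y x) c.
Proof.
move=> [k0 mk kr kc]; split => //.
- apply: (measurableT_comp mk (g := fun p => (p.2, p.1))).
  by apply: measurable_fun_pair; [exact: measurable_snd|exact: measurable_fst].
- by apply: filterS kc => x; under eq_integral do rewrite m_sym.
- by apply: filterS kr => x; under eq_integral do rewrite m_sym.
Qed.

(** Membership in [Am] speaks of the weighted kernel; dividing by the weight recovers [k]. *)
Lemma Am_meas k : Am mu m k -> cmeasurable (fun p : borel X * borel X => k p.1 p.2).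
Proof.
move=> [mk _].
have -> : (fun p : borel X * borel X => k p.1 p.2) =
    (fun p : borel X * borel X => weighted m k p.1 p.2 * ((m p.1 p.2)^-1)%:C).
  apply/funext => p; rewrite /weighted -mulrA -rmorphM /= mulfV ?gt_eqF //.
  by rewrite rmorph1 mulr1.
by apply: cmeasM => //; apply: cmeas_real; exact: weight_inv_meas.
Qed.

(** An essential supremum for the zero measure would be [-oo], hence the assumption on [mu]. *)
Lemma Am_norm_ge0 k : mu [set: borel X] != 0%E -> (0 <= Am_norm mu m k)%E.
Proof.
move=> mu0; rewrite /Am_norm /A1_norm le_max; apply/orP; left.
apply: ess_sup_gee; first by rewrite lt_neqAle eq_sym mu0 measure_ge0.
by apply: aeW => x; apply: integral_ge0 => y _; rewrite lee_fin rnorm_ge0.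
Qed.

Lemma Am_am_bound k : mu [set: borel X] != 0%E -> Am mu m k ->
  am_bound (fun x y => rnorm (k x y)) (fine (Am_norm mu m k)).
Proof.
move=> mu0 Ak; have [_ fin] := Ak; have k0 := Am_norm_ge0 k mu0.
have fE : (fine (Am_norm mu m k))%:E = Am_norm mu m k by rewrite fineK // ge0_fin_numE.
have /Am_normP[h1 h2] := lexx (Am_norm mu m k).
split => //.
- by move=> x y; exact: rnorm_ge0.
- by have := cmeas_rnorm (Am_meas Ak).
- by rewrite fE.
- by rewrite fE.
Qed.

Lemma am_bound_Am k c : am_bound k c ->
  Am mu m (fun x y => (k x y)%:C) /\ (Am_norm mu m (fun x y => (k x y)%:C) <= c%:E)%E.
Proof.
move=> [k0 mk kr kc]; have E x y : rnorm ((k x y)%:C : R[i]) * m x y = k x y * m x y.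
  by rewrite rnormC ger0_norm.
have h : (Am_norm mu m (fun x y => (k x y)%:C) <= c%:E)%E.
  apply/Am_normP; split.
    by apply: filterS kr => x h; under eq_integral => y _ do rewrite E.
  by apply: filterS kc => y h; under eq_integral => x _ do rewrite E.
split => //; split; last by apply: le_lt_trans h _; exact: ltry.
apply: cmeasM; apply: cmeas_real; [exact: mk|exact: weight_meas].
Qed.

Lemma am_bound_wL1 k c z : 0 <= c -> am_bound k c ->
  kernel_bound mu k c (wL1 mu (m^~ z)) (wL1n mu (m^~ z)).
Proof.
move=> c0 [k0 mk _ kc]; apply: wL1_kernel_bound => //.
- exact: sigma_compact_sigma_finite.
- exact: weight_meas.
Qed.

Variables (Y : set (X -> R[i])) (nY : (X -> R[i]) -> R).
Hypothesis Y_1 : property_Y1 mu Y nY.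
Hypothesis Y_2 : property_Y2 mu m Y nY.
Let YS := Y1_solid_space X_hausdorff X_sc Y_1.

(** Property (Y2) is applied to [|F|] and a nonnegative kernel. Its integrability clause makes the
    real-valued integral agree almost everywhere with the extended one. *)
Lemma am_bound_Y k c : 0 <= c -> am_bound k c -> kernel_bound mu k c Y nY.
Proof.
move=> c0 kb F YF; have [Ak nk] := am_bound_Am kb; have k0 := am_ge0 kb.
have [YaF naF] := ss_abs YS YF; have [ii YG nG] := Y_2 Ak YaF.
have E x : (fun y => (rnorm (F y))%:C * (k x y)%:C) = (fun y => (rnorm (F y) * k x y)%:C).
  by apply/funext => y; rewrite -rmorphM.
pose G (x : borel X) := (\int[mu]_y (rnorm (F y) * k x y))%R.
have GE : kernel_op mu (fun x y => (k x y)%:C) (fun y => (rnorm (F y))%:C) =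
    (fun x => (G x)%:C).
  by apply/funext => x; rewrite /kernel_op E cintegral_real.
rewrite GE in YG nG; exists G; split => //.
- move=> x; apply: fine_ge0; apply: integral_ge0 => y _.
  by rewrite lee_fin mulr_ge0 ?rnorm_ge0.
- rewrite -lee_fin; apply: le_trans nG _; rewrite [leRHS]EFinM.
  apply: le_trans (_ : (c%:E * (nY (fun y => (rnorm (F y))%:C))%:E <= _)%E).
    by rewrite lee_wpmul2r // lee_fin (ss_ge0 YS).
  by rewrite lee_wpmul2l ?lee_fin.
- apply: ae_mono ii => x; rewrite E => -[/= i1 _].
  rewrite /G /Rintegral fineK ?integrable_fin_num //.
  by under eq_integral do rewrite mulrC.
Qed.
End AdmissibleKernels.

(** * Moderate coverings *)

Section CoveringInstances.
Context (R : realType) (X : ptopologicalType) (mu : {measure set (borel X) -> \bar R}).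
Variable m : X -> X -> R.
Hypothesis m_adm : admissible_weight m.
Hypothesis X_hausdorff : hausdorff_space X.
Hypothesis X_sc : sigma_compact X.
Hypothesis mu_radon : radon_measure mu.
Local Open Scope complex_scope.

Let m1 x y : 1 <= m x y. Proof. by have [_ h] := m_adm. Qed.
Let m_sub x y t : m x y <= m x t * m t y. Proof. by have [_ _ h] := m_adm. Qed.
Let m_sym x y : m x y = m y x. Proof. by have [_ _ _ h] := m_adm. Qed.
Let m_ge0 x y : 0 <= m x y. Proof. exact: le_trans ler01 (m1 x y). Qed.

(** Finiteness of the masses comes from compact closures and the Radon property. All members
    containing [y] meet one fixed member through [y], so the overlap bound counts them. *)
Lemma covering_mass (I : countType) (U : I -> set X) : moderate_admissible_covering mu U ->
  exists (D : R) (N : nat), [/\ 0 < D, forall i, measurable (U i : set (borel X)),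
    forall i, mu (U i) = (fine (mu (U i)))%:E /\ D <= fine (mu (U i)),
    forall y, exists i, U i y &
    forall y, finite_set [set i | U i y] /\ (#|` fset_set [set i | U i y]| <= N)%N].
Proof.
move=> [[mU pU _ covU [N ovU]] [D D0 hD] _]; exists D, N.
have Ufin i : (mu (U i) < +oo)%E.
  have cU : compact (closure (U i)) by rewrite -precompactE.
  have [fin _ _] := mu_radon; apply: le_lt_trans (fin _ cU).
  apply: le_measure; rewrite ?inE; [exact: mU|exact: compact_borel|exact: subset_closure].
have UE i : mu (U i) = (fine (mu (U i)))%:E.
  by rewrite fineK // ge0_fin_numE.
have cov y : exists i, U i y.
  by have [i _ Ui] : (\bigcup_i U i) y by [rewrite covU]; exists i.
split => //.
- by move=> i; split => //; rewrite -lee_fin -UE.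
- move=> y; have [j Uj] := cov y.
  have h : ([set i | U i y] #<= `I_N)%card.
    apply: card_le_trans (ovU j); apply: subset_card_le => i Ui.
    by exists y.
  by split; [apply/finite_set_leP; exists N|exact: geq_card_fset_set].
Qed.

Lemma rect_am_bound (A B : set X) (c M a b : R) :
  measurable (A : set (borel X)) -> measurable (B : set (borel X)) ->
  mu A = a%:E -> mu B = b%:E -> 0 <= c -> 0 <= M ->
  (forall x y, A x -> B y -> m x y <= M) ->
  am_bound mu m (fun x y => c * \1_A x * \1_B y) (c * M * Num.max a b).
Proof.
move=> mA mB Aa Bb c0 M0 hM.
have mind (C : set (borel X)) : measurable C ->
    measurable_fun [set: borel X] (\1_C : borel X -> R).
  by move=> mC; exact: measurable_indic.
have i0 (C : set X) x : 0 <= \1_C x :> R by rewrite indicE ler0n.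
have intC (C : set (borel X)) e r : measurable C -> mu C = e%:E -> 0 <= r ->
    (\int[mu]_x (r * \1_C x)%:E = (r * e)%:E)%E.
  move=> mC Ce r0; rewrite (nnintZ mu (mind C mC) (i0 C) r0).
  by rewrite integral_indic // setIT Ce EFinM.
have pw x y : c * \1_A x * \1_B y * m x y <= c * M * \1_A x /\
              c * \1_A x * \1_B y * m x y <= c * M * \1_B y.
  have r0 : 0 <= c * M by rewrite mulr_ge0.
  rewrite !indicE; have [xA|xA] := boolP (x \in A); last first.
    by rewrite /= !mulr0 !mul0r mulr_ge0 ?ler0n.
  have [yB|yB] := boolP (y \in B); last by rewrite /= !mulr0 !mul0r mulr1.
  by rewrite /= !mulr1 ler_wpM2l // hM //; exact: set_mem.
have mm1 x : measurable_fun [set: borel X] (fun y : borel X => m x y).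
  exact: (@section_meas1 _ _ (borel X) (fun p => m p.1 p.2) x (weight_meas m_adm X_sc)).
have mm2 y : measurable_fun [set: borel X] (fun x : borel X => m x y).
  exact: (@section_meas2 _ _ (borel X) (fun p => m p.1 p.2) y (weight_meas m_adm X_sc)).
have k0 x y : 0 <= c * \1_A x * \1_B y by rewrite !mulr_ge0.
split => //.
- apply: measurable_funM; first apply: measurable_funM.
  + exact: measurable_cst.
  + by apply: (measurableT_comp (mind A mA)); exact: measurable_fst.
  + by apply: (measurableT_comp (mind B mB)); exact: measurable_snd.
- apply: aeW => x.
  apply: (@le_trans _ _ (\int[mu]_y (c * M * \1_B y)%:E)%E).
    apply: nnint_le.
    + apply: measurable_funM; last exact: mm1.
      by apply: measurable_funM; [exact: measurable_cst|exact: mind].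
    + by apply: measurable_funM; [exact: measurable_cst|exact: mind].
    + by move=> y; rewrite mulr_ge0.
    + by apply: aeW => y; exact: (pw x y).2.
  rewrite (intC B b) ?mulr_ge0 // lee_fin ler_wpM2l ?mulr_ge0 //.
  by rewrite le_max lexx orbT.
- apply: aeW => y.
  apply: (@le_trans _ _ (\int[mu]_x (c * M * \1_A x)%:E)%E).
    apply: nnint_le.
    + apply: measurable_funM; last exact: mm2.
      apply: measurable_funM; last exact: measurable_cst.
      by apply: measurable_funM; [exact: measurable_cst|exact: mind].
    + by apply: measurable_funM; [exact: measurable_cst|exact: mind].
    + by move=> x; rewrite mulr_ge0.
    + by apply: aeW => x; exact: (pw x y).1.
  rewrite (intC A a) ?mulr_ge0 // lee_fin ler_wpM2l ?mulr_ge0 //.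
  by rewrite le_max lexx.
Qed.

Section Space.
Variables (Y : set (X -> R[i])) (nY : (X -> R[i]) -> R).
Hypothesis Y_1 : property_Y1 mu Y nY.
Hypothesis Y_2 : property_Y2 mu m Y nY.
Let YS := Y1_solid_space X_hausdorff X_sc Y_1.

(* The rank one kernel [c * 1_A (x) 1_B] maps [|F|] to a multiple of [1_A]. *)
Lemma indic_bound (A B : set X) (c M a b r : R) (F : X -> R[i]) :
  measurable (A : set (borel X)) -> measurable (B : set (borel X)) ->
  mu A = a%:E -> mu B = b%:E -> 0 < c -> 0 <= M ->
  (forall x y, A x -> B y -> m x y <= M) -> Y F -> 0 < r ->
  (\int[mu]_t (rnorm (F t) * \1_B t)%:E = r%:E)%E ->
  Y (fun x => (\1_A x)%:C) /\
  c * r * nY (fun x => (\1_A x)%:C) <= c * M * Num.max a b * nY F.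
Proof.
move=> mA mB Aa Bb c0 M0 hM YF r0 rE.
have a0 : 0 <= a by rewrite -lee_fin -Aa.
have kb := rect_am_bound mA mB Aa Bb (ltW c0) M0 hM.
have k0 : 0 <= c * M * Num.max a b.
  by rewrite !mulr_ge0 ?(ltW c0) // le_max a0.
have [G [G0 YG nG hG]] := am_bound_Y m_adm X_hausdorff X_sc Y_1 Y_2 k0 kb YF.
have mF := cmeas_rnorm (ss_meas YS YF).
have mindB : measurable_fun [set: borel X] (\1_B : borel X -> R) by exact: measurable_indic.
have cr : 0 < c * r by rewrite mulr_gt0.
have hAG : {ae mu, forall x, rnorm ((\1_A x)%:C : R[i]) <= (c * r)^-1 * G x}.
  apply: ae_mono hG => x.
  have -> : (\int[mu]_y (c * \1_A x * \1_B y * rnorm (F y))%:E =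
      (c * \1_A x * r)%:E)%E.
    rewrite EFinM -rE -nnintZ.
    + by apply: eq_integral => y _; rewrite -mulrA [\1_B y * _]mulrC.
    + exact: measurable_funM.
    + by move=> y; rewrite mulr_ge0 ?rnorm_ge0 // indicE ler0n.
    + by rewrite mulr_ge0 ?(ltW c0) // indicE ler0n.
  rewrite lee_fin rnormC ger0_norm; last by rewrite indicE ler0n.
  by rewrite ler_pdivlMl // mulrAC.
have mAc : cmeasurable (fun x : borel X => (\1_A x)%:C : R[i]).
  by apply: cmeas_real; exact: measurable_indic.
have cri : 0 <= (c * r)^-1 by rewrite invr_ge0 ltW.
have [YA nA] := ss_realZ YS cri mAc YG hAG.
split => //; apply: le_trans (_ : nY (fun x => (G x)%:C) <= _) => //.
by rewrite mulrC -ler_pdivlMr // mulrC.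
Qed.

Variables (I : countType) (U : I -> set X) (z : X) (CmU D : R) (xs : I -> X).
Let mass i : R := fine (mu (U i)).
Hypothesis mU : forall i, measurable (U i : set (borel X)).
Hypothesis pU : forall i, compact (closure (U i)).
Hypothesis massE : forall i, mu (U i) = (mass i)%:E.
Hypothesis D0 : 0 < D.
Hypothesis massD : forall i, D <= mass i.
Hypothesis covU : forall y, exists i, U i y.
Hypothesis xsU : forall i, U i (xs i).
Hypothesis mCU : forall i x y, U i x -> U i y -> m x y <= CmU.
Let mass0 i : 0 < mass i. Proof. exact: lt_le_trans D0 (massD i). Qed.

Let CmU0 : 0 <= CmU.
Proof. by have [i Ui] := covU z; apply: le_trans (m_ge0 z z) (mCU Ui Ui). Qed.

Let mindU i : measurable_fun [set: borel X] (\1_(U i) : borel X -> R).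
Proof. exact: measurable_indic. Qed.

Let ind0 i x : 0 <= \1_(U i) x :> R. Proof. by rewrite indicE ler0n. Qed.

Lemma Y_local_fin F i : Y F -> exists2 r : R, 0 <= r &
  (\int[mu]_t (rnorm (F t) * \1_(U i) t)%:E = r%:E)%E.
Proof.
move=> YF; have mF := cmeas_rnorm (ss_meas YS YF).
have f0 t : 0 <= rnorm (F t) * \1_(U i) t by rewrite mulr_ge0 ?rnorm_ge0.
have Ffin : (\int[mu]_t (rnorm (F t) * \1_(U i) t)%:E < +oo)%E.
  have [_ hF] := Y1_L1loc Y_1 YF; have := hF _ (@pU i); apply: le_lt_trans.
  rewrite [leRHS]integral_mkcond; apply: ge0_le_integral; first exact: measurableT.
  - by move=> t _; rewrite lee_fin.
  - by apply/measurable_EFinP; exact: measurable_funM.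
  - apply/(measurable_restrictT _ (compact_borel X_hausdorff (@pU i))).
    by apply/measurable_EFinP; apply: (measurable_funS measurableT).
  - move=> t _; rewrite /patch indicE; have [tU|tU] := boolP (t \in U i).
      by rewrite mem_set ?mulr1 //; apply: subset_closure; exact: set_mem.
    by rewrite mulr0; case: ifP => _; rewrite lee_fin ?rnorm_ge0.
exists (fine (\int[mu]_t (rnorm (F t) * \1_(U i) t)%:E)%E).
  by apply: fine_ge0; apply: integral_ge0 => t _; rewrite lee_fin.
by rewrite fineK // ge0_fin_numE //; apply: integral_ge0 => t _; rewrite lee_fin.
Qed.

(** If every such integral vanished, a nontrivial [F] would be null on each member, hence almost
    everywhere, because [I] is countable. *)
Lemma Y_nonzero : exists F i r, [/\ Y F, 0 < r &
  (\int[mu]_t (rnorm (F t) * \1_(U i) t)%:E = r%:E)%E].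
Proof.
have [F YF nF0] := Y1_nontrivial Y_1; apply: contrapT => h; apply: nF0.
have mF := cmeas_rnorm (ss_meas YS YF).
have onU i : {ae mu, forall x, U i x -> F x = 0}.
  have [r r0 rE] := Y_local_fin i YF.
  have r00 : r = 0.
    by apply: contrapT => /eqP rn; apply: h; exists F, i, r; split => //; rewrite lt_neqAle eq_sym rn.
  have h1 : (\int[mu]_x `|(rnorm (F x) * \1_(U i) x)%:E| = 0)%E.
    rewrite -[RHS]/(0%:E) -r00 -rE; apply: eq_integral => x _.
    by rewrite gee0_abs // lee_fin mulr_ge0 ?rnorm_ge0.
  have mFi : measurable_fun [set: borel X] (fun x => (rnorm (F x) * \1_(U i) x)%:E).
    by apply/measurable_EFinP; exact: measurable_funM.
  have := (ae_eq_integral_abs mu measurableT mFi).1 h1; apply: ae_mono => x /(_ Logic.I) /= [] /eqP.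
  rewrite mulf_eq0 => /orP[/eqP/rnorm0_eq0 //|].
  by rewrite indicE => + Ux; rewrite mem_set // oner_eq0.
have : {ae mu, forall x, forall n i, choice.pickle i = n -> U i x -> F x = 0}.
  apply: (ae_foralln (mu := mu)) => n; case E : (choice.pickle_inv n : option I) => [i|].
    apply: ae_mono (onU i) => x hx j jn; suff -> : j = i by [].
    by move: E; rewrite -jn choice.pickleK_inv => -[].
  apply: aeW => x j jn; move: E; rewrite -jn choice.pickleK_inv.
  done.
apply: ae_mono => x hx; have [i Ui] := covU x.
exact: (hx _ i erefl).
Qed.

(** A rank one kernel carries mass from a member where some [F] is nonzero to [U j]. The weight is
    bounded on the product of the two members by passing through their sampling points. *)
Lemma Y_indic j : Y (fun y => (\1_(U j) y)%:C).
Proof.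
have [F [i [r [YF r0 rE]]]] := Y_nonzero.
apply: (indic_bound (mU j) (mU i) (massE j) (massE i) ltr01 _ _ YF r0 rE).1.
  exact: (mulr_ge0 (mulr_ge0 CmU0 (m_ge0 (xs j) (xs i))) CmU0).
move=> x y Ux Uy; apply: le_trans (m_sub x y (xs i)) _.
apply: ler_pM => //; last exact: mCU (xsU i) Uy.
apply: le_trans (m_sub x (xs i) (xs j)) _; apply: ler_pM => //.
exact: mCU Ux (xsU j).
Qed.

(** A fixed member [U j] around [z] is the yardstick: the rank one kernel from [U i] to [U j] turns
    the integral of [|F|] over [U i] into a multiple of one indicator, whose norm is positive
    because [U j] has positive measure. *)
Lemma Y_avg : exists2 C : R, 0 <= C & forall F i y, Y F -> U i y ->
  (\int[mu]_t (rnorm (F t) * \1_(U i) t)%:E <= (C * nY F * mass i * m y z)%:E)%E.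
Proof.
have [j Uj] := covU z; pose A := nY (fun y => (\1_(U j) y)%:C).
have A0 : 0 < A.
  rewrite lt_neqAle (ss_ge0 YS) ?andbT; last exact: Y_indic.
  apply/eqP => A0; have A00 : nY (fun y => (\1_(U j) y)%:C) = 0 by [].
  have ae0 := ss_definite YS (Y_indic j) A00.
  have : mu (U j) = 0%E.
    apply/negligibleP; first exact: mU.
    apply: negligibleS ae0 => y Uy /=; rewrite indicE mem_set //= => /eqP.
    by rewrite oner_eq0.
  by rewrite massE => -[/eqP]; rewrite gt_eqF.
(* From [s] in [U j] to [t] in [U i] the weight is followed through [xs j], [z] and [y]; only the
   leg between [z] and [y] is not bounded by a constant. *)
pose M0 := CmU * m (xs j) z * CmU.
have M00 : 0 <= M0 by rewrite /M0 !mulr_ge0.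
have q0 : 0 <= mass j / D + 1 by rewrite addr_ge0 // divr_ge0 // ltW.
exists (M0 * (mass j / D + 1) / A); first by rewrite divr_ge0 ?(ltW A0) // mulr_ge0.
move=> F i y YF Uy; have [r r0 rE] := Y_local_fin i YF; rewrite rE lee_fin.
have nF := ss_ge0 YS YF; have mi := mass0 i.
have [r00|rn] := eqVneq r 0.
  rewrite r00; apply: mulr_ge0 => //; apply: mulr_ge0; last exact: ltW.
  by apply: mulr_ge0 => //; rewrite divr_ge0 ?(ltW A0) // mulr_ge0.
have rp : 0 < r by rewrite lt_neqAle eq_sym rn.
have hM s t : U j s -> U i t -> m s t <= M0 * m y z.
  move=> Us Ut; apply: le_trans (m_sub s t (xs j)) _.
  rewrite /M0 -!mulrA; apply: ler_pM => //; first exact: mCU Us (xsU j).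
  apply: le_trans (m_sub (xs j) t z) _; apply: ler_pM => //.
  apply: le_trans (m_sub z t y) _; rewrite mulrC; apply: ler_pM => //; first exact: mCU Uy Ut.
  by rewrite m_sym.
have mi0 : 0 < (mass i)^-1 by rewrite invr_gt0.
have [_] := indic_bound (mU j) (mU i) (massE j) (massE i) mi0 (mulr_ge0 M00 (m_ge0 y z)) hM YF rp rE.
rewrite -/A -!mulrA ler_pM2l ?invr_gt0 // !mulrA => h.
(* Since [mass i >= D], [mass j] is at most [mass i * (mass j / D)]; the added 1 takes care of
   [mass i]. *)
have hmax : Num.max (mass j) (mass i) <= mass i * (mass j / D + 1).
  have jD : 0 <= mass j / D by rewrite divr_ge0 // ltW.
  rewrite ge_max mulrDr mulr1 lerDr mulr_ge0 ?(ltW mi) // andbT.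
  have e : mass j = mass j / D * D by rewrite divfK // lt0r_neq0.
  by rewrite {1}e [mass i * _]mulrC; apply: ler_wpDr; [exact: ltW|exact: ler_wpM2l].
rewrite -ler_pdivlMr // in h; apply: le_trans h _.
rewrite -!mulrA [A^-1 * _]mulrC !mulrA ler_wpM2r ?invr_ge0 ?(ltW A0) //.
apply: le_trans (_ : M0 * m y z * (mass i * (mass j / D + 1)) * nY F <= _).
  by apply: ler_wpM2r => //; apply: ler_wpM2l => //; exact: mulr_ge0.
by rewrite /M0 le_eqVlt; apply/orP; left; apply/eqP; ring.
Qed.

Lemma Y_core_space (K : X -> X -> R[i]) (o : X -> X -> R) (nR dl : R) :
  0 <= nR -> 0 <= dl -> am_bound mu m (fun x y => rnorm (K x y)) nR -> am_bound mu m o dl ->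
  core_space mu U (m^~ z) K o mass nR dl Y nY.
Proof.
move=> nR0 dl0 bK bo; split.
- exact: YS.
- exact: am_bound_Y bK.
- exact: am_bound_Y bo.
- exact: (am_bound_Y _ _ _ _ _ _ (am_bound_T m_adm bo)).
- exact: Y_avg.
- exact: Y_indic.
Qed.
End Space.

Section WeightedL1Space.
Variables (I : countType) (U : I -> set X) (z : X) (CmU D : R) (xs : I -> X).
Let mass i : R := fine (mu (U i)).
Hypothesis mU : forall i, measurable (U i : set (borel X)).
Hypothesis massE : forall i, mu (U i) = (mass i)%:E.
Hypothesis D0 : 0 < D.
Hypothesis massD : forall i, D <= mass i.
Hypothesis covU : forall y, exists i, U i y.
Hypothesis xsU : forall i, U i (xs i).
Hypothesis mCU : forall i x y, U i x -> U i y -> m x y <= CmU.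
Let mass0 i : 0 < mass i. Proof. exact: lt_le_trans D0 (massD i). Qed.

Lemma CmU_ge1 : 1 <= CmU.
Proof. by have [i Ui] := covU z; apply: le_trans (m1 z z) (mCU Ui Ui). Qed.

Lemma weight_moderate i y y' : U i y -> U i y' -> m y z <= CmU * m y' z.
Proof.
move=> Uy Uy'; apply: le_trans (m_sub y z y') _.
by apply: ler_wpM2r; [exact: m_ge0|exact: mCU Uy Uy'].
Qed.

Lemma weight_meas1 : measurable_fun [set: borel X] (fun y : borel X => m y z).
Proof. exact: (@section_meas2 _ _ (borel X) (fun p => m p.1 p.2) z (weight_meas m_adm X_sc)). Qed.

(** The test space satisfies the same interface as [Y]; local averages are controlled because
    [v >= 1] and masses are at least [D], indicators because [v] is bounded on each member. *)
Lemma wL1_core_space (K : X -> X -> R[i]) (o : X -> X -> R) (nR dl : R) :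
  0 <= nR -> 0 <= dl -> am_bound mu m (fun x y => rnorm (K x y)) nR -> am_bound mu m o dl ->
  core_space mu U (m^~ z) K o mass nR dl (wL1 mu (m^~ z)) (wL1n mu (m^~ z)).
Proof.
move=> nR0 dl0 bK bo; pose v : borel X -> R := m^~ z.
have v1 (y : borel X) : 1 <= v y by exact: m1.
have v0 y : 0 <= m y z by exact: m_ge0.
have mv : measurable_fun [set: borel X] v := weight_meas1.
have mind i : measurable_fun [set: borel X] (\1_(U i) : borel X -> R).
  exact: measurable_indic.
have ind0 i x : 0 <= \1_(U i) x :> R by rewrite indicE ler0n.
split.
- exact: wL1_solid mv v1.
- exact: am_bound_wL1 bK.
- exact: am_bound_wL1 bo.
- by have bT := am_bound_T m_adm bo; exact: am_bound_wL1 bT.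
- exists D^-1; first by rewrite invr_ge0 ltW.
  move=> F i y LF Uy.
  have n0 : 0 <= wL1n mu (m^~ z) F by exact: (wL1n_ge0 mu v1).
  apply: (@le_trans _ _ (wL1n mu (m^~ z) F)%:E).
    rewrite -(wL1nE v1 LF); apply: nnint_le.
    + by apply: measurable_funM; [exact: cmeas_rnorm LF.1|exact: mind].
    + exact: (wL1_meas mv LF.1).
    + by move=> x; apply: mulr_ge0; [exact: rnorm_ge0|exact: ind0].
    + apply: aeW => x; apply: ler_wpM2l; first exact: rnorm_ge0.
      by apply: le_trans (v1 x); rewrite indicE lern1 leq_b1.
  rewrite lee_fin mulrAC mulrC -[leLHS]mulr1.
  rewrite [leRHS](_ : _ = wL1n mu (m^~ z) F * (mass i / D * m y z)); last by ring.
  apply: ler_wpM2l => //; apply: le_trans (v1 y) _; apply: ler_peMl => //.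
    exact: v0.
  by rewrite ler_pdivlMr // mul1r.
- move=> i; have hm : cmeasurable (fun x : borel X => (\1_(U i) x)%:C : R[i]).
    by apply: cmeas_real; exact: mind.
  apply: (wL1_dom mv v1 hm (g := fun x => (CmU * m (xs i) z) * \1_(U i) x)).
  + by apply: measurable_funM; [exact: measurable_cst|exact: mind].
  + apply: aeW => x; rewrite rnormC ger0_norm ?ind0 //.
    rewrite indicE; have [xU|xU] := boolP (x \in U i); last by rewrite mul0r mulr0.
    by rewrite mul1r mulr1; apply: weight_moderate (set_mem xU) (xsU i).
  + rewrite (nnintZ mu (mind i) (ind0 i)); last first.
      by rewrite mulr_ge0 // (le_trans ler01 CmU_ge1).
    by rewrite integral_indic // setIT [mu _]massE -EFinM ltry.
Qed.

(* The almost everywhere bound on the columns of [K] transfers to every column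
   by comparison with a generic point of the same member of the covering. *)
Lemma column_bound (K : X -> X -> R[i]) (o : X -> X -> R) (nR dl : R) :
  am_bound mu m (fun x y => rnorm (K x y)) nR -> am_bound mu m o dl ->
  (forall i x y y', U i y -> U i y' -> rnorm (K x y - K x y') <= o x y) ->
  forall x, (\int[mu]_y (rnorm (K y x) * m y z)%:E <= (CmU * (nR + dl) * m x z)%:E)%E.
Proof.
move=> [K0 mK _ cK] [g_ge0 mo _ co] oK x; have [i Ux] := covU x.
have [x' Ux' [hK ho]] : exists2 x', U i x' &
    (\int[mu]_y (rnorm (K y x') * m y x')%:E <= nR%:E)%E /\
    (\int[mu]_y (o y x' * m y x')%:E <= dl%:E)%E.
  apply: contrapT => h.
  have : mu (U i) = 0%E.
    apply/negligibleP; first exact: mU.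
    apply: (negligibleS _ (filterI cK co)) => y Uy /= hy.
    by apply: h; exists y.
  by rewrite massE => -[/eqP]; rewrite gt_eqF.
have sK t : measurable_fun [set: borel X] (fun y : borel X => rnorm (K y t)).
  exact: (@section_meas2 _ _ (borel X) (fun p => rnorm (K p.1 p.2)) t mK).
have so t : measurable_fun [set: borel X] (fun y : borel X => o y t).
  exact: (@section_meas2 _ _ (borel X) (fun p => o p.1 p.2) t mo).
have sm t : measurable_fun [set: borel X] (fun y : borel X => m y t).
  exact: (@section_meas2 _ _ (borel X) (fun p => m p.1 p.2) t (weight_meas m_adm X_sc)).
have c0 : 0 <= CmU * m x z by rewrite mulr_ge0 // (le_trans ler01 CmU_ge1).
have f0 y : 0 <= rnorm (K y x') * m y x' by rewrite mulr_ge0 ?rnorm_ge0.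
have g0 y : 0 <= o y x' * m y x' by exact: (mulr_ge0 (g_ge0 _ _)).
have mf : measurable_fun [set: borel X] (fun y : borel X => rnorm (K y x') * m y x').
  exact: measurable_funM.
have mg : measurable_fun [set: borel X] (fun y : borel X => o y x' * m y x').
  exact: measurable_funM.
apply: (@le_trans _ _ (\int[mu]_y ((CmU * m x z) *
    (rnorm (K y x') * m y x' + o y x' * m y x'))%:E)%E).
  apply: nnint_le.
  + by apply: measurable_funM; [exact: sK|exact: sm].
  + by apply: measurable_funM; [exact: measurable_cst|exact: measurable_funD].
  + by move=> y; rewrite mulr_ge0 ?rnorm_ge0.
  apply: aeW => y; rewrite -mulrDl.
  have h1 : rnorm (K y x) <= rnorm (K y x') + o y x'.
    have := rnormD (K y x') (K y x - K y x'); rewrite addrC subrK => h.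
    by apply: le_trans h _; rewrite lerD2l rnorm_distC; exact: oK Ux' Ux.
  have h2 : m y z <= m y x' * (CmU * m x z).
    apply: le_trans (m_sub y z x') _; apply: ler_wpM2l => //.
    exact: weight_moderate Ux' Ux.
  apply: le_trans (ler_pM (rnorm_ge0 _) (m_ge0 _ _) h1 h2) _.
  by rewrite le_eqVlt; apply/orP; left; apply/eqP; ring.
rewrite nnintZ; [|exact: measurable_funD|by move=> y; exact: addr_ge0|exact: c0].
rewrite nnintD; [|exact: mf|exact: f0|exact: mg|exact: g0].
apply: (@le_trans _ _ ((CmU * m x z)%:E * (nR%:E + dl%:E))%E).
  by apply: lee_wpmul2l; [rewrite lee_fin|exact: leeD].
by rewrite -EFinD -EFinM lee_fin mulrAC.
Qed.
End WeightedL1Space.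

End CoveringInstances.

(** * The oscillation kernel *)

Section Oscillation.
Context (R : realType) (X : ptopologicalType) (I : choiceType) (U : I -> set X).
Variables (K : X -> X -> R[i]) (B : R).
Hypothesis KB : forall x y, rnorm (K x y) <= B.
Hypothesis covU : forall y, exists i, U i y.

Let osc_set x y := [set rnorm (K x y - K x z) | z in Qset U y].

Let osc_set_ub x y : has_ubound (osc_set x y).
Proof.
exists (B + B) => _ [t _ <-]; apply: le_trans (rnormB _ _) _.
by apply: lerD; exact: KB.
Qed.

(** The real-valued [sup] dominates the elements of the set only if the set is bounded, which is the
    purpose of the uniform bound [B] on [K]. *)
Lemma osc_le i x y y' : U i y -> U i y' ->
  rnorm (K x y - K x y') <= complex.Re (osc K U x y).
Proof.
by move=> Uy Uy'; apply: ub_le_sup (osc_set_ub x y) _ _; exists y' => //; exists i.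
Qed.

Lemma osc_ge0 x y : 0 <= complex.Re (osc K U x y).
Proof. by have [i Uy] := covU y; apply: le_trans (osc_le x Uy Uy); exact: rnorm_ge0. Qed.
End Oscillation.

(** * Discretization of a continuous frame *)

Theorem theorem5p7
  (R : realType)
  (H : completeNormedModType R[i]) (ip : {dot H for (@conjC R[i])})
  (X : ptopologicalType) (mu : {measure set (borel X) -> \bar R})
  (psi : X -> H) (m : X -> X -> R)
  (Y : set (X -> R[i])) (nY : (X -> R[i]) -> R)
  (z : X) (I : countType) (U : I -> set X) (CmU delta : R) (x : I -> X)
  (H_hilbert : hilbert_norm ip) (H_separable : separable_space H)
  (X_hausdorff : hausdorff_space X) (X_lc : locally_compact [set: X])
  (X_sc : sigma_compact X)
  (mu_radon : radon_measure mu) (mu_supp : full_support mu)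
  (psi_frame : continuous_frame ip mu psi)
  (m_adm : admissible_weight m)
  (Y_1 : property_Y1 mu Y nY) (Y_2 : property_Y2 mu m Y nY)
  (R_Am : Am mu m (frame_kernel ip mu psi))
  (delta_gt0 : 0 < delta)
  (psi_D : property_D mu (frame_kernel ip mu psi) m delta U CmU)
  (delta_small :
    let nR := Am_norm mu m (frame_kernel ip mu psi) in
    (delta%:E * (nR + maxe (CmU%:E * nR) (nR + delta%:E)) <= 1)%E)
  (x_in_U : forall i, U i (x i)) :
  let v := fun y : X => m y z in
  let H1v := H1 ip mu psi v in
  let K1v := K1 ip mu psi v in
  let CoY := Co ip mu psi v Y in
  let nCoY := Co_norm psi nY in
  let CotY := Co_tilde ip mu psi v Y in
  let nCotY := Co_tilde_norm ip mu psi nY in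
  let Yf := Yflat U Y in
  let nYf := Yflat_norm U nY in
  let Yn := Ynatural mu U Y in
  let nYn := Ynatural_norm mu U nY in
  let synthesis_cvg := fun (s : {fset I} -> H -> R[i]) (f : H -> R[i]) =>
    (finite_sequences_dense Yn nYn -> norm_cvg CotY nCotY s f) /\
    (~ finite_sequences_dense Yn nYn -> weakstar_cvg H1v s f) in
  [/\ forall i, K1v (psi (x i)),
      atomic_decomposition CotY nCotY Yn nYn synthesis_cvg
        (fun i => embed ip H1v (psi (x i))),
      banach_frame CoY nCoY Yf nYf (fun i f => f (psi (x i))) &
      exists e : I -> H,
      [/\ forall i, H1v (e i),
          norm_equivalence CoY nCoY Yf nYf (fun i f => f (psi (x i))),
          norm_equivalence CotY nCotY Yn nYn (fun i f => f (e i)),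
          forall f, CotY f -> synthesis_cvg
            (partial_sum (fun i => f (e i) *: embed ip H1v (psi (x i)))) f &
          finite_sequences_dense Yf nYf -> forall f, CoY f ->
            norm_cvg CoY nCoY
              (partial_sum (fun i => f (psi (x i)) *: embed ip K1v (e i))) f]].
Proof.
move=> v H1v K1v CoY nCoY CotY nCotY Yf nYf Yn nYn synthesis_cvg.
pose phi := dual_frame ip mu psi; pose K := frame_kernel ip mu psi.
have pq := frame_dual_pair H_hilbert psi_frame.
have [cov mCU o_Am o_delta] := psi_D.
have [D [N [D0 mU massP covU finU]]] := covering_mass X_hausdorff mu_radon cov.
have pU i : compact (closure (U i)) by rewrite -precompactE; have [[]] := cov.
(* Full support applied to the whole space, which is nonempty. *)
have mu0 : mu [set: borel X] != 0%E.
  by rewrite gt_eqF //; apply: mu_supp; [exact: openT|exists point].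
have [B KB] : exists B, forall s t, rnorm (K s t) <= B.
  have [M hM] := dp_bound pq; exists (M * M) => s t.
  apply: le_trans (ip_CS H_hilbert _ _) _.
  by apply: ler_pM; rewrite ?rnorm_ge0 ?(hM t).1 ?(hM s).2.
pose o s t := complex.Re (osc K U s t).
have o0 s t : 0 <= o s t by exact: osc_ge0 KB covU s t.
have o_bound i s t t' : U i t -> U i t' -> rnorm (K s t - K s t') <= o s t.
  exact: osc_le.
pose nR := fine (Am_norm mu m K); pose dl := fine (Am_norm mu m (osc K U)).
have bK : am_bound mu m (fun s t => rnorm (K s t)) nR by exact: (Am_am_bound m_adm X_sc mu0 R_Am).
have bo : am_bound mu m o dl.
  have := Am_am_bound m_adm X_sc mu0 o_Am.
  have -> // : (fun s t => rnorm (osc K U s t)) = o.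
  by apply/funext => s; apply/funext => t; rewrite rnormC ger0_norm //; exact: o0.
have nRE : Am_norm mu m K = nR%:E.
  by rewrite fineK // ge0_fin_numE ?Am_norm_ge0 //; case: R_Am.
have dlE : Am_norm mu m (osc K U) = dl%:E.
  by rewrite fineK // ge0_fin_numE ?Am_norm_ge0 //; case: o_Am.
have nR0 : 0 <= nR by rewrite -lee_fin -nRE Am_norm_ge0.
have dl0 : 0 <= dl by rewrite -lee_fin -dlE Am_norm_ge0.
(* The term [nR + delta] of the maximum gives [delta * (nR + (nR + delta)) <= 1]; strictness comes
   from [dl < delta]. *)
have theta1 : theta nR dl < 1.
  have dl_lt : dl < delta by rewrite -lte_fin -dlE.
  have h : delta * (nR + (nR + delta)) <= 1.
    rewrite -lee_fin; apply: le_trans delta_small; rewrite nRE EFinM.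
    apply: lee_wpmul2l; first by rewrite lee_fin ltW.
    by rewrite EFinD; apply: leeD (lexx _) _; rewrite le_max lexx orbT.
  by rewrite /theta; nra.
have YC := Y_core_space m_adm X_hausdorff X_sc Y_1 Y_2 z mU pU (fun i => (massP i).1) D0
  (fun i => (massP i).2) covU x_in_U mCU nR0 dl0 bK bo.
have LC := wL1_core_space m_adm X_hausdorff X_sc mu_radon z mU (fun i => (massP i).1) D0
  (fun i => (massP i).2) covU x_in_U mCU nR0 dl0 bK bo.
have K_herm s t : K s t = conjC (K t s).
  by rewrite /K /frame_kernel -ip_herm; exact: (dp_kernel pq s t).
have mK s : cmeasurable (K s : borel X -> R[i]).
  have -> : K s = (fun t => conjC (ip (psi s) (phi t))) by apply/funext => t; exact: K_herm.
  by apply: cmeas_conj; exact: (dp_measr pq (psi s)).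
have mo := am_meas bo.
(* The constant [C0] of the column bound is [CmU * (nR + dl)], and [CmU] also serves as the
   moderateness constant of the weight. *)
have [e [h1 h2 h3 h4 [h5 h6]]] := @discretization R _ (borel X) I mu U x (m^~ z) CmU N K o
  (fun i => fine (mu (U i))) D (CmU * (nR + dl)) nR dl mU (fun i => (massP i).1) D0
  (fun i => (massP i).2) covU (fun y => (finU y).1) (fun y => (finU y).2) x_in_U
  (weight_meas1 m_adm X_sc z) (fun y => let: And5 _ h _ _ _ := m_adm in h y z)
  (CmU_ge1 m_adm z covU mCU) (fun i y y' => @weight_moderate _ _ _ m_adm _ _ z _ mCU i y y')
  K_herm mK o0
  (fun s => @section_meas1 _ _ (borel X) (fun p => o p.1 p.2) s mo)
  (fun t => @section_meas2 _ _ (borel X) (fun p => o p.1 p.2) t mo)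
  o_bound
  (column_bound m_adm X_sc z mU (fun i => (massP i).1) D0 (fun i => (massP i).2) covU mCU
     bK bo o_bound)
  (fun s t => dp_int pq (psi t) (phi s)) (fun s t => dp_id pq (psi t) (phi s))
  nR0 dl0 LC theta1 H ip psi phi H_hilbert pq (fun s t => erefl) Y nY YC.
(* By unfolding, [CoY] is [coorb] for the pair [(psi, phi)] and [CotY] for [(phi, psi)], and the
   sequence spaces are those of [flatF] and [natF]. *)
split; [by move=> i; have [] := h1 i|exact: h2|exact: h3|exists e; split].
- by move=> i; have [] := h1 i.
- by have [_ _ _ h _] := h3.
- exact: h4.
- exact: h5.
- exact: h6.
Qed.
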